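(* Let $\varphi$ be a function analytic in $\mathbb{D}$ such that $\varphi'\in C_A$. Suppose that $T$ and $R$ are contractions on a Hilbert space such that $T-R\in\boldsymbol{S}_2$, and let $T_t=(1-t)T+tR$, $t\in[0,1]$. Then the function $$ t\mapsto\varphi(T_t),\quad 0\le t\le1, $$ is differentiable in the Hilbert–Schmidt norm and $$ \frac{d}{ds}\varphi(T_s)\Big|_{s=0}=\iint\limits_{\mathbb{T}\times\mathbb{T}}\frac{\varphi(\zeta)-\varphi(\tau)}{\zeta-\tau}\,d\mathcal{E}(\zeta)\,(R-T)\,d\mathcal{E}(\tau), $$ where $\mathcal{E}$ is a semi-spectral measure of $T$.
   Context: $\mathbb{D}$ is the open unit disk, $\mathbb{T}$ the unit circle; $\boldsymbol{S}_2$ is the Hilbert–Schmidt class. A contraction is an operator of norm at most $1$; each $T_t$ is a contraction. $C_A$ is the disk-algebra (functions analytic in $\mathbb{D}$ and continuous on the closed disk). For $f\in C_A$ and a contraction $T$, $f(T)$ is defined by extending the polynomial calculus by continuity using von Neumann's inequality. The divided difference $\frac{\varphi(\zeta)-\varphi(\tau)}{\zeta-\tau}$ is extended to the diagonal by continuity, with value $\varphi'(\zeta)$ at $(\zeta,\zeta)$, $\zeta\in\mathbb{T}$. Differentiability in the Hilbert–Schmidt norm means that the difference quotients $\frac{1}{s}\big(\varphi(T_{t+s})-\varphi(T_t)\big)$ converge in the norm of $\boldsymbol{S}_2$ as $s\to0$ (one-sided at the endpoints of $[0,1]$). Semi-spectral measures: for a measurable space $(\mathcal{X},\mathcal{B})$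 and a Hilbert space $\mathcal{H}$, a semi-spectral measure is a map $\mathcal{E}$ from $\mathcal{B}$ to the bounded operators on $\mathcal{H}$ with $\mathcal{E}(\Delta)\ge0$, $\mathcal{E}(\varnothing)=0$, $\mathcal{E}(\mathcal{X})=I$, countably additive in the weak operator topology. By Naimark's theorem it has a spectral dilation, i.e., a spectral measure $E$ on a Hilbert space $\mathcal{K}\supset\mathcal{H}$ with $\mathcal{E}(\Delta)=P_{\mathcal{H}}E(\Delta)|\mathcal{H}$, and $\int f\,d\mathcal{E}:=P_{\mathcal{H}}\left(\int f\,dE\right)\big|\mathcal{H}$ for bounded measurable $f$ (independent of the dilation). A semi-spectral measure of a contraction $T$ on $\mathcal{H}$ is $\mathcal{E}_T(\Delta)=P_{\mathcal{H}}E_U(\Delta)|\mathcal{H}$, $\Delta\subset\mathbb{T}$ Borel, where $E_U$ is the spectral measure of a unitary dilation $U$ of $T$ (a unitary operator on some $\mathcal{K}\supset\mathcal{H}$ with $T^n=P_{\mathcal{H}}U^n|\mathcal{H}$, $n\ge0$); thus $T^n=\int_{\mathbb{T}}\zeta^n\,d\mathcal{E}_T(\zeta)$, $n\ge0$. Double operator integrals with Hilbert–Schmidt $Q$: for semi-spectral measures $\mathcal{E}_1,\mathcal{E}_2$ (on $\mathcal{X}_1,\mathcal{X}_2$) there is a semi-spectral measure $\mathcal{F}$ on $\mathcal{X}_1\times\mathcal{X}_2$, with values in the bounded operators on the Hilbert space of Hilbert–Schmidt operators, such that $\mathcal{F}(\Delta_1\times\Delta_2)Q=\mathcal{E}_1(\Delta_1)Q\,\mathcal{E}_2(\Delta_2)$;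 for bounded measurable $\Phi$ on $\mathcal{X}_1\times\mathcal{X}_2$ and $Q\in\boldsymbol{S}_2$, $\iint\Phi\,d\mathcal{E}_1\,Q\,d\mathcal{E}_2:=\left(\int\Phi\,d\mathcal{F}\right)Q$. *)

(* Defs.v *)
From HB Require Import structures.
From mathcomp Require Import all_boot all_order all_algebra.
From mathcomp Require Import finmap complex.
From mathcomp Require Import all_classical all_reals all_analysis.
From mathcomp Require Import summability.

Set Implicit Arguments.
Unset Strict Implicit.
Unset Printing Implicit Defensive.
Import Order.TTheory GRing.Theory Num.Theory numFieldNormedType.Exports.
Local Open Scope classical_set_scope.
Local Open Scope ring_scope.
Local Open Scope complex_scope.

(* The complex field R[i] as a normed space over itself.  Norms take values in
   R[i]; its partial order makes [0 < eps] mean that [eps] is real and positive. *)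
HB.instance Definition _ (R : realType) := NormedModule.copy R[i] R[i]^o.

(** Complex Hilbert spaces; [hdot] is linear in its first argument. *)

HB.mixin Record isHilbert (R : realType) H & CompleteNormedModule R[i] H := {
  hdot : {dot H for (@Num.conj R[i])} ;
  hdotE : forall x : H, `|x| ^+ 2 = hdot x x }.

#[short(type="hilbertType")]
HB.structure Definition Hilbert (R : realType) :=
  {H of CompleteNormedModule R[i] H & isHilbert R H}.

Section HilbertSchmidt.
Context {R : realType}.
Implicit Type H : hilbertType R.

Definition contraction_op H (T : H -> H) := forall x, `|T x| <= `|x|.

Definition bounded_op H (T : H -> H) :=
  exists M : R[i], forall x, `|T x| <= M * `|x|.

Definition unitary_op H (U : H -> H) :=
  (forall x y, hdot (U x) (U y) = hdot x y) /\ (forall y, exists x, U x = y).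

Definition orthonormal_set H (B : set H) :=
  forall x y, B x -> B y -> hdot x y = (x == y)%:R.

Definition orthonormal_basis H (B : set H) :=
  orthonormal_set B /\ (forall x, (forall e, B e -> hdot x e = 0) -> x = 0).

Lemma orthonormal_basis_exists H : exists B : set H, orthonormal_basis B.
Proof.
have [|B [oB maxB]] := @Zorn_bigcup H (@orthonormal_set H).
  move=> F FP Ftot x y [X FX Xx] [Y FY Yy].
  have [XY|YX] := Ftot _ _ FX FY.
  - by apply: (FP _ FY) => //; exact: XY.
  - by apply: (FP _ FX) => //; exact: YX.
exists B; split => // x xB; apply/eqP/negPn/negP => x0.
have nx0 : `|x| != 0 by rewrite normr_eq0.
pose u := `|x|^-1 *: x.
have uu : hdot u u = 1.
  by rewrite -hdotE normrZ normfV normr_id mulVf// expr1n.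
have uB e : B e -> hdot u e = 0 by move=> Be; rewrite linearZl_LR/= xB// mulr0.
have Bu e : B e -> hdot e u = 0.
  by move=> Be; rewrite hermC/= uB// conjC0 mulr0.
have nBu : ~ B u by move=> /uB; rewrite uu => /eqP; rewrite oner_eq0.
apply: (maxB (u |` B)).
  by split=> [y By|/(_ u (or_introl erefl))//]; right.
move=> a b [->|Ba] [->|Bb].
- by rewrite uu eqxx.
- rewrite uB//; case: eqP => // ub; by case: nBu; rewrite ub.
- rewrite Bu//; case: eqP => // ub; by case: nBu; rewrite -ub.
- exact: oB.
Qed.

Definition onb H : set H := sval (cid (orthonormal_basis_exists H)).

Arguments onb : clear implicits.

Lemma onbP H : orthonormal_basis (onb H).
Proof. exact: (svalP (cid (orthonormal_basis_exists H))). Qed.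

(* The last clause says that the sum of `|A e| ^+ 2 over the basis is finite. *)
Definition hilbert_schmidt H (A : H -> H) :=
  [/\ linear A, bounded_op A &
      exists M : R[i], forall F : {fset H}, (forall e, e \in F -> onb H e) ->
        \sum_(e <- F) `|A e| ^+ 2 <= M].

Definition hs_pred H : {pred (H -> H)%type} := fun A => `[< hilbert_schmidt A >].
Arguments hs_pred : clear implicits.

Lemma hs_submod_closed H : submod_closed (hs_pred H).
Proof.
split.
  apply/asboolP; split.
  - by move=> a x y; rewrite scaler0 addr0.
  - by exists 0 => x; rewrite normr0 mul0r.
  - by exists 0 => F _; rewrite big1// => e _; rewrite normr0 expr0n.
move=> a A B /asboolP[lA [M bA] [sA SA]] /asboolP[lB [N bB] [sB SB]].
apply/asboolP; split.
- move=> c x y; rewrite !fctE lA lB !scalerDr !scalerA (mulrC a) addrACA.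
  by [].
- exists (`|a| * M + N) => x.
  rewrite !fctE (le_trans (ler_normD _ _))// mulrDl lerD//.
  by rewrite normrZ -mulrA ler_wpM2l.
- exists (`|a| ^+ 2 * sA *+ 2 + sB *+ 2) => F FB.
  apply: (@le_trans _ _ (`|a| ^+ 2 * (\sum_(e <- F) `|A e| ^+ 2) *+ 2 +
                         (\sum_(e <- F) `|B e| ^+ 2) *+ 2)); last first.
    by rewrite lerD// lerMn2r/= ?ler_wpM2l ?exprn_ge0 ?SA ?SB.
  rewrite mulr_sumr -!sumrMnl -big_split/=; apply: ler_sum => e _.
  rewrite -exprMn -normrZ !fctE.
  have : 0 <= (`|a *: A e| - `|B e|) ^+ 2.
    by rewrite -realEsqr realB.
  rewrite sqrrB addrAC subr_ge0 => ab.
  rewrite (@le_trans _ _ ((`|a *: A e| + `|B e|) ^+ 2))//.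
    by rewrite lerXn2r ?nnegrE ?addr_ge0// ler_normD.
  by rewrite sqrrD addrAC (le_trans (lerD (lexx _) ab))// addrACA -!mulr2n.
Qed.

HB.instance Definition _ H := GRing.isSubmodClosed.Build R[i] (H -> H)
  (hs_pred H) (hs_submod_closed H).

End HilbertSchmidt.
Arguments onb {R} H.
Arguments hs_pred {R} H.

Definition S2 (R : realType) (H : hilbertType R) :=
  {A : H -> H | A \in hs_pred H}.

Section S2.
Context {R : realType} {H : hilbertType R}.
Implicit Types A B D : S2 H.

HB.instance Definition _ := SubChoice.on (S2 H).
HB.instance Definition _ := [SubChoice_isSubLmodule of S2 H by <:].

(* The trace inner product tr (B^* A); [sum] is the unconditional sum over the
   index set [onb H]. *)
Definition hs_dot A B : R[i] :=
  sum (fun e : onb H => hdot (val A (val e)) (val B (val e))).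

Definition hs_norm A : R[i] := sqrtC (hs_dot A A).

(* [D] is the derivative at [t], in the norm of S2, of an operator-valued
   function [F] on [0, 1]; it is one-sided when [t] is an endpoint. *)
Definition hs_derivative (F : R -> H -> H) (t : R) (D : S2 H) :=
  forall eps : R[i], 0 < eps -> exists2 delta : R, 0 < delta &
    forall s : R, s != 0 -> `|s| < delta -> 0 <= t + s <= 1 ->
      exists Q : S2 H,
        (forall x, val Q x = (s^-1)%:C *: (F (t + s) x - F t x)) /\
        hs_norm (Q - D) < eps.

End S2.

(** Semi-spectral measures and operator integrals.  The form [ip] is the inner
    product of [V]; below it is either [hdot] or [hs_dot]. *)

Section SemiSpectral.
Context {R : realType} d {X : measurableType d}.

Definition ip_bounded (V : lmodType R[i]) (ip : V -> V -> R[i])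
    (A : V -> V) :=
  exists M : R[i], forall x, ip (A x) (A x) <= M * ip x x.

Definition semi_spectral (V : lmodType R[i]) (ip : V -> V -> R[i])
    (E : set X -> {linear V -> V}) :=
  [/\ forall D, measurable D ->
        ip_bounded ip (E D) /\ (forall x, 0 <= ip (E D x) x),
      forall x, E set0 x = 0,
      forall x, E setT x = x &
      forall D : nat -> set X, (forall n, measurable (D n)) ->
        trivIset setT D -> forall x y,
        (fun n => \sum_(i < n) ip (E (D i) x) y) @ \oo -->
          ip (E (\bigcup_i D i) x) y].

(* The values are positive and idempotent, hence orthogonal projections. *)
Definition spectral (K : hilbertType R) (E : set X -> {linear K -> K}) :=
  semi_spectral (@hdot R K) E /\
  (forall D, measurable D -> forall x, E D (E D x) = E D x).

(* [B] is the integral of [f] against the spectral measure [E]: the limit in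
   operator norm of the integrals of simple functions converging to [f]
   uniformly. *)
Definition spectral_integral (K : hilbertType R)
    (E : set X -> {linear K -> K}) (f : X -> R[i]) (B : K -> K) :=
  forall eps : R[i], 0 < eps ->
  exists n (c : 'I_n -> R[i]) (D : 'I_n -> set X),
    [/\ forall i, measurable (D i), trivIset setT D,
        \bigcup_i D i = setT,
        forall i x, D i x -> `|f x - c i| <= eps &
        forall h, `|B h - \sum_i c i *: E (D i) h| <= eps * `|h|].

(* [A] is the compression to [V] of [B], where [V] is identified with a
   subspace of [K] through [J]: J (A x) is the orthogonal projection of B (J x)
   onto the range of [J]. *)
Definition compression (V : lmodType R[i]) (K : hilbertType R)
    (J : V -> K) (B : K -> K) (A : V -> V) :=
  forall x y, hdot (B (J x) - J (A x)) (J y) = 0.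

Definition isometric (V : lmodType R[i]) (ip : V -> V -> R[i])
    (K : hilbertType R) (J : V -> K) :=
  forall x y, hdot (J x) (J y) = ip x y.

Definition spectral_dilation (V : lmodType R[i]) (ip : V -> V -> R[i])
    (E : set X -> {linear V -> V}) (K : hilbertType R)
    (J : {linear V -> K}) (EK : set X -> {linear K -> K}) :=
  [/\ isometric ip J, spectral EK &
      forall D, measurable D -> compression J (EK D) (E D)].

(* The integral of [f] against the semi-spectral measure [E]; it does not
   depend on the dilation. *)
Definition semi_spectral_integral (V : lmodType R[i]) (ip : V -> V -> R[i])
    (E : set X -> {linear V -> V}) (f : X -> R[i]) (A : V -> V) :=
  exists (K : hilbertType R) (J : {linear V -> K})
    (EK : set X -> {linear K -> K}) (B : K -> K),
    [/\ spectral_dilation ip E J EK, spectral_integral EK f B &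
        compression J B A].

End SemiSpectral.

(* [D] is the double operator integral of [Phi] against [E1], [Q] and [E2]. *)
Definition double_operator_integral (R : realType) (H : hilbertType R)
    d1 d2 (X1 : measurableType d1) (X2 : measurableType d2)
    (E1 : set X1 -> {linear H -> H}) (E2 : set X2 -> {linear H -> H})
    (Phi : X1 * X2 -> R[i]) (Q D : S2 H) :=
  exists (F : set (X1 * X2) -> {linear S2 H -> S2 H}) (I : S2 H -> S2 H),
    [/\ semi_spectral hs_dot F,
        forall D1 D2, measurable D1 -> measurable D2 -> forall (A : S2 H) x,
          val (F (D1 `*` D2) A) x = E1 D1 (val A (E2 D2 x)),
        semi_spectral_integral hs_dot F Phi I &
        I Q = D].

Section Circle.
Context {R : realType}.

Definition circle_sub := {z : R[i] | `|z| == 1}.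

HB.instance Definition _ := Choice.on circle_sub.
HB.instance Definition _ :=
  isPointed.Build circle_sub (exist _ 1 (introT eqP (normr1 R[i]))).

Definition circle_open : set (set circle_sub) :=
  [set A | exists2 O : set R[i], open O & A = val @^-1` O].

(* The unit circle with its Borel sets. *)
Definition circle := g_sigma_algebraType circle_open.

Definition circle_val (z : circle) : R[i] := sval (z : circle_sub).

Definition semi_spectral_of (H : hilbertType R) (T : {linear H -> H})
    (E : set circle -> {linear H -> H}) :=
  exists (K : hilbertType R) (J : {linear H -> K}) (U : {linear K -> K})
    (EU : set circle -> {linear K -> K}),
    [/\ isometric (@hdot R H) J,
        unitary_op U /\
        (forall n, compression J (iter n U) (iter n T)),
        spectral EU /\ spectral_integral EU circle_val U &
        forall D, measurable D -> compression J (EU D) (E D)].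

End Circle.
Arguments circle R : clear implicits.

Section DiskAlgebra.
Context {R : realType}.
Implicit Types f phi : R[i] -> R[i].

Definition disk : set R[i] := [set z | `|z| < 1].
Definition closed_disk : set R[i] := [set z | `|z| <= 1].

(* Only the values in the open disk matter. *)
Definition analytic_disk f := forall z, disk z -> derivable f z 1.

Definition disk_algebra f :=
  analytic_disk f /\ {within closed_disk, continuous f}.

(* [f], considered as a function on the open disk, belongs to the disk algebra
   once it is extended to the closed disk by continuity. *)
Definition in_disk_algebra f :=
  exists2 g, disk_algebra g & forall z, disk z -> f z = g z.

(* The extension by continuity of a function on the open disk. *)
Definition disk_ext f (z : R[i]) : R[i] := lim (f @ within disk (nbhs z)).

Definition poly_op (H : hilbertType R) (p : {poly R[i]}) (T : H -> H) : H -> H :=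
  fun x => \sum_(i < size p) p`_i *: iter i T x.

(* [A] is the value at [T] of the continuous extension of the polynomial
   calculus to the disk algebra. *)
Definition is_disk_calculus (H : hilbertType R) f (T A : H -> H) :=
  exists p : nat -> {poly R[i]},
    (forall eps : R[i], 0 < eps ->
      \forall n \near \oo, forall z, closed_disk z ->
        `|(p n).[z] - disk_ext f z| <= eps) /\
    (forall eps : R[i], 0 < eps ->
      \forall n \near \oo, forall x, `|poly_op (p n) T x - A x| <= eps * `|x|).

Definition disk_calculus (H : hilbertType R) f (T : H -> H) : H -> H :=
  get [set A | is_disk_calculus f T A].

(* The divided difference of [phi] on the torus, where [phi] and its derivative
   take their boundary values. *)
Definition divided_difference phi (p : circle R * circle R) : R[i] :=
  let z := circle_val p.1 in let w := circle_val p.2 in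
  if z == w then disk_ext (derive1 phi) z
  else (disk_ext phi z - disk_ext phi w) / (z - w).

Definition segment_op (H : hilbertType R) (T S : H -> H) (t : R) : H -> H :=
  fun x => (1 - t)%:C *: T x + t%:C *: S x.

End DiskAlgebra.

(* Main.v *)
Require Import Defs.
From HB Require Import structures.
From mathcomp Require Import all_boot all_order all_algebra.
From mathcomp Require Import finmap complex.
From mathcomp Require Import all_classical all_reals all_analysis.
From mathcomp Require Import summability ring lra.
Import Order.TTheory GRing.Theory Num.Theory numFieldNormedType.Exports.
Set Implicit Arguments.
Unset Strict Implicit.
Unset Printing Implicit Defensive.
Local Open Scope classical_set_scope.
Local Open Scope ring_scope.
Local Open Scope complex_scope.

(* The divided difference of a polynomial [p] is the polynomial
   [\sum_(j, k) p_(j+k+1) z^j w^k], and [p(A) - p(B)] is the operator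
   [X |-> \sum_(j, k) p_(j+k+1) A^j X B^k] applied to [X = A - B].  On the Hilbert
   space of Hilbert-Schmidt operators the commuting contractions [X |-> A X] and
   [X |-> X B] satisfy Brehmer's positivity condition, hence a von Neumann
   inequality: the norm of that operator is at most the supremum over the bidisk
   of the divided difference, that is, at most [sup |p'|] on the disk.
   Polynomials [P n] tending to [phi] on the disk together with their derivatives
   therefore give operators converging in norm, uniformly in [A] and [B], and
   the derivative at [t] is the limit for [A = B = T_t].  For a unitary dilation
   [U] of [T] the same sums with [A = B = U] are the integrals of the divided
   differences of [P n] against a product spectral measure on the Hilbert-Schmidt
   operators of the dilation space.  Those divided differences converge uniformly
   on the torus, and compressing the limit gives the double operator integral. *)

(** * Positive semidefinite forms *)

Section Modulus.
Context {R : realType}.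
Implicit Types z w : R[i].

(** The von Neumann inequality is proved without a dilation: the defect [b x y - b (L x) (L y)] is
    summed along a finite orbit, closed up into a cyclic group where Parseval's identity applies.
    For two variables it is needed for the defect of left multiplication as well as for the trace
    form. Defects may be degenerate, so the tools are stated for positive semidefinite forms. In
    particular [\sum |X B e|^2 <= \sum |X e|^2] for a contraction [B] holds for every such form, by
    Schur's product theorem, and Brehmer's condition is an instance of it. The other obstacle is
    countable additivity of the product measure. On the rank-one operator built from [u] and [v],
    the squared norm of the projection attached to a union of rectangles is its measure for the
    product of the scalar measures [|E A u|^2] and [|E B v|^2]. Finite sums of rank-one operators
    are dense, so on every Hilbert-Schmidt operator the projections are dominated, up to a small
    constant, by a finite measure; this extends them from finite unions of rectangles to the
    sigma-algebra. *)

Definition cabs z : R := Normc.normc z.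

Lemma normcE z : `|z| = (cabs z)%:C. Proof. by []. Qed.

Lemma cabs_ge0 z : 0 <= cabs z.
Proof. by rewrite -lecR -normcE normr_ge0. Qed.

Lemma cabs0 : cabs 0 = 0. Proof. exact: Normc.normc0. Qed.
Lemma cabs1 : cabs 1 = 1. Proof. exact: Normc.normc1. Qed.

Lemma cabsM z w : cabs (z * w) = cabs z * cabs w.
Proof. exact: Normc.normcM. Qed.

Lemma cabsX z n : cabs (z ^+ n) = cabs z ^+ n.
Proof. by elim: n => [|n IH]; rewrite ?expr0 ?cabs1// !exprS cabsM IH. Qed.

Lemma cabsV z : cabs z^-1 = (cabs z)^-1. Proof. exact: Normc.normcV. Qed.

Lemma cabsD z w : cabs (z + w) <= cabs z + cabs w.
Proof. by rewrite -lecR rmorphD/= -!normcE ler_normD. Qed.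

Lemma cabsN z : cabs (- z) = cabs z.
Proof. by apply: (@complexI R); rewrite -!normcE normrN. Qed.

Lemma cabs_distC z w : cabs (z - w) = cabs (w - z).
Proof. by rewrite -cabsN opprB. Qed.

Lemma cabsB z w : cabs (z - w) <= cabs z + cabs w.
Proof. by rewrite (le_trans (cabsD _ _))// cabsN. Qed.

Lemma cabsR (x : R) : cabs x%:C = `|x|.
Proof.
by apply: (@complexI R); rewrite -normcE normc_def/= expr0n/= addr0 sqrtr_sqr.
Qed.

Lemma cabs_eq0 z : (cabs z == 0) = (z == 0).
Proof. by rewrite -(inj_eq (@complexI R)) -normcE normr_eq0. Qed.

Lemma cabs_conj z : cabs (Num.conj z) = cabs z.
Proof. by apply: (@complexI R); rewrite -!normcE norm_conjC. Qed.

Lemma Re_le_cabs z : complex.Re z <= cabs z.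
Proof.
rewrite (le_trans (ler_norm _))// -lecR; exact: normc_ge_Re.
Qed.

Lemma mulcC_cabs z : z * Num.conj z = (cabs z ^+ 2)%:C.
Proof. by rewrite rmorphXn/= -normcE normCK. Qed.

Lemma cabs_sum I (r : seq I) (P : pred I) (f : I -> R[i]) :
  cabs (\sum_(i <- r | P i) f i) <= \sum_(i <- r | P i) cabs (f i).
Proof.
elim/big_ind2: _ => //; first by rewrite cabs0.
by move=> a b c d ab cd; rewrite (le_trans (cabsD _ _))// lerD.
Qed.

Lemma Re_sum I (r : seq I) (P : pred I) (f : I -> R[i]) :
  complex.Re (\sum_(i <- r | P i) f i) = \sum_(i <- r | P i) complex.Re (f i).
Proof. by apply: (big_morph (@complex.Re R)) => // -[a b] [c d]. Qed.

Lemma ReD z w : complex.Re (z + w) = complex.Re z + complex.Re w.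
Proof. by case: z w => a b []. Qed.

Lemma ReB z w : complex.Re (z - w) = complex.Re z - complex.Re w.
Proof. by case: z w => a b []. Qed.

Lemma ReZ (x : R) z : complex.Re (x%:C * z) = x * complex.Re z.
Proof. by case: z => a b /=; rewrite mul0r subr0. Qed.

Lemma Re_conj z : complex.Re (Num.conj z) = complex.Re z.
Proof. by case: z. Qed.

Lemma conjR (x : R) : Num.conj x%:C = x%:C.
Proof. exact: conjc_real. Qed.

Lemma ge0_ReK z : 0 <= z -> (complex.Re z)%:C = z.
Proof. by move=> z0; rewrite RRe_real// ger0_real. Qed.

Lemma ge0_Re z : 0 <= z -> 0 <= complex.Re z.
Proof. by move=> z0; rewrite -lecR ge0_ReK. Qed.

End Modulus.

(** * Semidefinite sesquilinear forms and Schur's product theorem *)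

Section PsdForms.
Context {R : realType} {V : lmodType R[i]}.
Implicit Types (b : V -> V -> R[i]) (x y z : V).

(** Definiteness is left out because the defect forms [b x y - b (L x) (L y)] may vanish on nonzero
    vectors. *)
Definition psd_form b :=
  [/\ forall a x y z, b (a *: x + y) z = a * b x z + b y z,
      forall x y, b x y = Num.conj (b y x) &
      forall x, 0 <= b x x].

Definition qform b x : R := complex.Re (b x x).
Definition snorm b x : R := Num.sqrt (qform b x).

Section Theory.
Variable b : V -> V -> R[i].
Hypothesis psdb : psd_form b.

Lemma psdC x y : b x y = Num.conj (b y x). Proof. by case: psdb. Qed.

Lemma psd0l y : b 0 y = 0.
Proof.
case: psdb => lb _ _; apply: (addIr (b 0 y)); rewrite add0r.
by have := lb 1 0 0 y; rewrite scale1r addr0 mul1r => <-.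
Qed.

Lemma psdDl x y z : b (x + y) z = b x z + b y z.
Proof. by case: psdb => lb _ _; rewrite -(scale1r x) lb scale1r mul1r. Qed.

Lemma psdZl a x y : b (a *: x) y = a * b x y.
Proof. by case: psdb => lb _ _; rewrite -[a *: x]addr0 lb psd0l addr0. Qed.

Lemma psd0r y : b y 0 = 0.
Proof. by rewrite psdC psd0l conjC0. Qed.

Lemma psdDr x y z : b z (x + y) = b z x + b z y.
Proof. by rewrite psdC psdDl rmorphD/= -!psdC. Qed.

Lemma psdZr a x y : b y (a *: x) = Num.conj a * b y x.
Proof. by rewrite psdC psdZl rmorphM/= -psdC. Qed.

Lemma psdNl x y : b (- x) y = - b x y.
Proof. by rewrite -scaleN1r psdZl mulN1r. Qed.

Lemma psdNr x y : b y (- x) = - b y x.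
Proof. by rewrite -scaleN1r psdZr rmorphN1 mulN1r. Qed.

Lemma psdBl x y z : b (x - y) z = b x z - b y z.
Proof. by rewrite psdDl psdNl. Qed.

Lemma psdBr x y z : b z (x - y) = b z x - b z y.
Proof. by rewrite psdDr psdNr. Qed.

Lemma psd_suml I (r : seq I) (P : pred I) (f : I -> V) y :
  b (\sum_(i <- r | P i) f i) y = \sum_(i <- r | P i) b (f i) y.
Proof. by apply: (big_morph (b^~ y)); [move=> *; exact: psdDl|exact: psd0l]. Qed.

Lemma psd_sumr I (r : seq I) (P : pred I) (f : I -> V) y :
  b y (\sum_(i <- r | P i) f i) = \sum_(i <- r | P i) b y (f i).
Proof. by apply: (big_morph (b y)); [move=> *; exact: psdDr|exact: psd0r]. Qed.

Lemma qformE x : b x x = (qform b x)%:C.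
Proof. by case: psdb => _ _ pos; rewrite ge0_ReK. Qed.

Lemma qform_ge0 x : 0 <= qform b x.
Proof. by case: psdb => _ _ pos; exact: ge0_Re. Qed.

Lemma qform0 : qform b 0 = 0. Proof. by rewrite /qform psd0l. Qed.

Lemma qformZ a x : qform b (a *: x) = cabs a ^+ 2 * qform b x.
Proof. by rewrite /qform psdZl psdZr mulrA mulcC_cabs ReZ. Qed.

Lemma qformN x : qform b (- x) = qform b x.
Proof. by rewrite /qform psdNl psdNr opprK. Qed.

Lemma qformD x y :
  qform b (x + y) = qform b x + qform b y + complex.Re (b x y) *+ 2.
Proof.
rewrite /qform !(psdDl, psdDr) !ReD [b y x]psdC Re_conj mulr2n; ring.
Qed.

Lemma qformB x y :
  qform b (x - y) = qform b x + qform b y - complex.Re (b x y) *+ 2.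
Proof. by rewrite qformD qformN psdNr -mulNrn; case: (b x y). Qed.

Lemma psd_CauchySchwarz x y : cabs (b x y) ^+ 2 <= qform b x * qform b y.
Proof.
set m := cabs (b x y).
have key (t : R) :
    0 <= qform b x + t ^+ 2 * m ^+ 2 * qform b y - t * m ^+ 2 *+ 2.
  have := qform_ge0 (x - (t%:C * b x y) *: y).
  rewrite qformB qformZ psdZr cabsM cabsR exprMn real_normK ?num_real//.
  by rewrite rmorphM/= conjR -mulrA [Num.conj _ * _]mulrC mulcC_cabs -rmorphM.
have [qy0|qy0] := eqVneq (qform b y) 0.
  rewrite qy0 mulr0; case: (ltP 0 (m ^+ 2)) => // m2.
  (* Without its quadratic term the right-hand side of [key] is affine in [t], and this [t] makes it
     negative. *)
  have := key ((qform b x + 1) / m ^+ 2 ).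
  rewrite qy0 mulr0 addr0 divfK ?gt_eqF// => h.
  by have := qform_ge0 x; lra.
have qy : 0 < qform b y by rewrite lt_def qy0 qform_ge0.
have := key (qform b y)^-1.
have -> : (qform b y)^-1 ^+ 2 * m ^+ 2 * qform b y = (qform b y)^-1 * m ^+ 2.
  by field.
rewrite -(pmulr_rge0 _ qy) => h; rewrite -subr_ge0; apply: le_trans h _.
by rewrite le_eqVlt; apply/orP; left; apply/eqP; field.
Qed.

Lemma snorm_ge0 x : 0 <= snorm b x. Proof. exact: sqrtr_ge0. Qed.

Lemma sqr_snorm x : snorm b x ^+ 2 = qform b x.
Proof. by rewrite sqr_sqrtr ?qform_ge0. Qed.

Lemma psd_le_snorm x y : cabs (b x y) <= snorm b x * snorm b y.
Proof.
rewrite -(@ler_pXn2r _ 2)// ?nnegrE ?mulr_ge0 ?snorm_ge0 ?cabs_ge0//.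
by rewrite exprMn !sqr_snorm psd_CauchySchwarz.
Qed.

Lemma snormD x y : snorm b (x + y) <= snorm b x + snorm b y.
Proof.
rewrite -(@ler_pXn2r _ 2)// ?nnegrE ?addr_ge0 ?snorm_ge0//.
rewrite sqrrD !sqr_snorm qformD addrAC lerD2r lerD2l lerMn2r/=.
by rewrite (le_trans (Re_le_cabs _))// psd_le_snorm.
Qed.

Lemma snormZ a x : snorm b (a *: x) = cabs a * snorm b x.
Proof. by rewrite /snorm qformZ sqrtrM ?sqr_ge0// sqrtr_sqr ger0_norm ?cabs_ge0. Qed.

Lemma snorm0 : snorm b 0 = 0. Proof. by rewrite /snorm qform0 sqrtr0. Qed.

Lemma snorm_sum I (r : seq I) (P : pred I) (f : I -> V) :
  snorm b (\sum_(i <- r | P i) f i) <= \sum_(i <- r | P i) snorm b (f i).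
Proof.
elim/big_ind2: _ => //; first by rewrite snorm0.
by move=> x s y t xs yt; rewrite (le_trans (snormD _ _))// lerD.
Qed.

End Theory.

(* Induction on [s]: subtracting from [b] the rank-one form
   [b x x0 * b x0 y / b x0 x0] leaves a positive form vanishing at [x0]. *)
Lemma schur_sum_ge0 b (I : eqType) (s : seq I) (W : I -> I -> R[i]) (f : I -> V) :
  psd_form b -> uniq s ->
  (forall u : I -> R[i],
     0 <= \sum_(i <- s) \sum_(j <- s) W i j * (u i * Num.conj (u j))) ->
  0 <= \sum_(i <- s) \sum_(j <- s) W i j * b (f i) (f j).
Proof.
elim: s b W => [|i0 s IH] b W psdb /=; first by rewrite big_nil.
case/andP=> i0s us Wpos.
pose x0 := f i0; pose c := (qform b x0)^-1%:C.
pose b' x y := b x y - c * (b x x0 * Num.conj (b y x0)).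
have c0 : 0 <= c by rewrite ler0c invr_ge0 qform_ge0.
have b'x x : b' x0 x = 0.
  rewrite /b' /c (qformE psdb) -(psdC psdb).
  have [q0|q0] := eqVneq (qform b x0) 0; last first.
    by rewrite mulrA -rmorphM mulVf// mul1r subrr.
  rewrite mulrA -rmorphM q0 mulr0 mul0r subr0.
  (* When [x0] is a null vector, [c] is the inverse of 0, that is 0, and [b x0 x] already vanishes
     by Cauchy-Schwarz. *)
  have := psd_CauchySchwarz psdb x0 x; rewrite q0 mul0r => h.
  have /eqP : cabs (b x0 x) ^+ 2 == 0 by rewrite eq_le h sqr_ge0.
  by move/eqP; rewrite expf_eq0/= cabs_eq0 => /eqP.
have b'C x y : b' x y = Num.conj (b' y x).
  rewrite /b' rmorphB !rmorphM/= conjCK -(psdC psdb x y) /c conjR; ring.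
have psdb' : psd_form b'.
  split=> // [a x y z|x].
    rewrite /b' !(psdDl psdb) !(psdZl psdb); ring.
  rewrite /b' mulcC_cabs (qformE psdb) /c -rmorphM -rmorphB/= ler0c subr_ge0.
  have [q0|q0] := eqVneq (qform b x0) 0.
    by rewrite q0 invr0 mul0r qform_ge0.
  have q0' : 0 < qform b x0 by rewrite lt_def q0 qform_ge0.
  by rewrite mulrC ler_pdivrMr// psd_CauchySchwarz.
have -> : \sum_(i <- i0 :: s) \sum_(j <- i0 :: s) W i j * b (f i) (f j) =
  \sum_(i <- i0 :: s) \sum_(j <- i0 :: s) W i j * b' (f i) (f j) +
  c * \sum_(i <- i0 :: s) \sum_(j <- i0 :: s)
        W i j * (b (f i) x0 * Num.conj (b (f j) x0)).
  rewrite mulr_sumr -big_split/=; apply: eq_bigr => i _.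
  rewrite mulr_sumr -big_split/=; apply: eq_bigr => j _.
  rewrite /b'; ring.
(* The rank-one part is nonnegative by [Wpos] at [u i = b (f i) x0]. *)
rewrite addr_ge0//; last by rewrite mulr_ge0.
have -> : \sum_(i <- i0 :: s) \sum_(j <- i0 :: s) W i j * b' (f i) (f j) =
    \sum_(i <- s) \sum_(j <- s) W i j * b' (f i) (f j).
  rewrite big_cons big1 ?add0r; last by move=> j _; rewrite b'x mulr0.
  by apply: eq_bigr => i _; rewrite big_cons b'C b'x conjC0 mulr0 add0r.
apply: IH => // u.
(* A vector that vanishes at [i0] tests only the submatrix indexed by [s]. *)
have := Wpos (fun i => if i == i0 then 0 else u i).
rewrite big_cons eqxx big1 ?add0r; last by move=> j _; rewrite mul0r mulr0.
rewrite big_seq [in X in _ -> X]big_seq; congr (0 <= _); apply: eq_bigr => i si.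
have /negPf -> : i != i0 by apply: contraNneq i0s => <-.
rewrite big_cons eqxx conjC0 !mulr0 add0r big_seq [RHS]big_seq.
apply: eq_bigr => j sj.
by have /negPf -> : j != i0 by apply: contraNneq i0s => <-.
Qed.
End PsdForms.

(** * A von Neumann inequality *)

Section RootsOfUnity.
Context {R : realType}.

Definition cis (t : R) : R[i] := cos t +i* sin t.

Lemma cisD s t : cis (s + t) = cis s * cis t.
Proof. by rewrite /cis sinD cosD; simpc; congr (_ +i* _); ring. Qed.

Lemma cis0 : cis 0 = 1. Proof. by rewrite /cis cos0 sin0. Qed.

Lemma cabs_cis t : cabs (cis t) = 1.
Proof. by rewrite /cabs /cis /= cos2Dsin2 sqrtr1. Qed.

Lemma cisMn t n : cis (t *+ n) = cis t ^+ n.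
Proof. by elim: n => [|n IH]; rewrite ?mulr0n ?cis0// mulrS cisD IH exprS. Qed.

Lemma cis2pi : cis (pi *+ 2) = 1. Proof. by rewrite /cis cos2pi sin2pi. Qed.

Lemma cis_neq1 t : 0 < t < pi *+ 2 -> cis t != 1.
Proof.
move=> /andP[t0 t2]; apply/eqP => -[ct st].
have [tpi|pit] := ltP t pi.
  by have := @sin_gt0_pi R t; rewrite t0 tpi st ltxx => /(_ isT).
have [tpi|tpi] := eqVneq t pi.
  by move: ct; rewrite tpi cospi => h; have : (0:R) < 1 by []; rewrite -h; lra.
have : 0 < t - pi < pi.
  by rewrite subr_gt0 lt_neqAle eq_sym tpi pit/=; move: t2; rewrite mulr2n; lra.
move/sin_gt0_pi; rewrite sinB st cospi sinpi; lra.
Qed.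

Definition unity_root (N : nat) : R[i] := cis (pi *+ 2 / N%:R).

Lemma unity_root_exp N k : unity_root N ^+ k = cis ((pi *+ 2) * (k%:R / N%:R)).
Proof. by rewrite /unity_root -cisMn -mulr_natr; congr cis; ring. Qed.

Lemma unity_rootN N : (0 < N)%N -> unity_root N ^+ N = 1.
Proof.
by move=> N0; rewrite unity_root_exp divff ?mulr1 ?cis2pi// pnatr_eq0 -lt0n.
Qed.

Lemma cabs_unity_root N : cabs (unity_root N) = 1.
Proof. exact: cabs_cis. Qed.

Lemma unity_root_neq1 N k : (0 < k < N)%N -> unity_root N ^+ k != 1.
Proof.
move=> /andP[k0 kN]; rewrite unity_root_exp; apply: cis_neq1.
have N0 : (0 : R) < N%:R by rewrite ltr0n (leq_trans _ kN).
have p0 := pi_gt0 R.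
have p2 : 0 < (pi : R) *+ 2 by rewrite pmulrn_lgt0.
apply/andP; split; first by rewrite mulr_gt0// divr_gt0// ltr0n.
by rewrite -[ltRHS]mulr1 ltr_pM2l// ltr_pdivrMr// mul1r ltr_nat.
Qed.

Lemma unity_root_sum N k : (0 < k < N)%N ->
  \sum_(j < N) (unity_root N ^+ k) ^+ j = 0.
Proof.
move=> kN; have /andP[k0 kN'] := kN.
have := subrX1 (unity_root N ^+ k) N.
rewrite exprAC unity_rootN ?expr1n ?(leq_trans _ kN')// subrr => /esym/eqP.
by rewrite mulf_eq0 subr_eq0 (negPf (unity_root_neq1 kN)) => /eqP.
Qed.

Lemma unity_root_orth N (i j : 'I_N) :
  \sum_(k < N) unity_root N ^+ (i * k) * Num.conj (unity_root N ^+ (j * k)) =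
  N%:R * (i == j)%:R.
Proof.
set w := unity_root N.
have N0 : (0 < N)%N by rewrite (leq_trans _ (ltn_ord i)).
have cw m : Num.conj (w ^+ m) * w ^+ m = 1.
  by rewrite mulrC mulcC_cabs cabsX cabs_unity_root !expr1n.
have w0 m : w ^+ m != 0.
  by apply/eqP => w0; have := cw m; rewrite w0 mulr0 => /eqP; rewrite eq_sym oner_eq0.
have [->|ij] := eqVneq i j.
  rewrite mulr1 (eq_bigr (fun=> 1)); first by rewrite sumr_const card_ord.
  by move=> k _; rewrite mulrC cw.
rewrite mulr0.
wlog lij : i j ij / (i < j)%N.
  move=> W; case: (ltngtP i j) => [ltij|ji|/val_inj/eqP].
  - exact: W.
  - have := W j i; rewrite eq_sym => /(_ ij ji)/(congr1 Num.conj).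
    rewrite rmorph0 rmorph_sum/= => h; rewrite -[RHS]h; apply: eq_bigr => k _.
    by rewrite rmorphM/= conjCK mulrC.
  - by rewrite (negPf ij).
(* The quotient of [w ^+ i] by [w ^+ j] is the positive power [N - (j - i)] of [w], because
   [w ^+ N = 1]. *)
have kN : (0 < N - (j - i) < N)%N.
  by rewrite subn_gt0 ltn_subrL subn_gt0 lij N0 (leq_ltn_trans (leq_subr _ _)).
rewrite -[RHS](unity_root_sum kN); apply: eq_bigr => k _.
apply: (mulIf (w0 (j * k)%N)); rewrite -mulrA cw mulr1 -exprM -exprD -/w.
have -> : ((N - (j - i)) * k + j * k = (N + i) * k)%N.
  rewrite -mulnDl subnBA ?(ltnW lij)// subnK//.
  by rewrite (leq_trans (ltnW (ltn_ord j)))// leq_addr.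
by rewrite mulnDl exprD [w ^+ (N * k)]exprM unity_rootN ?expr1n ?mul1r.
Qed.

End RootsOfUnity.

(** * Fourier analysis on a finite cyclic group *)

Section CyclicGroup.
Context {R : realType} {V : lmodType R[i]}.
Variable b : V -> V -> R[i].
Hypothesis psdb : psd_form b.

Lemma cyclic_parseval N (v : 'I_N -> V) :
  \sum_(k < N) qform b (\sum_(j < N) unity_root N ^+ (j * k) *: v j) =
  N%:R * \sum_(j < N) qform b (v j).
Proof.
apply: (@complexI R); rewrite rmorph_sum rmorphM rmorph_sum rmorph_nat/=.
rewrite (eq_bigr (fun k : 'I_N => \sum_(i < N) \sum_(j < N)
   (unity_root N ^+ (i * k) * Num.conj (unity_root N ^+ (j * k))) *
   b (v i) (v j))); last first.
  move=> k _; rewrite -(qformE psdb) (psd_suml psdb); apply: eq_bigr => i _.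
  rewrite (psd_sumr psdb); apply: eq_bigr => j _.
  by rewrite (psdZl psdb) (psdZr psdb) mulrA.
rewrite exchange_big/= mulr_sumr; apply: eq_bigr => i _.
rewrite exchange_big/= (bigD1 i)//= [X in _ + X]big1 ?addr0; last first.
  move=> j ji; rewrite -mulr_suml unity_root_orth eq_sym (negPf ji).
  by rewrite mulr0 mul0r.
by rewrite -mulr_suml unity_root_orth eqxx mulr1 (qformE psdb).
Qed.

(** The discrete Fourier transform turns the cyclic convolution with the [C a] into the action of
    the symbol [\sum_a z ^+ a *: C a] at roots of unity [z]. The hypothesis bounds the symbol there,
    and Parseval's identity is applied on both sides. *)
Lemma cyclic_convolution_le d (C : nat -> {linear V -> V}) (M : R) N
    (v : 'I_N.+1 -> V) :
  (forall z, cabs z = 1 -> forall x,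
     qform b (\sum_(a < d) z ^+ a *: C a x) <= M * qform b x) ->
  \sum_(j < N.+1) qform b (\sum_(a < d) C a (v (inord ((j + a) %% N.+1)))) <=
  M * \sum_(j < N.+1) qform b (v j).
Proof.
move=> CM; rewrite -(ler_pM2l (ltr0Sn R N)) mulrCA -!cyclic_parseval mulr_sumr.
apply: ler_sum => k _; set w := unity_root N.+1.
(* A shift by [a] multiplies the transform by the inverse of [w ^+ (k * a)], which is [z ^+ a]. *)
pose z := Num.conj (w ^+ k).
have wz : cabs z = 1 by rewrite cabs_conj cabsX cabs_unity_root expr1n.
have wk : w ^+ k * z = 1 by rewrite mulcC_cabs -[cabs _]cabs_conj wz expr1n.
have -> : \sum_(j < N.+1) w ^+ (j * k) *:
     (\sum_(a < d) C a (v (inord ((j + a) %% N.+1)))) =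
   \sum_(a < d) z ^+ a *: C a (\sum_(j < N.+1) w ^+ (j * k) *: v j).
  under eq_bigr do rewrite scaler_sumr.
  rewrite exchange_big/=; apply: eq_bigr => a _.
  rewrite linear_sum scaler_sumr/=.
  pose s (j : 'I_N.+1) : 'I_N.+1 := inord ((j + a) %% N.+1).
  have sE j : (s j = (j + a) %% N.+1 :> nat)%N by rewrite inordK// ltn_mod.
  have sinj : injective s.
    move=> i j /(congr1 val) /=; rewrite !sE => /eqP; rewrite eqn_modDr.
    by rewrite !modn_small// => /eqP/val_inj.
  rewrite [RHS](reindex_inj sinj)/=; apply: eq_bigr => j _.
  rewrite linearZ/= scalerA; congr (_ *: _).
  rewrite [in RHS]mulnC [in RHS]exprM sE expr_mod; last first.
    by rewrite exprAC unity_rootN ?expr1n.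
  by rewrite exprD mulrCA -exprMn [z * _]mulrC wk expr1n mulr1 -exprM mulnC.
exact: CM.
Qed.

End CyclicGroup.

(** * The von Neumann inequality with operator coefficients *)

Section VonNeumann.
Context {R : realType} {V : lmodType R[i]}.
Variable b : V -> V -> R[i].
Hypothesis psdb : psd_form b.

Lemma iter_linear_sum (L : {linear V -> V}) n I (r : seq I) (P : pred I)
    (f : I -> V) :
  iter n L (\sum_(i <- r | P i) f i) = \sum_(i <- r | P i) iter n L (f i).
Proof. by elim: n => // n IH; rewrite iterS IH linear_sum. Qed.

Lemma iter_linearZ (L : {linear V -> V}) n a x :
  iter n L (a *: x) = a *: iter n L x.
Proof. by elim: n => // n IH; rewrite iterS IH linearZ. Qed.

Lemma iter_comm (f g : V -> V) n x :
  (forall x, f (g x) = g (f x)) -> f (iter n g x) = iter n g (f x).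
Proof. by move=> fg; elim: n => // n IH; rewrite !iterS fg IH. Qed.

Lemma psd_defect (L : {linear V -> V}) :
  (forall x, qform b (L x) <= qform b x) ->
  psd_form (fun x y => b x y - b (L x) (L y)).
Proof.
move=> Lc; split=> [a x y z|x y|x].
- rewrite linearP !(psdDl psdb) !(psdZl psdb); ring.
- by rewrite rmorphB/= -!(psdC psdb).
- by rewrite !(qformE psdb) -rmorphB/= ler0c subr_ge0.
Qed.

Lemma qform_defect (L : {linear V -> V}) x :
  qform (fun x y => b x y - b (L x) (L y)) x = qform b x - qform b (L x).
Proof. by rewrite /qform ReB. Qed.

Lemma expr_small (r e : R) : 0 <= r < 1 -> 0 < e -> exists n, r ^+ n < e.
Proof.
move=> /andP[r0 r1] e0.
have /cvgrPdist_lt/(_ e e0)[n _ /(_ n (leqnn n))] : r ^+ n @[n --> \oo] --> (0 : R).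
  by apply: cvg_expr; rewrite ger0_norm.
by rewrite /= sub0r normrN ger0_norm ?exprn_ge0// => h; exists n.
Qed.

(* The defect of [L] sums along an orbit to [qform b x] in the limit, and on a
   finite piece of the orbit, wrapped around a cyclic group, Parseval's identity
   turns [\sum_a iter a L (C a x)] into multiplication by [\sum_a z ^+ a *: C a]. *)
Lemma von_neumann_strict d (C : nat -> {linear V -> V}) (L : {linear V -> V})
    (M r : R) :
  0 <= M -> 0 <= r < 1 ->
  (forall a x, C a (L x) = L (C a x)) ->
  (forall x, qform b (L x) <= r * qform b x) ->
  (forall z, cabs z = 1 -> forall x,
    let y := \sum_(a < d) z ^+ a *: C a x in
    qform b y - qform b (L y) <= M * (qform b x - qform b (L x))) ->
  forall x, qform b (\sum_(a < d) iter a L (C a x)) <= M * qform b x.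
Proof.
move=> M0 /andP[r0 r1] CL Lr CM x.
have Lc z : qform b (L z) <= qform b z.
  by rewrite (le_trans (Lr z))// ler_piMl ?(qform_ge0 psdb)// ltW.
pose b' x y := b x y - b (L x) (L y).
have psdb' : psd_form b' := psd_defect Lc.
have tele n z : \sum_(j < n) qform b' (iter j L z) = qform b z - qform b (iter n L z).
  elim: n => [|n IH]; first by rewrite big_ord0 subrr.
  by rewrite big_ord_recr IH /= qform_defect addrA subrK.
have Lit n z : qform b (iter n L z) <= r ^+ n * qform b z.
  elim: n => [|n IH]; first by rewrite mul1r.
  by rewrite iterS exprS -mulrA (le_trans (Lr _))// ler_wpM2l.
set y := \sum_(a < d) _.
have key n : qform b y * (1 - r ^+ n) <= M * qform b x.
  rewrite mulrBr mulr1 [_ * r ^+ _]mulrC.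
  apply: (@le_trans _ _ (\sum_(j < n) qform b' (iter j L y))).
    by rewrite tele lerB.
  case: n => [|n]; first by rewrite big_ord0 mulr_ge0 ?(qform_ge0 psdb).
  (* For [j <= n] and [a < d] the index [j + a] stays below the length [(n + d).+1], so nothing
     wraps around at the positions that count; the other positions add nonnegative terms. *)
  pose v (j : 'I_(n + d).+1) := iter j L x.
  have iterLy j : iter j L y = \sum_(a < d) C a (iter (j + a) L x).
    rewrite /y iter_linear_sum; apply: eq_bigr => a _.
    by rewrite -iterD -iter_comm.
  apply: (@le_trans _ _ (\sum_(j < (n + d).+1)
      qform b' (\sum_(a < d) C a (v (inord ((j + a) %% (n + d).+1)))))).
    rewrite (big_ord_widen_cond (n + d).+1 xpredT (fun j => qform b' (iter j L y)))/=; last first.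
      by rewrite ltnS leq_addr.
    rewrite [leRHS](bigID (fun j : 'I_(n + d).+1 => j < n.+1)%N)/= -[leLHS]addr0 lerD//.
      apply: ler_sum => j jn; rewrite iterLy le_eqVlt; apply/orP; left.
      apply/eqP; congr qform; apply: eq_bigr => a _; rewrite /v inordK ?ltn_mod// modn_small//.
      by rewrite ltnS leq_add// ltnW.
    by apply: sumr_ge0 => j _; exact: qform_ge0.
  apply: (@le_trans _ _ (M * \sum_(j < (n + d).+1) qform b' (v j))).
    apply: (cyclic_convolution_le psdb' (C := C) (M := M) v) => z z1 w.
    by rewrite !qform_defect; exact: CM.
  rewrite ler_wpM2l// /v tele gerBl.
  exact: qform_ge0.
rewrite leNgt; apply/negP => lt.
have y0 : 0 < qform b y by rewrite (le_lt_trans _ lt)// mulr_ge0// (qform_ge0 psdb).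
(* Once [r ^+ n] is below this gap, [key n] contradicts [lt]. *)
have [//||n hn] := @expr_small r (1 - M * qform b x / qform b y).
- by rewrite r0.
- by rewrite subr_gt0 ltr_pdivrMr// mul1r.
have := key n; apply/negP; rewrite -ltNge [ltRHS]mulrC -ltr_pdivrMr//; lra.
Qed.

(** [von_neumann_strict] is applied to [r L] and [r] tends to 1. The defect of [r L] is [1 - r ^+ 2]
    times [b] plus [r ^+ 2] times the defect of [L], which is why the symbol has to be bounded for
    both forms. *)
Lemma von_neumann d (C : nat -> {linear V -> V}) (L : {linear V -> V}) (M : R) :
  0 <= M ->
  (forall a x, C a (L x) = L (C a x)) ->
  (forall x, qform b (L x) <= qform b x) ->
  (forall z, cabs z = 1 -> forall x,
    let y := \sum_(a < d) z ^+ a *: C a x in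
    qform b y <= M * qform b x /\
    qform b y - qform b (L y) <= M * (qform b x - qform b (L x))) ->
  forall x, qform b (\sum_(a < d) iter a L (C a x)) <= M * qform b x.
Proof.
move=> M0 CL Lc CM x; set y := \sum_(a < d) _.
pose K := \sum_(a < d) a%:R * snorm b (iter a L (C a x)).
have K0 : 0 <= K by apply: sumr_ge0 => a _; rewrite mulr_ge0 ?ler0n ?snorm_ge0.
suff key (r : R) : 0 <= r < 1 -> snorm b y <= Num.sqrt (M * qform b x) + (1 - r) * K.
  rewrite -(sqr_snorm psdb) -[leRHS]sqr_sqrtr ?mulr_ge0 ?(qform_ge0 psdb)//.
  rewrite ler_pXn2r ?nnegrE ?snorm_ge0 ?sqrtr_ge0//.
  apply/ler_addgt0Pr => e e0.
  (* This value of [1 - r] makes [(1 - r) * K] at most [e]. *)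
  have e1 : 0 < e / (K + e) <= 1.
    by rewrite divr_gt0 ?ler_pdivrMr ?mul1r ?lerDr ?ltr_wpDl.
  apply: (le_trans (key (1 - e / (K + e)) _)); first by lra.
  rewrite lerD2l opprB addrCA subrr addr0 mulrAC ler_pdivrMr ?ltr_wpDl//.
  by rewrite mulrDr lerDl mulr_ge0// ltW.
move=> r01; have /andP[r0 r1] := r01.
pose rc : R[i] := r%:C; pose L' : {linear V -> V} := rc \*: L.
have L'E x' : L' x' = rc *: L x' by [].
have iterL' n z : iter n L' z = rc ^+ n *: iter n L z.
  elim: n z => [|n IH] z; first by rewrite scale1r.
  by rewrite iterS IH L'E linearZ scalerA -exprS -iterS.
have crc : cabs rc = r by rewrite cabsR ger0_norm.
have bnd : qform b (\sum_(a < d) iter a L' (C a x)) <= M * qform b x.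
  apply: (@von_neumann_strict d C L' M (r ^+ 2)) => //.
  - by rewrite sqr_ge0 expr_lt1.
  - by move=> a z; rewrite !L'E linearZ CL.
  - by move=> z; rewrite L'E (qformZ psdb) crc ler_wpM2l ?sqr_ge0.
  - move=> z z1 w; have [] := CM z z1 w.
    set y' := \sum_(a < d) _ => h1 h2.
    change (qform b y' - qform b (rc *: L y') <= M * (qform b w - qform b (rc *: L w))).
    rewrite !(qformZ psdb) !crc; have := ler_wpM2l (sqr_ge0 r) h2.
    have r2 : 0 <= 1 - r ^+ 2 by rewrite subr_ge0 expr_le1// ltW.
    have := ler_wpM2l r2 h1.
    lra.
have -> : y = \sum_(a < d) iter a L' (C a x) + (y - \sum_(a < d) iter a L' (C a x)).
  by rewrite addrC subrK.
apply: (le_trans (snormD psdb _ _)); apply: lerD; first by rewrite /snorm ler_wsqrtr.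
rewrite /y -sumrB (le_trans (snorm_sum psdb _ _ _))// /K mulr_sumr.
apply: ler_sum => a _; rewrite iterL' -[X in X - _]scale1r -scalerBl (snormZ psdb) mulrA.
rewrite ler_wpM2r ?snorm_ge0//.
have -> : 1 - rc ^+ a = (1 - r ^+ a)%:C by rewrite rmorphB rmorphXn rmorph1.
rewrite cabsR.
rewrite ger0_norm ?subr_ge0 ?exprn_ile1// ?(ltW r1)//.
have -> : 1 - r ^+ a = (1 - r) * \sum_(i < a) r ^+ i by rewrite -[in LHS](opprB _ 1) subrX1 -mulNr opprB.
rewrite ler_wpM2l ?subr_ge0 ?(ltW r1)// -[leRHS]mulr1n -[in leRHS](card_ord a) mulr1n.
rewrite -sumr_const; apply: ler_sum => i _; rewrite exprn_ile1// ltW//.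
Qed.

End VonNeumann.

Definition mk_linear (K : nzRingType) (U V : lmodType K) (f : U -> V)
    (lf : linear f) : {linear U -> V} :=
  HB.pack f (GRing.isLinear.Build K U V *:%R f lf).

Lemma mk_linearE (K : nzRingType) (U V : lmodType K) (f : U -> V)
  (lf : linear f) x : mk_linear lf x = f x.
Proof. by []. Qed.

(** * Hilbert spaces and Hilbert-Schmidt operators *)

Section RealNorm.
Context {R : realType} {V : normedModType R[i]}.
Implicit Types x y : V.

(** Taking the real part moves the estimates to the ordered field [R]. *)
Definition rnorm x : R := complex.Re `|x|.

Lemma rnormE x : `|x| = (rnorm x)%:C.
Proof. by rewrite /rnorm ge0_ReK. Qed.

Lemma rnorm_ge0 x : 0 <= rnorm x. Proof. by rewrite ge0_Re. Qed.

Lemma rnormD x y : rnorm (x + y) <= rnorm x + rnorm y.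
Proof. by rewrite -lecR rmorphD/= -!rnormE ler_normD. Qed.

Lemma rnormN x : rnorm (- x) = rnorm x. Proof. by rewrite /rnorm normrN. Qed.

Lemma rnormB x y : rnorm (x - y) <= rnorm x + rnorm y.
Proof. by rewrite -(rnormN y) rnormD. Qed.

Lemma rnorm_distC x y : rnorm (x - y) = rnorm (y - x).
Proof. by rewrite /rnorm distrC. Qed.

Lemma rnormZ a x : rnorm (a *: x) = cabs a * rnorm x.
Proof. by apply: (@complexI R); rewrite rmorphM/= -!rnormE normrZ. Qed.

Lemma rnorm0 : rnorm 0 = 0. Proof. by rewrite /rnorm normr0. Qed.

Lemma rnorm_eq0 x : rnorm x = 0 -> x = 0.
Proof. by move=> x0; apply/eqP; rewrite -normr_eq0 rnormE x0. Qed.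

Lemma rnorm_dist_triangle x y z : rnorm (x - y) <= rnorm (x - z) + rnorm (z - y).
Proof. by rewrite (le_trans _ (rnormD _ _))// addrA subrK. Qed.

Lemma rnorm_sum I (r : seq I) (P : pred I) (f : I -> V) :
  rnorm (\sum_(i <- r | P i) f i) <= \sum_(i <- r | P i) rnorm (f i).
Proof.
elim/big_ind2: _ => //; first by rewrite rnorm0.
by move=> x s y t xs yt; rewrite (le_trans (rnormD _ _))// lerD.
Qed.

Lemma rnorm_small_eq x y : (forall e : R, 0 < e -> rnorm (x - y) <= e) -> x = y.
Proof.
move=> h; apply/eqP; rewrite -subr_eq0; apply/eqP/rnorm_eq0/eqP.
by rewrite eq_le rnorm_ge0 andbT; apply/ler_addgt0Pr => e /h; rewrite add0r.
Qed.

End RealNorm.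

Lemma complex_gt0P (R : realType) (e : R[i]) : 0 < e -> exists2 r : R, 0 < r & e = r%:C.
Proof.
move=> e0; have := ge0_ReK (ltW e0); move: (complex.Re e) => r re.
by exists r => //; rewrite -ltcR re.
Qed.

Lemma ltr0C (R : realType) (d : R) : (0 < d%:C) = (0 < d).
Proof. exact: (ltcR 0). Qed.

(** Limits are carried with an explicit error sequence, so that a bound is available at every index
    and not only eventually. *)
Definition rate (R : realType) (e : nat -> R) :=
  forall d, 0 < d -> exists N, forall n, (N <= n)%N -> e n <= d.

Lemma rate_inv (R : realType) : rate (fun n => (n.+1%:R)^-1 : R).
Proof.
move=> d d0; have [N hN] := ltr_add_invr d0; exists N => n Nn.
rewrite add0r in hN; rewrite (le_trans _ (ltW hN))// lef_pV2 ?posrE ?ltr0Sn//.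
by rewrite ler_nat ltnS.
Qed.

Lemma rateZ (R : realType) (c : R) (e : nat -> R) : 0 <= c -> rate e ->
  rate (fun n => c * e n).
Proof.
move=> c0 re d d0; have c1 : 0 < c + 1 by rewrite ltr_wpDl.
have [N hN] := re (d / (c + 1)) (divr_gt0 d0 c1).
exists N => n /hN; rewrite ler_pdivlMr// => h; rewrite mulrC.
have [e0|e0] := leP 0 (e n); first by rewrite (le_trans _ h)// ler_wpM2l// lerDl.
by rewrite (le_trans _ (ltW d0))// mulr_le0_ge0// ltW.
Qed.

Lemma complete_rate (R : realType) (V : completeNormedModType R[i])
    (u : nat -> V) (e : nat -> R) :
  rate e ->
  (forall m n, (m <= n)%N -> rnorm (u m - u n) <= e m) ->
  exists l, forall m, rnorm (u m - l) <= e m.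
Proof.
move=> re ue.
have /cauchy_cvg/cvg_ex[l ul] : cauchy (u @ \oo).
  apply: cauchy_exP => eps /complex_gt0P[d d0 ->].
  have [N hN] := re _ (divr_gt0 d0 (ltr0n R 2)).
  exists (u N); exists N => // n /= Nn; rewrite -ball_normE /ball_/= rnormE ltcR.
  rewrite (le_lt_trans (ue _ _ Nn))// (le_lt_trans (hN _ (leqnn N)))//.
  by rewrite ltr_pdivrMr// ltr_pMr// ltr1n.
exists l => m; apply/ler_addgt0Pr => d d0.
have dc : 0 < d%:C by rewrite ltr0C.
have /cvgrPdist_lt/(_ _ dc)[N _ hN] := ul.
have := hN (maxn N m) (leq_maxl _ _); rewrite rnormE ltcR => h.
rewrite (le_trans (rnorm_dist_triangle _ _ (u (maxn N m))))// lerD ?ue ?leq_maxr//.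
by rewrite rnorm_distC ltW.
Qed.

(** * Orthonormal bases, adjoints and trace inequalities *)

Section HilbertSpace.
Context {R : realType}.
Implicit Types H : hilbertType R.

Lemma hdot_psd H : psd_form (@hdot R H).
Proof.
split=> [a x y z|x y|x].
- by rewrite linearDl linearZl_LR.
- by rewrite hermC/= expr0 mul1r.
- by rewrite -hdotE exprn_ge0.
Qed.

Lemma rnorm_snorm H (x : H) : rnorm x = snorm (@hdot R H) x.
Proof.
rewrite /snorm /qform -hdotE rnormE -rmorphXn /= sqrtr_sqr.
by rewrite ger0_norm ?rnorm_ge0.
Qed.

Lemma sqr_rnorm H (x : H) : rnorm x ^+ 2 = qform (@hdot R H) x.
Proof. by rewrite rnorm_snorm sqr_snorm//; exact: hdot_psd. Qed.

Lemma hdot_rnorm H (x y : H) : cabs (hdot x y) <= rnorm x * rnorm y.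
Proof. by rewrite !rnorm_snorm psd_le_snorm//; exact: hdot_psd. Qed.

Lemma hdotxx H (x : H) : hdot x x = (rnorm x ^+ 2)%:C.
Proof. by rewrite -hdotE rnormE rmorphXn. Qed.

Lemma hdotC H (x y : H) : hdot x y = Num.conj (hdot y x).
Proof. exact: (psdC (hdot_psd H)). Qed.

Lemma hdotDl H (x y z : H) : hdot (x + y) z = hdot x z + hdot y z.
Proof. exact: (psdDl (hdot_psd H)). Qed.

Lemma hdotBl H (x y z : H) : hdot (x - y) z = hdot x z - hdot y z.
Proof. exact: (psdBl (hdot_psd H)). Qed.

Lemma hdotBr H (x y z : H) : hdot z (x - y) = hdot z x - hdot z y.
Proof. exact: (psdBr (hdot_psd H)). Qed.

Lemma hdotZr H a (x y : H) : hdot y (a *: x) = Num.conj a * hdot y x.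
Proof. exact: (psdZr (hdot_psd H)). Qed.

Lemma hdotZl H a (x y : H) : hdot (a *: x) y = a * hdot x y.
Proof. exact: (psdZl (hdot_psd H)). Qed.

Lemma hdot_suml H I (r : seq I) (P : pred I) (f : I -> H) y :
  hdot (\sum_(i <- r | P i) f i) y = \sum_(i <- r | P i) hdot (f i) y.
Proof. exact: (psd_suml (hdot_psd H)). Qed.

Lemma hdot_sumr H I (r : seq I) (P : pred I) (f : I -> H) y :
  hdot y (\sum_(i <- r | P i) f i) = \sum_(i <- r | P i) hdot y (f i).
Proof. exact: (psd_sumr (hdot_psd H)). Qed.

Lemma hdot_eq H (x y : H) : (forall z, hdot x z = hdot y z) -> x = y.
Proof.
move=> xy; apply/eqP; rewrite -subr_eq0 -normr_eq0 rnormE.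
have : hdot (x - y) (x - y) = 0 by rewrite linearBl/= xy subrr.
rewrite hdotxx => /(congr1 (@complex.Re R))/= /eqP.
by rewrite expf_eq0/= => /eqP ->.
Qed.

Lemma onb_orth H (e f : H) : onb H e -> onb H f -> hdot e f = (e == f)%:R.
Proof. by have [orth _] := onbP H; exact: orth. Qed.

Lemma onb_norm H (e : H) : onb H e -> rnorm e = 1.
Proof.
move=> be; have := onb_orth be be; rewrite eqxx hdotxx => /(congr1 (@complex.Re R))/=.
by move/eqP; rewrite sqrf_eq1 => /orP[/eqP//|/eqP h]; have := rnorm_ge0 e; rewrite h; lra.
Qed.

Definition basis_fset H (F : {fset H}) := forall e, e \in F -> onb H e.

Lemma basis_fset0 H : basis_fset (fset0 : {fset H}).
Proof. by move=> e; rewrite inE. Qed.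

Lemma basis_fsetU H (F G : {fset H}) :
  basis_fset F -> basis_fset G -> basis_fset (F `|` G)%fset.
Proof. by move=> bF bG e; rewrite inE => /orP[/bF|/bG]. Qed.

Lemma basis_fset1 H (e : H) : onb H e -> basis_fset [fset e]%fset.
Proof. by move=> be f; rewrite inE => /eqP ->. Qed.

Lemma hdot_basis_sum H (c : H -> R[i]) (F : {fset H}) e :
  basis_fset F -> onb H e ->
  hdot (\sum_(f <- F) c f *: f) e = if e \in F then c e else 0.
Proof.
move=> bF be; rewrite hdot_suml; case: ifPn => eF; last first.
  rewrite big_seq big1// => f fF; rewrite hdotZl onb_orth//; last exact: bF.
  by case: eqP fF eF => [-> ->|]//; rewrite mulr0.
rewrite (big_fsetD1 e)//= hdotZl onb_orth// eqxx mulr1 big_seq big1 ?addr0// => f.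
rewrite !inE => /andP[fe fF]; rewrite hdotZl onb_orth//; last exact: bF.
by rewrite (negPf fe) mulr0.
Qed.

Lemma rnorm_basis_sum H (c : H -> R[i]) (F : {fset H}) :
  basis_fset F ->
  rnorm (\sum_(f <- F) c f *: f) ^+ 2 = \sum_(f <- F) cabs (c f) ^+ 2.
Proof.
move=> bF; apply: (@complexI R); rewrite -hdotxx hdot_sumr rmorph_sum/=.
rewrite big_seq [RHS]big_seq; apply: eq_bigr => f fF.
by rewrite hdotZr hdot_basis_sum// ?fF ?mulcC_cabs 1?mulrC ?mulcC_cabs//; exact: bF.
Qed.

(** This is Bessel's inequality for the adjoint of [T] at [y], obtained before the adjoint exists.
    With [s] the sum and [w] the vector of coefficients [hdot y (T e)], both [hdot y (T w)] and the
    squared norm of [w] equal [s]; Cauchy-Schwarz bounds [s] by a multiple of its square root. *)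
Lemma bessel_bounded H1 H2 (T : {linear H1 -> H2}) (M : R) y (F : {fset H1}) :
  (forall x, rnorm (T x) <= M * rnorm x) -> basis_fset F ->
  \sum_(e <- F) cabs (hdot y (T e)) ^+ 2 <= (M * rnorm y) ^+ 2.
Proof.
move=> TM bF; set s := \sum_(e <- F) _.
pose w := \sum_(e <- F) hdot y (T e) *: e.
have s0 : 0 <= s by apply: sumr_ge0 => e _; rewrite sqr_ge0.
have ws : rnorm w ^+ 2 = s by exact: rnorm_basis_sum.
have yw : hdot y (T w) = s%:C.
  rewrite linear_sum hdot_sumr rmorph_sum/=; apply: eq_bigr => e _.
  by rewrite linearZ hdotZr mulrC mulcC_cabs.
have : s <= rnorm y * (M * rnorm w).
  apply: (@le_trans _ _ (rnorm y * rnorm (T w))); last by rewrite ler_wpM2l ?rnorm_ge0.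
  by have := hdot_rnorm y (T w); rewrite yw cabsR ger0_norm.
have [->|sn0] := eqVneq s 0; first by rewrite sqr_ge0.
have sp : 0 < s by rewrite lt_def sn0.
rewrite mulrCA mulrA => h.
have h2 : s ^+ 2 <= (M * rnorm y * rnorm w) ^+ 2.
  by rewrite lerXn2r// nnegrE// (le_trans s0).
by move: h2; rewrite [leRHS]exprMn ws expr2 ler_pM2r.
Qed.

Lemma bessel H (y : H) (F : {fset H}) : basis_fset F ->
  \sum_(e <- F) cabs (hdot y e) ^+ 2 <= rnorm y ^+ 2.
Proof.
move=> bF; rewrite -[rnorm y]mul1r.
by apply: (@bessel_bounded H H idfun) => // x; rewrite mul1r.
Qed.

Lemma bounded_fset_sup (T : choiceType) (P : {fset T} -> Prop) (f : {fset T} -> R)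
    (M : R) :
  (exists F, P F) -> (forall F, P F -> f F <= M) ->
  exists2 s, (forall F, P F -> f F <= s) &
    (forall d, 0 < d -> exists2 F, P F & s - d < f F).
Proof.
move=> [F0 PF0] fM; pose S := [set f F | F in P].
have S0 : S !=set0 by exists (f F0), F0.
have Sb : has_ubound S by exists M => _ [F PF <-]; exact: fM.
exists (sup S); first by move=> F PF; apply: ub_le_sup => //; exists F.
move=> d d0; have [_ [F PF <-] h] := @sup_adherent R S d d0 (conj S0 Sb).
by exists F.
Qed.

(** The basis may be uncountable, so the expansion is a limit along finite subsets. If the sums of
    squares over [F] and over [G] are within [d ^+ 2] of the supremum [s], Pythagoras in [F] union
    [G] puts the partial sums within [2 d] of each other; a sequence of nearly optimal sets is
    therefore Cauchy. *)
Lemma riesz_fischer H (c : H -> R[i]) (M : R) :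
  (forall F, basis_fset F -> \sum_(e <- F) cabs (c e) ^+ 2 <= M) ->
  exists2 h : H,
    (forall e, onb H e -> hdot h e = c e) &
    (forall d, 0 < d -> exists2 F0, basis_fset F0 & forall F, basis_fset F ->
       (F0 `<=` F)%fset -> rnorm (h - \sum_(e <- F) c e *: e) <= d).
Proof.
move=> cM; pose S (F : {fset H}) := \sum_(e <- F) cabs (c e) ^+ 2.
pose u (F : {fset H}) := \sum_(e <- F) c e *: e.
have [s Ss sS] := @bounded_fset_sup H (@basis_fset H) S M
   (ex_intro _ fset0 (@basis_fset0 H)) cM.
have S_sub (F G : {fset H}) : (F `<=` G)%fset -> S F <= S G.
  move=> FG; rewrite /S (big_fsetID _ (mem F) G)/=.
  have -> : [fset x in G | x \in F]%fset = F.
    by apply/fsetP => x; rewrite !inE; apply: andb_idl => /(fsubsetP FG).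
  by rewrite lerDl; apply: sumr_ge0 => x _; rewrite sqr_ge0.
have uFG_sub (F G : {fset H}) : basis_fset G -> (F `<=` G)%fset ->
    rnorm (u G - u F) ^+ 2 = S G - S F.
  move=> bG FG; have E : [fset x in G | x \in F]%fset = F.
    by apply/fsetP => x; rewrite !inE; apply: andb_idl => /(fsubsetP FG).
  rewrite /S /u (big_fsetID _ (mem F) G)/= E addrAC subrr add0r.
  rewrite [in RHS](big_fsetID _ (mem F) G)/= E [RHS]addrAC subrr add0r.
  by rewrite rnorm_basis_sum// => x; rewrite !inE => /andP[/bG].
have near_u (F G : {fset H}) d : basis_fset F -> basis_fset G -> 0 <= d ->
    s - d ^+ 2 <= S F -> s - d ^+ 2 <= S G -> rnorm (u F - u G) <= d *+ 2.
  move=> bF bG d0 SF SG; have bFG := basis_fsetU bF bG.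
  rewrite (le_trans (rnorm_dist_triangle _ _ (u (F `|` G)%fset)))// mulr2n.
  have aux (E : {fset H}) : basis_fset E -> (E `<=` F `|` G)%fset ->
      s - d ^+ 2 <= S E -> rnorm (u (F `|` G)%fset - u E) <= d.
    move=> bE EFG SE; rewrite -(@ler_pXn2r _ 2)// ?nnegrE ?rnorm_ge0//.
    by rewrite uFG_sub//; have := Ss _ bFG; lra.
  by rewrite rnorm_distC; apply: lerD; apply: aux; rewrite ?fsubsetUl ?fsubsetUr.
pose d n : R := n.+1%:R^-1.
have d0 n : 0 < d n by rewrite invr_gt0 ltr0Sn.
pose Fn n := sval (cid2 (sS _ (exprn_gt0 2 (d0 n)))).
have bFn n : basis_fset (Fn n) by rewrite /Fn; case: cid2.
have SFn n : s - d n ^+ 2 <= S (Fn n) by rewrite /Fn; case: cid2 => /= F _ /ltW.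
have dmn m n : (m <= n)%N -> d n <= d m.
  by move=> mn; rewrite lef_pV2 ?posrE ?ltr0Sn// ler_nat ltnS.
have rd : rate (fun n => 2 * d n) by apply: rateZ => //; exact: rate_inv.
have [|h hu] := @complete_rate R H (fun n => u (Fn n)) _ rd.
  move=> m n mn; rewrite mulr_natl; apply: near_u => //; first exact: ltW.
  by rewrite (le_trans _ (SFn n))// lerB// lerXn2r ?nnegrE ?dmn// ltW.
have cvg (e : R) : 0 < e -> exists2 F0, basis_fset F0 & forall F, basis_fset F ->
       (F0 `<=` F)%fset -> rnorm (h - u F) <= e.
  move=> e0; have [N hN] := rd _ (divr_gt0 e0 (ltr0n R 2)).
  exists (Fn N) => // F bF FNF.
  rewrite (le_trans (rnorm_dist_triangle _ _ (u (Fn N))))// [leRHS]splitr lerD//.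
    by rewrite rnorm_distC (le_trans (hu N))// hN.
  rewrite (le_trans _ (hN N _))// mulr_natl; apply: near_u => //; first exact: ltW.
  by rewrite (le_trans (SFn N))// S_sub.
exists h => // e be; apply/eqP; rewrite -subr_eq0 -cabs_eq0 eq_le cabs_ge0 andbT.
apply/ler_addgt0Pr => eps /cvg[F0 bF0 /(_ ([fset e] `|` F0)%fset)].
have bF : basis_fset ([fset e] `|` F0)%fset by apply: basis_fsetU => //; exact: basis_fset1.
move=> /(_ bF (fsubsetUr _ _)) hF; rewrite add0r.
have -> : c e = hdot (u ([fset e] `|` F0)%fset) e.
  by rewrite hdot_basis_sum// !inE eqxx.
by rewrite -linearBl/= (le_trans (hdot_rnorm _ _))// (onb_norm be) mulr1.
Qed.

Lemma onb_expansion H (x : H) d : 0 < d ->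
  exists2 F0, basis_fset F0 & forall F, basis_fset F -> (F0 `<=` F)%fset ->
    rnorm (x - \sum_(e <- F) hdot x e *: e) <= d.
Proof.
have [h he hd] := @riesz_fischer H (hdot x) _ (bessel x).
suff xh : x = h by rewrite {1}xh; exact: hd.
apply/eqP; rewrite -subr_eq0; apply/eqP; have [_ compl] := onbP H.
by apply: compl => e be; rewrite linearBl/= he// subrr.
Qed.

Lemma bounded_linear_onb H (V : normedModType R[i]) (T : {linear H -> V}) (M : R) x e :
  (forall x, rnorm (T x) <= M * rnorm x) -> 0 < e ->
  exists2 F0, basis_fset F0 & forall F, basis_fset F -> (F0 `<=` F)%fset ->
    rnorm (T x - \sum_(f <- F) hdot x f *: T f) <= e.
Proof.
move=> TM e0; have M0 : 0 < `|M| + 1 by rewrite ltr_wpDl.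
have [F0 bF0 hF0] := onb_expansion x (divr_gt0 e0 M0); exists F0 => // F bF F0F.
have -> : \sum_(f <- F) hdot x f *: T f = T (\sum_(f <- F) hdot x f *: f).
  by rewrite linear_sum; apply: eq_bigr => f _; rewrite linearZ.
rewrite -linearB (le_trans (TM _))//.
have := hF0 _ bF F0F; rewrite ler_pdivlMr// => h; rewrite (le_trans _ h)// mulrC.
by rewrite ler_wpM2l ?rnorm_ge0// (le_trans (ler_norm M))// lerDl.
Qed.

(** [S y] is the vector with coefficients [hdot y (T e)], square summable by [bessel_bounded]. The
    adjoint relation at [x] is checked on finite parts of the expansion of [x]. *)
Lemma adjoint_exists H1 H2 (T : {linear H1 -> H2}) (M : R) :
  0 <= M -> (forall x, rnorm (T x) <= M * rnorm x) ->
  exists S : {linear H2 -> H1}, (forall x y, hdot (S y) x = hdot y (T x)) /\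
    (forall y, rnorm (S y) <= M * rnorm y).
Proof.
move=> M0 TM.
have ex y : exists h : H1, forall x, hdot h x = hdot y (T x).
  have [h he _] := @riesz_fischer H1 (fun e => hdot y (T e)) _
    (fun F bF => bessel_bounded y TM bF).
  exists h => x; apply/eqP; rewrite -subr_eq0 -cabs_eq0 eq_le cabs_ge0 andbT.
  apply/ler_addgt0Pr => d d0; rewrite add0r.
  pose A := rnorm h + rnorm y; have A0 : 0 < A + 1 by rewrite ltr_wpDl ?addr_ge0 ?rnorm_ge0.
  have [F1 bF1 hF1] := onb_expansion x (divr_gt0 d0 A0).
  have [F2 bF2 hF2] := bounded_linear_onb x TM (divr_gt0 d0 A0).
  set F := (F1 `|` F2)%fset; have bF : basis_fset F by exact: basis_fsetU.
  have {}hF1 := hF1 F bF (fsubsetUl _ _); have {}hF2 := hF2 F bF (fsubsetUr _ _).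
  have -> : hdot h x - hdot y (T x) =
     hdot h (x - \sum_(f <- F) hdot x f *: f) -
     hdot y (T x - \sum_(f <- F) hdot x f *: T f).
    rewrite !linearBr/= !hdot_sumr.
    suff -> : \sum_(f <- F) hdot h (hdot x f *: f) =
      \sum_(f <- F) hdot y (hdot x f *: T f) by ring.
    by rewrite big_seq [RHS]big_seq; apply: eq_bigr => f fF; rewrite !hdotZr he//; exact: bF.
  rewrite (le_trans (cabsB _ _))//.
  apply: (@le_trans _ _ (rnorm h * (d / (A + 1)) + rnorm y * (d / (A + 1)))).
    by rewrite lerD// (le_trans (hdot_rnorm _ _))// ler_wpM2l ?rnorm_ge0.
  rewrite -mulrDl mulrA ler_pdivrMr// mulrC ler_wpM2l ?(ltW d0)// /A; lra.
pose S y := sval (cid (ex y)).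
have SE y x : hdot (S y) x = hdot y (T x) by rewrite /S; case: cid.
have lS : linear S.
  by move=> a y z; apply: hdot_eq => x; rewrite linearDl/= hdotZl !SE linearDl/= hdotZl.
exists (mk_linear lS); split=> [x y|y]; first exact: SE.
rewrite mk_linearE.
have : rnorm (S y) ^+ 2 <= rnorm y * (M * rnorm (S y)).
  have := SE y (S y); rewrite hdotxx => h.
  rewrite (_ : _ ^+ 2 = cabs (hdot y (T (S y)))); last first.
    by rewrite -h cabsR ger0_norm ?sqr_ge0.
  by rewrite (le_trans (hdot_rnorm _ _))// ler_wpM2l ?rnorm_ge0.
have [->|Sy0] := eqVneq (rnorm (S y)) 0.
  by rewrite mulr_ge0 ?rnorm_ge0.
by rewrite mulrCA mulrA expr2 ler_pM2r// lt_def Sy0 rnorm_ge0.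
Qed.

Lemma onb_expansion_seq H1 H (B : H1 -> H) (s : seq H1) d : 0 < d ->
  exists2 G, basis_fset G & forall x, x \in s ->
    rnorm (B x - \sum_(g <- G) hdot (B x) g *: g) <= d.
Proof.
(* Asking for the bound on every larger finite set lets it survive the unions made in the
   induction. *)
move=> d0; suff [G bG hG] : exists2 G, basis_fset G & forall x, x \in s ->
    forall G', basis_fset G' -> (G `<=` G')%fset ->
    rnorm (B x - \sum_(g <- G') hdot (B x) g *: g) <= d.
  by exists G => // x xs; exact: hG.
elim: s => [|x s [G bG hG]]; first by exists fset0 => //; exact: basis_fset0.
have [F bF hF] := onb_expansion (B x) d0.
exists (F `|` G)%fset; first exact: basis_fsetU.
move=> y; rewrite inE => /orP[/eqP ->|ys] G' bG' sub.
  by apply: hF => //; rewrite (fsubset_trans _ sub)// fsubsetUl.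
by apply: hG => //; rewrite (fsubset_trans _ sub)// fsubsetUr.
Qed.

Section TraceContraction.
Context {H1 H2 : hilbertType R} {V : lmodType R[i]}.
Variables (b : V -> V -> R[i]) (X : {linear H2 -> V}) (B : {linear H1 -> H2}).
Hypothesis psdb : psd_form b.
Hypothesis Bc : forall x, rnorm (B x) <= rnorm x.

(** The difference of the two sides is [\sum W g g' * b (X g) (X g')], where [W] is the matrix on
    [G] of the identity minus [B Q B'], with [Q] the projection onto the span of [F] and [B'] the
    adjoint of [B]. Bessel's inequality makes [W] positive, and Schur's product theorem applies. *)
Lemma trace_contraction_fset (F : {fset H1}) (G : {fset H2}) :
  basis_fset F -> basis_fset G ->
  \sum_(e <- F) qform b (X (\sum_(g <- G) hdot (B e) g *: g)) <=
  \sum_(g <- G) qform b (X g).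
Proof.
move=> bF bG; pose W g g' := (g == g')%:R -
   \sum_(e <- F) hdot (B e) g * Num.conj (hdot (B e) g').
have diag (P : H2 -> H2 -> R[i]) : \sum_(g <- G) \sum_(g' <- G) (g == g')%:R * P g g' =
    \sum_(g <- G) P g g.
  rewrite big_seq [RHS]big_seq; apply: eq_bigr => g gG.
  rewrite (big_fsetD1 g)//= eqxx mul1r big_seq big1 ?addr0// => g'.
  by rewrite !inE eq_sym => /andP[/negPf -> _]; rewrite mul0r.
rewrite -lecR -subr_ge0 !rmorph_sum/=.
have -> : \sum_(g <- G) (qform b (X g))%:C -
    \sum_(e <- F) (qform b (X (\sum_(g <- G) hdot (B e) g *: g)))%:C =
    \sum_(g <- G) \sum_(g' <- G) W g g' * b (X g) (X g').
  under [RHS]eq_bigr do under eq_bigr do rewrite mulrBl.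
  under [RHS]eq_bigr do rewrite sumrB.
  rewrite sumrB diag; congr (_ - _); first by apply: eq_bigr => g _; rewrite qformE.
  under [RHS]eq_bigr do under eq_bigr do rewrite mulr_suml.
  under [RHS]eq_bigr do rewrite exchange_big/=.
  rewrite exchange_big/=; apply: eq_bigr => e _; rewrite -(qformE psdb).
  rewrite linear_sum/= (psd_suml psdb); apply: eq_bigr => g _.
  rewrite (psd_sumr psdb); apply: eq_bigr => g' _.
  by rewrite !linearZ/= (psdZl psdb) (psdZr psdb) mulrA.
apply: schur_sum_ge0 => // u.
pose y := \sum_(g <- G) Num.conj (u g) *: g.
have -> : \sum_(g <- G) \sum_(g' <- G) W g g' * (u g * Num.conj (u g')) =
   (rnorm y ^+ 2 - \sum_(e <- F) cabs (hdot y (B e)) ^+ 2)%:C.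
  rewrite rnorm_basis_sum// rmorphB/= !rmorph_sum/=.
  under eq_bigr do under eq_bigr do rewrite mulrBl.
  under eq_bigr do rewrite sumrB.
  rewrite sumrB diag; congr (_ - _).
    by apply: eq_bigr => g _; rewrite cabs_conj mulcC_cabs.
  under [LHS]eq_bigr do under eq_bigr do rewrite mulr_suml.
  under [LHS]eq_bigr do rewrite exchange_big/=.
  rewrite exchange_big/=; apply: eq_bigr => e _.
  rewrite hdotC cabs_conj -mulcC_cabs hdot_sumr mulr_suml.
  apply: eq_bigr => g _; rewrite rmorph_sum mulr_sumr; apply: eq_bigr => g' _.
  by rewrite !hdotZr !conjCK rmorphM/=; ring.
rewrite ler0c subr_ge0 -[rnorm y]mul1r; apply: bessel_bounded => // x.
by rewrite mul1r.
Qed.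

(* For [b] the inner product of [V] this says that composing with a contraction
   on the right does not increase the Hilbert-Schmidt norm. *)
Lemma trace_contraction (C M : R) (F : {fset H1}) :
  (forall x, snorm b (X x) <= C * rnorm x) -> basis_fset F ->
  (forall G, basis_fset G -> \sum_(g <- G) qform b (X g) <= M) ->
  \sum_(e <- F) qform b (X (B e)) <= M.
Proof.
move=> XC bF hM; apply/ler_addgt0Pr => eps eps0.
pose N := (size F)%:R : R; pose A := `|C| + 1.
have A0 : 0 < A by rewrite ltr_wpDl.
have XA x : snorm b (X x) <= A * rnorm x.
  by rewrite (le_trans (XC x))// ler_wpM2r ?rnorm_ge0// (le_trans (ler_norm C))// lerDl.
(* Replacing [B e] by its projection [P e], at distance at most [d <= 1], changes a term by at most
   [2 A^2 d + A^2 d^2 <= 3 A^2 d], and there are [N] terms. The summand 1 keeps [D] positive. *)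
pose D := 1 + N * (A ^+ 2 * 3).
have D0 : 0 < D.
  by rewrite ltr_wpDr// mulr_ge0 ?ler0n// mulr_ge0// exprn_ge0// ltW.
pose d := Num.min 1 (eps / D).
have d0 : 0 < d by rewrite lt_min ltr01 divr_gt0.
have d1 : d <= 1 by rewrite ge_min lexx.
have dD : d * D <= eps by rewrite -ler_pdivlMr// ge_min lexx orbT.
have [G bG hG] := onb_expansion_seq B F d0.
pose P e := \sum_(g <- G) hdot (B e) g *: g.
apply: (@le_trans _ _ (\sum_(e <- F) (qform b (X (P e)) + d * (A ^+ 2 * 3)))); last first.
  rewrite big_split/= lerD//; first exact: (le_trans (trace_contraction_fset bF bG) (hM _ bG)).
  rewrite big_const_seq count_predT iter_addr_0 -[X in X <= _]mulr_natl (le_trans _ dD)//.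
  rewrite (_ : _ * (d * _) = d * D - d) ?gerBl ?ltW// /D /N; ring.
rewrite big_seq [leRHS]big_seq; apply: ler_sum => e eF.
have PB1 : rnorm (P e) <= 1.
  have -> : 1 = rnorm e :> R by rewrite onb_norm//; exact: bF.
  apply: le_trans (Bc e); rewrite -(@ler_pXn2r _ 2)// ?nnegrE ?rnorm_ge0//.
  by rewrite rnorm_basis_sum// bessel.
have h1 : snorm b (X (B e)) <= snorm b (X (P e)) + A * d.
  have -> : X (B e) = X (P e) + X (B e - P e) by rewrite -linearD addrC subrK.
  rewrite (le_trans (snormD psdb _ _))// lerD2l (le_trans (XA _))// ler_pM2l//.
  exact: hG.
have h2 : snorm b (X (P e)) <= A by rewrite (le_trans (XA _))// ger_pMr.
rewrite -!(sqr_snorm psdb).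
have s0 := snorm_ge0 b (X (P e)).
apply: (@le_trans _ _ ((snorm b (X (P e)) + A * d) ^+ 2)).
  by rewrite lerXn2r// nnegrE ?snorm_ge0// addr_ge0// mulr_ge0// ltW.
rewrite sqrrD -addrA lerD2l.
have : snorm b (X (P e)) * (A * d) <= A * (A * d) by rewrite ler_wpM2r// mulr_ge0// ltW.
have : (A * d) ^+ 2 <= A * (A * d).
  by rewrite expr2 -mulrA ler_pM2l// mulrCA ler_pM2l// ger_pMl// mulr_gt0.
by rewrite mulr2n; nra.
Qed.

End TraceContraction.

End HilbertSpace.

(** * The trace form and the completeness of the Hilbert-Schmidt class *)

Section HilbertSchmidtForm.
Context {R : realType} {H : hilbertType R}.
Implicit Types A B : S2 H.

Lemma S2P A : hilbert_schmidt (val A).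
Proof. by have /asboolP := valP A. Qed.

Definition mkS2 (A : H -> H) (hA : hilbert_schmidt A) : S2 H :=
  exist _ A (asboolT hA).

Lemma mkS2E (A : H -> H) (hA : hilbert_schmidt A) : val (mkS2 hA) = A.
Proof. by []. Qed.

Lemma S2_linear A : linear (val A). Proof. by case: (S2P A). Qed.

Definition S2_lin A : {linear H -> H} := mk_linear (S2_linear A).

Lemma S2_app0 A : val A 0 = 0. Proof. exact: (linear0 (S2_lin A)). Qed.
Lemma S2_appB A x y : val A (x - y) = val A x - val A y.
Proof. exact: (linearB (S2_lin A)). Qed.
Lemma S2_appZ A a x : val A (a *: x) = a *: val A x.
Proof. by have := S2_linear A a x 0; rewrite S2_app0 !addr0. Qed.

Lemma S2_eq A B : (forall x, val A x = val B x) -> A = B.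
Proof. by move=> AB; apply: val_inj; apply/funext. Qed.

Lemma S2D A B x : val (A + B) x = val A x + val B x. Proof. by []. Qed.
Lemma S2N A x : val (- A) x = - val A x. Proof. by []. Qed.
Lemma S2B A B x : val (A - B) x = val A x - val B x. Proof. by []. Qed.
Lemma S2Z a A x : val (a *: A) x = a *: val A x. Proof. by []. Qed.
Lemma S2_suml I (r : seq I) (P : pred I) (f : I -> S2 H) x :
  val (\sum_(i <- r | P i) f i) x = \sum_(i <- r | P i) val (f i) x.
Proof. by apply: (big_morph (fun A : S2 H => val A x)). Qed.

Lemma S2_bounded A : exists2 M : R, 0 <= M & forall x, rnorm (val A x) <= M * rnorm x.
Proof.
case: (S2P A) => _ [M hM] _; exists (cabs M) => [|x]; first exact: cabs_ge0.
rewrite -lecR rmorphM/= -!rnormE -normcE (le_trans (hM x))//.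
have [->|x0] := eqVneq `|x| 0; first by rewrite !mulr0.
have xp : 0 < `|x| by rewrite lt_def x0/=.
have M0 : 0 <= M by have := le_trans (normr_ge0 _) (hM x); rewrite pmulr_lge0.
by rewrite ger0_norm.
Qed.

Definition hs_sum A (F : {fset H}) : R := \sum_(e <- F) rnorm (val A e) ^+ 2.

Lemma hs_sum_ge0 A F : 0 <= hs_sum A F.
Proof. by apply: sumr_ge0 => e _; rewrite sqr_ge0. Qed.

Lemma hs_sum_bounded A : exists M, forall F, basis_fset F -> hs_sum A F <= M.
Proof.
case: (S2P A) => _ _ [M hM]; exists (complex.Re M) => F bF.
have := hM F bF; rewrite lecE => /andP[_]; rewrite Re_sum.
rewrite (eq_bigr (fun e => rnorm (val A e) ^+ 2))// => e _.
by rewrite rnormE -rmorphXn.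
Qed.

Lemma mk_hilbert_schmidt (A : H -> H) (C M : R) : linear A ->
  (forall x, rnorm (A x) <= C * rnorm x) ->
  (forall F, basis_fset F -> \sum_(e <- F) rnorm (A e) ^+ 2 <= M) ->
  hilbert_schmidt A.
Proof.
move=> lA bA sA; split => //.
- by exists C%:C => x; rewrite !rnormE -rmorphM/= lecR.
- exists M%:C => F bF; rewrite (eq_bigr (fun e => (rnorm (A e) ^+ 2)%:C)).
    by rewrite -rmorph_sum/= lecR sA.
  by move=> e _; rewrite rnormE rmorphXn.
Qed.

(** The finite sets consist of vectors of [H], not of elements of the index type of [hs_dot];
    [sum_onb] makes the passage to [sum]. *)
Definition onb_cvg (f : H -> R[i]) (l : R[i]) :=
  forall d : R, 0 < d -> exists2 F0, basis_fset F0 & forall F, basis_fset F ->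
    (F0 `<=` F)%fset -> cabs (l - \sum_(e <- F) f e) <= d.

Lemma onb_cvg_unique f l l' : onb_cvg f l -> onb_cvg f l' -> l = l'.
Proof.
move=> fl fl'; apply/eqP; rewrite -subr_eq0 -cabs_eq0 eq_le cabs_ge0 andbT.
apply/ler_addgt0Pr => d d0; rewrite add0r.
have [F1 b1 h1] := fl _ (divr_gt0 d0 (ltr0n R 2)).
have [F2 b2 h2] := fl' _ (divr_gt0 d0 (ltr0n R 2)).
have bF := basis_fsetU b1 b2.
have {}h1 := h1 _ bF (fsubsetUl _ _); have {}h2 := h2 _ bF (fsubsetUr _ _).
rewrite -(subrKA (\sum_(e <- (F1 `|` F2)%fset) f e)) (le_trans (cabsD _ _))//.
by rewrite [leRHS]splitr lerD// cabs_distC.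
Qed.

Lemma onb_cvgD f g l m : onb_cvg f l -> onb_cvg g m ->
  onb_cvg (fun e => f e + g e) (l + m).
Proof.
move=> fl gm d d0.
have [F1 b1 h1] := fl _ (divr_gt0 d0 (ltr0n R 2)).
have [F2 b2 h2] := gm _ (divr_gt0 d0 (ltr0n R 2)).
exists (F1 `|` F2)%fset; first exact: basis_fsetU.
move=> F bF sub; rewrite big_split/= opprD addrACA (le_trans (cabsD _ _))//.
by rewrite [leRHS]splitr lerD// ?h1 ?h2// (fsubset_trans _ sub) ?fsubsetUl ?fsubsetUr.
Qed.

Lemma onb_cvgZ a f l : onb_cvg f l -> onb_cvg (fun e => a * f e) (a * l).
Proof.
move=> fl d d0; have a1 : 0 < cabs a + 1 by rewrite ltr_wpDl ?cabs_ge0.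
have [F0 b0 h0] := fl _ (divr_gt0 d0 a1); exists F0 => // F bF sub.
rewrite -mulr_sumr -mulrBr cabsM.
have := h0 F bF sub; rewrite ler_pdivlMr// => h; rewrite (le_trans _ h)// mulrC.
by rewrite ler_wpM2l ?cabs_ge0// lerDl.
Qed.

Lemma onb_cvg_conj f l : onb_cvg f l ->
  onb_cvg (fun e => Num.conj (f e)) (Num.conj l).
Proof.
move=> fl d /fl[F0 b0 h0]; exists F0 => // F bF /(h0 _ bF).
by rewrite -rmorph_sum -rmorphB cabs_conj.
Qed.

Lemma hs_sum_sup A : exists2 s, (forall F, basis_fset F -> hs_sum A F <= s) &
  (forall d, 0 < d -> exists2 F, basis_fset F & s - d < hs_sum A F).
Proof.
have [M hM] := hs_sum_bounded A.
by apply: (@bounded_fset_sup R H (@basis_fset R H) (hs_sum A) M) => //; exists fset0; exact: basis_fset0.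
Qed.

Lemma hs_sum_sub A (F G : {fset H}) : (F `<=` G)%fset -> hs_sum A F <= hs_sum A G.
Proof.
move=> FG; rewrite /hs_sum (big_fsetID _ (mem F) G)/=.
have -> : [fset x in G | x \in F]%fset = F.
  by apply/fsetP => x; rewrite !inE; apply: andb_idl => /(fsubsetP FG).
by rewrite lerDl; apply: sumr_ge0 => x _; rewrite sqr_ge0.
Qed.

Lemma hs_sum_cvg A s : (forall F, basis_fset F -> hs_sum A F <= s) ->
  (forall d, 0 < d -> exists2 F, basis_fset F & s - d < hs_sum A F) ->
  onb_cvg (fun e => hdot (val A e) (val A e)) s%:C.
Proof.
move=> ub adh d /adh[F0 b0 h0]; exists F0 => // F bF sub.
rewrite (eq_bigr (fun e => (rnorm (val A e) ^+ 2)%:C)); last by move=> e _; rewrite hdotxx.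
have -> : s%:C - \sum_(e <- F) (rnorm (val A e) ^+ 2)%:C = (s - hs_sum A F)%:C.
  by rewrite rmorphB rmorph_sum.
rewrite cabsR ger0_norm ?subr_ge0 ?ub//.
by have := hs_sum_sub A sub; rewrite /hs_sum in h0 *; lra.
Qed.

Let iC : R[i] := Num.imaginary.

(** By polarization it is enough to treat [A = B], where the terms are nonnegative and the finite
    sums bounded. *)
Lemma hs_cvg_ex A B : exists l, onb_cvg (fun e => hdot (val A e) (val B e)) l.
Proof.
have ex (C : S2 H) : exists l, onb_cvg (fun e => hdot (val C e) (val C e)) l.
  by have [s h1 h2] := hs_sum_sup C; exists s%:C; exact: hs_sum_cvg.
have [l1 h1] := ex (A + B); have [l2 h2] := ex (A - B).
have [l3 h3] := ex (A + iC *: B); have [l4 h4] := ex (A - iC *: B).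
have := onb_cvgD (onb_cvgD (onb_cvgZ (1/4) h1) (onb_cvgZ (-(1/4)) h2))
 (onb_cvgD (onb_cvgZ (iC / 4) h3) (onb_cvgZ (- iC / 4) h4)).
set l := (X in onb_cvg _ X) => h; exists l; move: h.
have ii : iC * iC = -1 by exact: mulCii.
congr onb_cvg; apply/funext => e; rewrite !S2D !S2N !S2Z.
have ps := hdot_psd H.
rewrite !(psdDl ps, psdDr ps, psdNl ps, psdNr ps, psdZl ps, psdZr ps) .
have -> : Num.conj iC = - iC by exact: conjCi.
set a := hdot _ _; set b := hdot (val A e) _; set c := hdot _ (val A e); set d := hdot _ _.
(* [field] treats [iC] as an unknown, so its square is isolated before being replaced by -1. *)
transitivity ((b + c) / 2 + (iC * iC) * (c - b) / 2); first by field.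
by rewrite ii; field.
Qed.

Lemma sum_onb (f : H -> R[i]) l : onb_cvg f l ->
  sum (fun e : onb H => f (val e)) = l.
Proof.
move=> fl; have PF := @totally_filter (onb H).
apply: cvg_lim; first exact: norm_hausdorff.
apply/cvgrPdist_le => eps /complex_gt0P[d d0 ->].
have [F0 b0 h0] := fl d d0.
(* [insub] carries the basis vectors in [F0] to the subtype that indexes [sum]. *)
exists [fset e in pmap insub (enum_fset F0)]%fset => // J /= J0J.
pose F : {fset H} := [fset val e | e in J]%fset.
have bF : basis_fset F by move=> e /imfsetP[/= x xJ ->]; exact: (set_mem (valP x)).
have -> : partial_sum (fun e : onb H => f (val e)) J = \sum_(e <- F) f e.
  rewrite /F big_imfset/=; last by move=> x y _ _ xy; apply: val_inj.
  by rewrite /partial_sum -(big_seq_fsetE _ J xpredT (fun e => f (val e))).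
rewrite normcE lecR; apply: h0 => //; apply/fsubsetP => e eF0.
apply/imfsetP => /=; exists (exist _ e (mem_set (b0 _ eF0))) => //.
apply: (fsubsetP J0J); rewrite !inE mem_pmap; apply/mapP; exists e => //.
rewrite (insubT (mem (onb H)) (mem_set (b0 _ eF0))).
by congr Some; exact: val_inj.
Qed.

Lemma hs_dot_cvg A B : onb_cvg (fun e => hdot (val A e) (val B e)) (hs_dot A B).
Proof. by have [l hl] := hs_cvg_ex A B; rewrite /hs_dot (sum_onb hl). Qed.

Lemma hs_dot_psd : psd_form (@hs_dot R H).
Proof.
have lin a A B C : hs_dot (a *: A + B) C = a * hs_dot A C + hs_dot B C.
  apply: (onb_cvg_unique (hs_dot_cvg _ _)).
  have := onb_cvgD (onb_cvgZ a (hs_dot_cvg A C)) (hs_dot_cvg B C).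
  congr onb_cvg; apply/funext => e.
  by rewrite S2D S2Z (psdDl (hdot_psd H)) hdotZl.
have conjg A B : hs_dot A B = Num.conj (hs_dot B A).
  apply: (onb_cvg_unique (hs_dot_cvg _ _)).
  have := onb_cvg_conj (hs_dot_cvg B A).
  by congr onb_cvg; apply/funext => e; rewrite -hdotC.
split=> // A; have [s h1 h2] := hs_sum_sup A.
rewrite (onb_cvg_unique (hs_dot_cvg A A) (hs_sum_cvg h1 h2)) ler0c.
by rewrite (le_trans _ (h1 _ (@basis_fset0 _ _)))// hs_sum_ge0.
Qed.

Lemma hs_qform_sup A : (forall F, basis_fset F -> hs_sum A F <= qform hs_dot A) /\
  (forall d, 0 < d -> exists2 F, basis_fset F & qform hs_dot A - d < hs_sum A F).
Proof.
have [s h1 h2] := hs_sum_sup A.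
by rewrite /qform (onb_cvg_unique (hs_dot_cvg A A) (hs_sum_cvg h1 h2)).
Qed.

Lemma hs_qform_ub A F : basis_fset F -> hs_sum A F <= qform hs_dot A.
Proof. by case: (hs_qform_sup A) => h _; exact: h. Qed.

Lemma hs_qform_le A M : (forall F, basis_fset F -> hs_sum A F <= M) ->
  qform hs_dot A <= M.
Proof.
move=> hM; apply/ler_addgt0Pr => d d0; have [_ /(_ d d0)[F bF h]] := hs_qform_sup A.
by have := hM F bF; lra.
Qed.

Lemma hs_normE A : hs_norm A = (snorm hs_dot A)%:C.
Proof.
rewrite /hs_norm (qformE hs_dot_psd) -(sqr_snorm hs_dot_psd) rmorphXn/= sqrCK//.
by rewrite ler0c snorm_ge0.
Qed.

Definition rank_one (u v : H) : H -> H := fun x => hdot x v *: u.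

(** The unit vector [y] along [x] need not belong to the basis. The contraction [rank_one y e] maps
    a basis vector [e] to [y], so [trace_contraction] on the single vector [e] bounds [A y]. *)
Lemma S2_apply_le A x : rnorm (val A x) <= snorm hs_dot A * rnorm x.
Proof.
have [->|x0] := eqVneq x 0.
  by rewrite S2_app0 !rnorm0 mulr0.
have nx : 0 < rnorm x.
  by rewrite lt_def rnorm_ge0 andbT; apply: contra x0 => /eqP/rnorm_eq0 ->.
have [e be] : exists e, onb H e.
  apply: contrapT => ne; move/eqP: x0; apply; have [_ compl] := onbP H.
  by apply: compl => e be; case: ne; exists e.
pose y := (rnorm x)^-1%:C *: x.
have ny : rnorm y = 1.
  by rewrite rnormZ cabsR ger0_norm ?invr_ge0 ?rnorm_ge0// mulVf ?gt_eqF.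
have lB : linear (rank_one y e).
  by move=> a u v; rewrite /rank_one hdotDl hdotZl scalerDl -scalerA.
have Bc z : rnorm (mk_linear lB z) <= rnorm z.
  by rewrite mk_linearE /rank_one rnormZ ny mulr1 (le_trans (hdot_rnorm _ _))// (onb_norm be) mulr1.
have [M M0 AM] := S2_bounded A.
have := @trace_contraction R H H H (@hdot R H) (S2_lin A) (mk_linear lB) (hdot_psd H) Bc
  M (qform hs_dot A) [fset e]%fset.
rewrite big_seq_fset1 !mk_linearE /rank_one onb_orth// eqxx scale1r -sqr_rnorm.
move=> h; have {}h : rnorm (val A y) ^+ 2 <= qform hs_dot A.
  apply: h; [|exact: basis_fset1|].
    by move=> z; rewrite -rnorm_snorm; exact: AM.
  move=> G bG; apply: le_trans (hs_qform_ub A bG).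
  by apply: ler_sum => g _; rewrite -sqr_rnorm.
have xE : x = (rnorm x)%:C *: y by rewrite scalerA -rmorphM/= divff ?scale1r ?gt_eqF.
rewrite {1}xE.
rewrite S2_appZ rnormZ cabsR ger0_norm ?rnorm_ge0// mulrC.
rewrite ler_pM2r// -(@ler_pXn2r _ 2)// ?nnegrE ?rnorm_ge0 ?snorm_ge0//.
by rewrite (sqr_snorm hs_dot_psd).
Qed.

Lemma hs_definite A : snorm hs_dot A = 0 -> A = 0.
Proof.
move=> A0; apply: S2_eq => x; apply: rnorm_eq0; apply/eqP.
by rewrite eq_le rnorm_ge0 andbT (le_trans (S2_apply_le A x))// A0 mul0r.
Qed.

(** The limit is taken pointwise, and its distance to [u m] is estimated on finite sets of basis
    vectors. The factor 2 is a coarse bound for the square root of the 2 in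
    [(a + b)^2 <= 2 a^2 + 2 b^2]. *)
Lemma hs_complete (u : nat -> S2 H) (e : nat -> R) : rate e ->
  (forall m n, (m <= n)%N -> snorm hs_dot (u m - u n) <= e m) ->
  exists l, forall m, snorm hs_dot (u m - l) <= 2 * e m.
Proof.
move=> re ue.
have e0 m : 0 <= e m by rewrite (le_trans _ (ue m m (leqnn m)))// snorm_ge0.
have lim_ex x : exists y : H, forall m, rnorm (val (u m) x - y) <= rnorm x * e m.
  apply: (@complete_rate R H (fun m => val (u m) x)).
    by apply: rateZ => //; exact: rnorm_ge0.
  move=> m n mn; rewrite -S2B mulrC (le_trans (S2_apply_le _ _))//.
  by rewrite ler_wpM2r ?rnorm_ge0// ue.
pose l x := sval (cid (lim_ex x)).
have lE x m : rnorm (val (u m) x - l x) <= rnorm x * e m by rewrite /l; case: cid.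
have lin : linear l.
  move=> a x y; apply: rnorm_small_eq => d d0.
  pose K := rnorm (a *: x + y) + cabs a * rnorm x + rnorm y.
  have K0 : 0 <= K by rewrite !addr_ge0 ?mulr_ge0 ?rnorm_ge0 ?cabs_ge0.
  have [N /(_ N (leqnn N)) hN] := rateZ K0 re d0.
  apply: le_trans hN; rewrite /K !mulrDl.
  have -> : l (a *: x + y) - (a *: l x + l y) =
     - (val (u N) (a *: x + y) - l (a *: x + y)) + a *: (val (u N) x - l x)
     + (val (u N) y - l y).
    by rewrite S2_linear scalerBr opprB -addrA (addrACA (a *: val (u N) x)) -opprD addrA subrK.
  rewrite (le_trans (rnormD _ _))// lerD// (le_trans (rnormD _ _))// lerD//.
    by rewrite rnormN.
  by rewrite rnormZ -mulrA ler_wpM2l ?cabs_ge0.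
have bnd x : rnorm (l x) <= (snorm hs_dot (u 0%N) + e 0%N) * rnorm x.
  rewrite -[l x](subKr (val (u 0%N) x)) (le_trans (rnormB _ _))// mulrDl lerD//.
    exact: S2_apply_le.
  by rewrite mulrC.
have dist m F : basis_fset F ->
    \sum_(f <- F) rnorm (val (u m) f - l f) ^+ 2 <= 2 * e m ^+ 2.
  (* Over the finite set [F], replacing [l] by [u n] costs at most [K * e n ^+ 2], which is below
     [d] for large [n]; what remains is the Hilbert-Schmidt norm of [u m - u n]. *)
  move=> bF; apply/ler_addgt0Pr => d d0; pose K := 2 * (size F)%:R : R.
  have K0 : 0 <= K by rewrite mulr_ge0 ?ler0n.
  have dK : 0 < Num.min 1 (d / (K + 1)).
    by rewrite lt_min ltr01 divr_gt0// ltr_wpDl.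
  have [N hN] := re _ dK; pose n := maxn m N.
  have := hN n (leq_maxr _ _); rewrite le_min => /andP[en1].
  rewrite ler_pdivlMr ?ltr_wpDl// => enK.
  apply: (@le_trans _ _ (\sum_(f <- F) (2 * rnorm (val (u m - u n) f) ^+ 2 + 2 * e n ^+ 2))).
    rewrite big_seq [leRHS]big_seq; apply: ler_sum => f fF.
    have h1 : rnorm (val (u m) f - l f) <= rnorm (val (u m - u n) f) + e n.
      rewrite (le_trans (rnorm_dist_triangle _ _ (val (u n) f)))// lerD//.
      by rewrite (le_trans (lE _ _))// (onb_norm (bF _ fF)) mul1r.
    have h2 := rnorm_ge0 (val (u m) f - l f).
    have := sqr_ge0 (rnorm (val (u m - u n) f) - e n).
    have : rnorm (val (u m) f - l f) ^+ 2 <= (rnorm (val (u m - u n) f) + e n) ^+ 2.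
      by rewrite lerXn2r// nnegrE ?addr_ge0 ?rnorm_ge0.
    by rewrite sqrrD sqrrB; lra.
  rewrite big_split/= -!mulr_sumr lerD//.
    rewrite ler_pM2l// (le_trans (hs_qform_ub (u m - u n) bF))//.
    rewrite -(sqr_snorm hs_dot_psd) lerXn2r ?nnegrE ?snorm_ge0 ?ue ?leq_maxl//.
  rewrite big_const_seq count_predT iter_addr_0.
  rewrite (_ : 2 * _ = K * e n ^+ 2); last by rewrite -[e n *+ _]mulr_natl /K; ring.
  rewrite (le_trans _ enK)// mulrC expr2 -mulrA ler_wpM2l//.
  by apply: (@le_trans _ _ (1 * K)); [rewrite ler_wpM2r|rewrite mul1r lerDl].
have hl : hilbert_schmidt l.
  apply: (@mk_hilbert_schmidt l (snorm hs_dot (u 0%N) + e 0%N)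
    (2 * qform hs_dot (u 0%N) + 2 * (2 * e 0%N ^+ 2))) => // F bF.
  apply: (@le_trans _ _ (\sum_(f <- F) (2 * rnorm (val (u 0%N) f) ^+ 2
      + 2 * rnorm (val (u 0%N) f - l f) ^+ 2))).
    apply: ler_sum => f _.
    have h1 : rnorm (l f) <= rnorm (val (u 0%N) f) + rnorm (val (u 0%N) f - l f).
      by rewrite -{1}[l f](subKr (val (u 0%N) f)) rnormB.
    have := sqr_ge0 (rnorm (val (u 0%N) f) - rnorm (val (u 0%N) f - l f)).
    have : rnorm (l f) ^+ 2 <= (rnorm (val (u 0%N) f) + rnorm (val (u 0%N) f - l f)) ^+ 2.
      by rewrite lerXn2r// nnegrE ?addr_ge0 ?rnorm_ge0.
    by rewrite sqrrD sqrrB; lra.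
  rewrite big_split/= -!mulr_sumr lerD// ler_pM2l//; last exact: dist.
  exact: hs_qform_ub.
exists (mkS2 hl) => m; rewrite -(@ler_pXn2r _ 2)// ?nnegrE ?snorm_ge0 ?mulr_ge0//.
rewrite (sqr_snorm hs_dot_psd); apply: hs_qform_le => F bF.
rewrite (le_trans (dist m F bF))// exprMn ler_wpM2r ?sqr_ge0//.
by rewrite expr2 ler_peMl// ler1n.
Qed.

End HilbertSchmidtForm.

(** * The Hilbert-Schmidt operators as a Hilbert space *)

Section HilbertSchmidtHilbert.
Context {R : realType} {H : hilbertType R}.
Implicit Types A B : S2 H.

Let hs_normD A B : hs_norm (A + B) <= hs_norm A + hs_norm B.
Proof. by rewrite !hs_normE -rmorphD lecR snormD//; exact: hs_dot_psd. Qed.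

Let hs_normZ (a : R[i]) A : hs_norm (a *: A) = `|a| * hs_norm A.
Proof. by rewrite !hs_normE snormZ ?rmorphM//; exact: hs_dot_psd. Qed.

Let hs_norm_eq0 A : hs_norm A = 0 -> A = 0.
Proof. by rewrite hs_normE => -[]; exact: hs_definite. Qed.

HB.instance Definition _ :=
  Lmodule_isNormed.Build R[i] (S2 H) hs_normD hs_normZ hs_norm_eq0.

Lemma S2_normE A : `|A| = hs_norm A. Proof. by []. Qed.

Lemma S2_rnorm A : rnorm A = snorm hs_dot A.
Proof. by rewrite /rnorm S2_normE hs_normE. Qed.

Let ball_rnorm A (e : R) B : ball A e%:C B -> rnorm (A - B) < e.
Proof. by move=> h; rewrite -ltcR -rnormE; exact: h. Qed.

Let S2_cauchy_cvg (F : set_system (S2 H)) : ProperFilter F -> cauchy F -> cvg F.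
Proof.
move=> PF /cauchyP Fc.
pose d n : R := n.+1%:R^-1.
have d0 n : 0 < d n by rewrite invr_gt0 ltr0Sn.
have ex n : exists x, F (ball x (d n)%:C) by apply: Fc; rewrite ltr0C.
pose u n := sval (cid (ex n)).
have Fu n : F (ball (u n) (d n)%:C) by rewrite /u; case: cid.
have rd : rate (fun n => 2 * d n) by apply: rateZ => //; exact: rate_inv.
have [m n mn|l hl] := @hs_complete R H u _ rd.
  (* Two members of a proper filter meet, so [u m] and [u n] are within [d m + d n] of each
     other. *)
  have [x [/= h1 h2]] := filter_ex (filterI (Fu m) (Fu n)).
  move: h1 h2 => /ball_rnorm h1 /ball_rnorm h2.
  rewrite -S2_rnorm (le_trans (rnorm_dist_triangle _ _ x))// mulr_natl mulr2n.
  rewrite lerD ?(ltW h1)// rnorm_distC (le_trans (ltW h2))//.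
  by rewrite lef_pV2 ?posrE ?ltr0Sn// ler_nat ltnS.
apply/cvg_ex; exists l; apply/cvgrPdist_lt => eps /complex_gt0P[e e0 ->].
have [N hN] := rateZ (ler0n R 6) (@rate_inv R) (divr_gt0 e0 (ltr0n R 2)).
have h6 := hN N (leqnn N); apply: filterS (Fu N) => x /ball_rnorm h1.
rewrite rnormE ltcR.
rewrite (le_lt_trans (rnorm_dist_triangle _ _ (u N)))//.
have := hl N; rewrite -S2_rnorm rnorm_distC => h2.
have h3 := d0 N; move: h6; rewrite -/(d N) => h6; lra.
Qed.

HB.instance Definition _ := Uniform_isComplete.Build (S2 H) S2_cauchy_cvg.

Let hs_bilinear : bilinear_for ( *%R : GRing.Scale.law _ _)
  (Num.conj \; *%R : GRing.Scale.law _ _) (@hs_dot R H).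
Proof.
split=> A a B C /=.
  by rewrite (psdDl hs_dot_psd) (psdZl hs_dot_psd).
by rewrite (psdDr hs_dot_psd) (psdZr hs_dot_psd).
Qed.

HB.instance Definition _ := bilinear_isBilinear.Build R[i] (S2 H) (S2 H) R[i]
  ( *%R : GRing.Scale.law _ _) (Num.conj \; *%R : GRing.Scale.law _ _)
  (@hs_dot R H) hs_bilinear.

Let hs_hermitian A B : hs_dot A B = (-1) ^+ false * Num.conj (hs_dot B A).
Proof. by rewrite expr0 mul1r; exact: (psdC hs_dot_psd). Qed.

HB.instance Definition _ := isHermitianSesquilinear.Build R[i] (S2 H) false
  Num.conj (@hs_dot R H) hs_hermitian.

Let hs_pos A : A != 0 -> 0 < hs_dot A A.
Proof.
move=> A0; rewrite (qformE hs_dot_psd) ltr0C -(sqr_snorm hs_dot_psd) exprn_gt0//.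
by rewrite lt_def snorm_ge0 andbT; apply: contra A0 => /eqP/hs_definite ->.
Qed.

HB.instance Definition _ := isDotProduct.Build R[i] (S2 H) (@hs_dot R H) hs_pos.

Let S2_hdotE A : `|A| ^+ 2 = hs_dot A A.
Proof.
by rewrite S2_normE hs_normE -rmorphXn/= (sqr_snorm hs_dot_psd) (qformE hs_dot_psd).
Qed.

(** Spectral measures and dilation spaces are required to be of type [hilbertType]; from here on the
    operators on a dilation space form one. *)
HB.instance Definition _ := isHilbert.Build R (S2 H) (@S2_hdotE).

Lemma S2_hdot A B : hdot A B = hs_dot A B. Proof. by []. Qed.

End HilbertSchmidtHilbert.

(** * Contractions and the maps [X |-> P X Q] *)

Section Contractions.
Context {R : realType}.
Implicit Types H K L : hilbertType R.

Record contr H K := Contr {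
  contr_op :> {linear H -> K};
  contrP : forall x, rnorm (contr_op x) <= rnorm x }.

Lemma contr_id_subproof H (x : H) : rnorm ((idfun : {linear H -> H}) x) <= rnorm x.
Proof. by []. Qed.
Definition contr_id H : contr H H := Contr (@contr_id_subproof H).

Lemma contr_comp_subproof H K L (P : contr K L) (Q : contr H K) x :
  rnorm ((P \o Q : {linear H -> L}) x) <= rnorm x.
Proof. exact: (le_trans (contrP _ _) (contrP _ _)). Qed.
Definition contr_comp H K L (P : contr K L) (Q : contr H K) : contr H L :=
  Contr (contr_comp_subproof P Q).

Fixpoint contr_iter H (P : contr H H) n : contr H H :=
  if n is m.+1 then contr_comp P (contr_iter P m) else contr_id H.

Lemma contr_iterE H (P : contr H H) n x : contr_iter P n x = iter n P x.
Proof. by elim: n => //= n ->. Qed.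

(** The pointwise bound sees [A] at [P e], which need not run through a basis; [trace_contraction]
    absorbs [P] after summation. *)
Lemma S2_le H K (A : S2 H) (B : S2 K) (P : contr K H) (c : R) :
  0 <= c -> (forall e, rnorm (val B e) <= c * rnorm (val A (P e))) ->
  rnorm B <= c * rnorm A.
Proof.
move=> c0 BA; rewrite -(@ler_pXn2r _ 2)// ?nnegrE ?mulr_ge0 ?rnorm_ge0//.
rewrite exprMn !S2_rnorm !(sqr_snorm hs_dot_psd); apply: hs_qform_le => F bF.
apply: (@le_trans _ _ (c ^+ 2 * \sum_(e <- F) rnorm (val A (P e)) ^+ 2)).
  rewrite mulr_sumr; apply: ler_sum => e _; rewrite -exprMn lerXn2r// nnegrE.
    exact: rnorm_ge0.
  by rewrite mulr_ge0// rnorm_ge0.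
rewrite ler_wpM2l ?sqr_ge0//; have [M M0 AM] := S2_bounded A.
rewrite (eq_bigr (fun e => qform (@hdot R H) (S2_lin A (P e)))); last first.
  by move=> e _; rewrite sqr_rnorm.
apply: (@trace_contraction R K H H (@hdot R H) (S2_lin A) P (hdot_psd H) (@contrP _ _ P) M) => //.
  by move=> x; rewrite -rnorm_snorm; exact: AM.
move=> G bG; apply: le_trans (hs_qform_ub A bG).
by apply: ler_sum => g _; rewrite -sqr_rnorm.
Qed.

Lemma sandwich_subproof H K (P : contr H K) (Q : contr K H) (A : S2 H) :
  hilbert_schmidt (fun x => P (val A (Q x))).
Proof.
have [M M0 AM] := S2_bounded A.
apply: (@mk_hilbert_schmidt _ _ _ M (qform hs_dot A)).
- by move=> a x y; rewrite linearP S2_linear linearP.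
- move=> x; rewrite (le_trans (contrP _ _))// (le_trans (AM _))// ler_wpM2l//.
  exact: contrP.
move=> F bF.
apply: (@le_trans _ _ (\sum_(e <- F) qform (@hdot R H) (S2_lin A (Q e)))).
  apply: ler_sum => e _; rewrite -sqr_rnorm lerXn2r ?nnegrE ?rnorm_ge0//.
  exact: contrP.
apply: (@trace_contraction R K H H (@hdot R H) (S2_lin A) Q (hdot_psd H) (@contrP _ _ Q) M) => //.
  by move=> x; rewrite -rnorm_snorm; exact: AM.
move=> G bG; apply: le_trans (hs_qform_ub A bG).
by apply: ler_sum => g _; rewrite -sqr_rnorm.
Qed.

Lemma sandwich_linear H K (P : contr H K) (Q : contr K H) :
  linear (fun A : S2 H => mkS2 (sandwich_subproof P Q A)).
Proof.
by move=> a A B; apply: S2_eq => x; rewrite S2D S2Z !mkS2E S2D S2Z linearP.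
Qed.

Definition sandwich H K (P : contr H K) (Q : contr K H) : {linear S2 H -> S2 K} :=
  mk_linear (sandwich_linear P Q).

Lemma sandwichE H K (P : contr H K) (Q : contr K H) A x :
  val (sandwich P Q A) x = P (val A (Q x)).
Proof. by []. Qed.

Lemma sandwich_contr H K (P : contr H K) (Q : contr K H) A :
  rnorm (sandwich P Q A) <= rnorm A.
Proof.
rewrite -[leRHS]mul1r; apply: (@S2_le _ _ _ _ Q) => // x.
by rewrite sandwichE mul1r contrP.
Qed.

Lemma rank_one_linear H K (u : K) (v : H) : linear (fun x => hdot x v *: u).
Proof. by move=> a x y; rewrite hdotDl hdotZl scalerDl -scalerA. Qed.

Lemma rank_one_hs H (u v : H) : hilbert_schmidt (rank_one u v).
Proof.
apply: (@mk_hilbert_schmidt _ _ _ (rnorm u * rnorm v) (rnorm u ^+ 2 * rnorm v ^+ 2)).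
- exact: rank_one_linear.
- move=> x; rewrite /rank_one rnormZ -mulrA mulrC ler_wpM2l ?rnorm_ge0//.
  by rewrite [_ * rnorm x]mulrC hdot_rnorm.
move=> F bF.
have -> : \sum_(e <- F) rnorm (rank_one u v e) ^+ 2 =
    rnorm u ^+ 2 * \sum_(e <- F) cabs (hdot v e) ^+ 2.
  by rewrite mulr_sumr; apply: eq_bigr => e _; rewrite rnormZ hdotC cabs_conj exprMn mulrC.
by rewrite ler_wpM2l ?sqr_ge0// bessel.
Qed.

Definition rank_one_S2 H (u v : H) : S2 H := mkS2 (rank_one_hs u v).

Lemma rank_one_S2E H (u v x : H) : val (rank_one_S2 u v) x = hdot x v *: u.
Proof. by []. Qed.

Lemma rnorm_rank_one_S2 H (u v : H) : rnorm (rank_one_S2 u v) = rnorm u * rnorm v.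
Proof.
apply/eqP; rewrite eq_le; apply/andP; split.
  rewrite -(@ler_pXn2r _ 2)// ?nnegrE ?mulr_ge0 ?rnorm_ge0//.
  rewrite S2_rnorm (sqr_snorm hs_dot_psd) exprMn; apply: hs_qform_le => F bF.
  have -> : hs_sum (rank_one_S2 u v) F = rnorm u ^+ 2 * \sum_(e <- F) cabs (hdot v e) ^+ 2.
    by rewrite mulr_sumr; apply: eq_bigr => e _; rewrite rnormZ hdotC cabs_conj exprMn mulrC.
  by rewrite ler_wpM2l ?sqr_ge0// bessel.
have [->|v0] := eqVneq v 0; first by rewrite rnorm0 mulr0 rnorm_ge0.
have nv : 0 < rnorm v.
  by rewrite lt_def rnorm_ge0 andbT; apply: contra v0 => /eqP/rnorm_eq0 ->.
have := S2_apply_le (rank_one_S2 u v) v; rewrite -S2_rnorm rank_one_S2E rnormZ hdotxx cabsR.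
by rewrite ger0_norm ?sqr_ge0// expr2 -mulrA mulrC ler_pM2r// mulrC.
Qed.

End Contractions.

(** * The von Neumann inequality on the bidisk *)

Section BidiskInequality.
Context {R : realType}.

(** With scalar coefficients the symbol is multiplication by a number of modulus at most [M], so
    both hypotheses of [von_neumann] follow at once. *)
Lemma qform_scalar_poly (V : lmodType R[i]) (b : V -> V -> R[i]) (L : {linear V -> V})
    (g : nat -> R[i]) d (M : R) : psd_form b -> 0 <= M ->
  (forall x, qform b (L x) <= qform b x) ->
  (forall w, cabs w = 1 -> cabs (\sum_(k < d) g k * w ^+ k) <= M) ->
  forall x, qform b (\sum_(k < d) g k *: iter k L x) <= M ^+ 2 * qform b x.
Proof.
move=> psdb M0 Lc gM x.
have -> : \sum_(k < d) g k *: iter k L x =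
    \sum_(k < d) iter k L ((g k \*: idfun : {linear V -> V}) x).
  by apply: eq_bigr => k _; rewrite -iter_linearZ.
apply: (von_neumann psdb (C := fun k => g k \*: idfun)); rewrite ?sqr_ge0//.
  by move=> a y /=; rewrite linearZ.
move=> z z1 y.
have -> : \sum_(a < d) z ^+ a *: (g a \*: idfun : {linear V -> V}) y =
    (\sum_(k < d) g k * z ^+ k) *: y.
  by rewrite scaler_suml; apply: eq_bigr => k _; rewrite /= scalerA mulrC.
have gz : cabs (\sum_(k < d) g k * z ^+ k) ^+ 2 <= M ^+ 2.
  by rewrite lerXn2r ?nnegrE ?cabs_ge0 ?gM.
rewrite /= linearZ !(qformZ psdb) -mulrBr; split; first by rewrite ler_wpM2r ?qform_ge0.
by rewrite ler_wpM2r// subr_ge0.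
Qed.

Section Sandwich.
Context {H : hilbertType R}.
Variables A B : contr H H.

Let LA := sandwich A (contr_id H).
Let RB := sandwich (contr_id H) B.

Let LAE X x : val (LA X) x = A (val X x). Proof. by []. Qed.
Let RBE X x : val (RB X) x = val X (B x). Proof. by []. Qed.

Let LA_contr X : qform hs_dot (LA X) <= qform hs_dot X.
Proof.
rewrite -!(sqr_snorm hs_dot_psd) lerXn2r ?nnegrE ?snorm_ge0// -!S2_rnorm.
exact: sandwich_contr.
Qed.

Let RB_contr X : qform hs_dot (RB X) <= qform hs_dot X.
Proof.
rewrite -!(sqr_snorm hs_dot_psd) lerXn2r ?nnegrE ?snorm_ge0// -!S2_rnorm.
exact: sandwich_contr.
Qed.

Let defect X Y := hs_dot X Y - hs_dot (LA X) (LA Y).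

(* Brehmer's positivity condition for [LA] and [RB]; it makes the von Neumann
   inequality available for this commuting pair. *)
Let RB_defect_contr X : qform defect (RB X) <= qform defect X.
Proof.
(* [qform defect Y] is the sum of [qform q (val Y e)] over the basis, so the claim is the trace
   inequality for the form [q] and the contraction [B]. *)
pose q (x y : H) := hdot x y - hdot (A x) (A y).
have Ac x : qform (@hdot R H) (A x) <= qform (@hdot R H) x.
  by rewrite -!sqr_rnorm lerXn2r ?nnegrE ?rnorm_ge0 ?contrP.
have psdq : psd_form q := psd_defect (hdot_psd H) Ac.
have qE x : qform q x = rnorm x ^+ 2 - rnorm (A x) ^+ 2.
  by rewrite qform_defect -!sqr_rnorm.
have sumE (Y : S2 H) (F : {fset H}) : \sum_(e <- F) qform q (val Y e) = hs_sum Y F - hs_sum (LA Y) F.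
  by rewrite -sumrB; apply: eq_bigr => e _; rewrite qE.
have [M M0 XM] := S2_bounded X.
have key F : basis_fset F -> \sum_(e <- F) qform q (val (RB X) e) <= qform defect X.
  move=> bF; apply: (@trace_contraction R H H H q (S2_lin X) B psdq (@contrP _ _ _ B) M) => //.
    move=> x; rewrite (le_trans _ (XM x))// -(@ler_pXn2r _ 2)// ?nnegrE ?snorm_ge0 ?rnorm_ge0//.
    by rewrite (sqr_snorm psdq) qE gerBl sqr_ge0.
  move=> G bG; apply/ler_addgt0Pr => d d0.
  rewrite /defect qform_defect.
  have [_ /(_ d d0)[G' bG' hG']] := hs_qform_sup (LA X).
  have bGG := basis_fsetU bG bG'.
  apply: (@le_trans _ _ (\sum_(g <- (G `|` G')%fset) qform q (val X g))).
    rewrite [leRHS](big_fsetID _ (mem G))/=.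
    have -> : [fset x in (G `|` G')%fset | x \in G]%fset = G.
      by apply/fsetP => x; rewrite !inE; case: (x \in G); rewrite ?andbF.
    by rewrite lerDl; apply: sumr_ge0 => x _; exact: qform_ge0.
  rewrite sumE; have := hs_qform_ub X bGG.
  have := hs_sum_sub (LA X) (fsubsetUr G G'); lra.
rewrite {1}/defect qform_defect lerBlDr; apply/ler_addgt0Pr => d d0.
have [_ /(_ d d0)[F bF hF]] := hs_qform_sup (RB X).
have := key F bF; rewrite sumE.
by have := hs_qform_ub (LA (RB X)) bF; lra.
Qed.

Lemma iter_LA j X : iter j LA X = sandwich (contr_iter A j) (contr_id H) X.
Proof.
apply: S2_eq => x; rewrite sandwichE contr_iterE.
by elim: j => // j IH; rewrite iterS LAE IH.
Qed.

Lemma iter_RB j X : iter j RB X = sandwich (contr_id H) (contr_iter B j) X.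
Proof.
apply: S2_eq => x; rewrite sandwichE contr_iterE.
by elim: j x => // j IH x; rewrite iterS RBE IH -iterSr.
Qed.

(** [von_neumann] is applied to [LA], with polynomials in [RB] as coefficients. For fixed [z] its
    two hypotheses are one-variable inequalities for [RB]: one for the trace form, one for the
    defect form of [LA], on which [RB] is still a contraction. *)
Lemma bidisk_inequality (c : nat -> nat -> R[i]) d (M : R) : 0 <= M ->
  (forall z w, cabs z = 1 -> cabs w = 1 ->
     cabs (\sum_(j < d) \sum_(k < d) c j k * (z ^+ j * w ^+ k)) <= M) ->
  forall X, rnorm (\sum_(j < d) \sum_(k < d)
      c j k *: sandwich (contr_iter A j) (contr_iter B k) X) <= M * rnorm X.
Proof.
move=> M0 cM X.
have lC j : linear (fun Y => \sum_(k < d) c j k *: iter k RB Y).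
  move=> a Y Z; rewrite scaler_sumr -big_split/=; apply: eq_bigr => k _.
  by rewrite !iter_RB linearP scalerDr !scalerA [c j k * a]mulrC.
pose C j : {linear S2 H -> S2 H} := mk_linear (lC j).
have CE j Y : C j Y = \sum_(k < d) c j k *: iter k RB Y by [].
have -> : \sum_(j < d) \sum_(k < d)
    c j k *: sandwich (contr_iter A j) (contr_iter B k) X = \sum_(j < d) iter j LA (C j X).
  apply: eq_bigr => j _; rewrite CE iter_linear_sum; apply: eq_bigr => k _.
  rewrite iter_linearZ iter_RB iter_LA; congr (_ *: _).
  by apply: S2_eq => x; rewrite !sandwichE.
rewrite !S2_rnorm -(@ler_pXn2r _ 2)// ?nnegrE ?mulr_ge0 ?snorm_ge0//.
rewrite exprMn !(sqr_snorm hs_dot_psd).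
apply: (von_neumann hs_dot_psd) => //; rewrite ?sqr_ge0//.
  move=> j Y; rewrite !CE linear_sum; apply: eq_bigr => k _.
  by rewrite linearZ_LR !iter_RB; congr (_ *: _); apply: S2_eq => x; rewrite LAE !sandwichE.
move=> z z1 Y.
have E : \sum_(j < d) z ^+ j *: C j Y =
    \sum_(k < d) (\sum_(j < d) c j k * z ^+ j) *: iter k RB Y.
  under eq_bigr do rewrite CE scaler_sumr.
  rewrite exchange_big/=; apply: eq_bigr => k _; rewrite scaler_suml.
  by apply: eq_bigr => j _; rewrite scalerA mulrC.
have bound w : cabs w = 1 -> cabs (\sum_(k < d) (\sum_(j < d) c j k * z ^+ j) * w ^+ k) <= M.
  move=> w1; rewrite (le_trans _ (cM z w z1 w1))// exchange_big/=.
  rewrite le_eqVlt; apply/orP; left; apply/eqP; congr cabs; apply: eq_bigr => k _.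
  by rewrite mulr_suml; apply: eq_bigr => j _; rewrite mulrA.
set y := \sum_(j < d) _; split.
  by rewrite /y E; apply: (qform_scalar_poly (g := fun k => \sum_(j < d) c j k * z ^+ j)
     hs_dot_psd M0 RB_contr).
rewrite -!qform_defect /y E.
exact: (qform_scalar_poly (g := fun k => \sum_(j < d) c j k * z ^+ j)
     (psd_defect hs_dot_psd LA_contr) M0 RB_defect_contr).
Qed.

End Sandwich.
End BidiskInequality.

(** * Polynomial approximation in the disk algebra *)

Section ComplexDifferentiation.
Context {R : realType}.
Implicit Types (f g : R[i] -> R[i]) (z w a b : R[i]).

(** An increment estimate with real bounds that also covers [h = 0]; affine substitutions need no
    division. *)
Definition cdiff f z (l : R[i]) := forall e : R, 0 < e ->
  exists2 d, 0 < d & forall h, cabs h < d ->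
    cabs (f (z + h) - f z - l * h) <= e * cabs h.

Lemma cabs_real_ge0 (t : R) : 0 <= t -> cabs t%:C = t.
Proof. by move=> t0; rewrite cabsR ger0_norm. Qed.

Lemma derivable_cdiff f z : derivable f z 1 -> cdiff f z (derive1 f z).
Proof.
move=> df e e0; have : (fun h => h^-1 *: ((f \o shift z) (h *: 1) - f z)) @ 0^' --> 'D_1 f z by [].
have -> : 'D_1 f z = derive1 f z by rewrite derive1E.
have ec : 0 < e%:C by rewrite ltr0C.
move=> /cvgrPdist_le/(_ _ ec) /nbhs_ballP[_ /= /complex_gt0P[d d0 ->] hd].
exists d => // h hd'; have [->|h0] := eqVneq h 0.
  by rewrite addr0 subrr mulr0 subr0 cabs0 mulr0.
have := hd h; rewrite /ball/= sub0r normrN normcE ltcR => /(_ hd' h0).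
rewrite normcE lecR /GRing.scale/= mulr1 => hh.
have -> : f (z + h) - f z - derive1 f z * h =
  - (derive1 f z - h^-1 * (f (h + z) - f z)) * h by rewrite [h + z]addrC; field.
by rewrite cabsM cabsN ler_wpM2r ?cabs_ge0.
Qed.

Lemma cdiffD f g z l m : cdiff f z l -> cdiff g z m ->
  cdiff (fun x => f x + g x) z (l + m).
Proof.
move=> fl gm e e0; have e2 := divr_gt0 e0 (ltr0n R 2).
have [d1 d10 h1] := fl _ e2; have [d2 d20 h2] := gm _ e2.
exists (Num.min d1 d2); first by rewrite lt_min d10.
move=> h; rewrite lt_min => /andP[/h1 {}h1 /h2 {}h2].
have -> : f (z + h) + g (z + h) - (f z + g z) - (l + m) * h =
  (f (z + h) - f z - l * h) + (g (z + h) - g z - m * h) by ring.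
by rewrite (le_trans (cabsD _ _))// [e]splitr mulrDl lerD.
Qed.

Lemma cdiff_cst c z : cdiff (fun=> c) z 0.
Proof.
move=> e e0; exists 1 => // h _.
by rewrite subrr mul0r subr0 cabs0 mulr_ge0 ?cabs_ge0// ltW.
Qed.

Lemma cdiffZ f z l c : cdiff f z l -> cdiff (fun x => c * f x) z (c * l).
Proof.
move=> fl e e0; have c1 : 0 < cabs c + 1 by rewrite ltr_wpDl ?cabs_ge0.
have [d d0 hd] := fl _ (divr_gt0 e0 c1); exists d => // h /hd hh.
have -> : c * f (z + h) - c * f z - c * l * h = c * (f (z + h) - f z - l * h) by ring.
rewrite cabsM (@le_trans _ _ ((cabs c + 1) * (e / (cabs c + 1) * cabs h)))//.
  by rewrite ler_pM ?cabs_ge0// lerDl.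
by rewrite mulrA [(_ + 1) * _]mulrC divfK ?gt_eqF.
Qed.

Lemma cdiff_sum I (r : seq I) (f : I -> R[i] -> R[i]) (l : I -> R[i]) z :
  (forall i, cdiff (f i) z (l i)) ->
  cdiff (fun x => \sum_(i <- r) f i x) z (\sum_(i <- r) l i).
Proof.
move=> fl; elim: r => [|i r IH].
  have -> : (fun x => \sum_(i <- [::]) f i x) = fun=> 0.
    by apply/funext => x; rewrite big_nil.
  by rewrite big_nil; exact: cdiff_cst.
have -> : (fun x => \sum_(i <- i :: r) f i x) =
    (fun x => f i x + \sum_(i <- r) f i x).
  by apply/funext => x; rewrite big_cons.
by rewrite big_cons; exact: cdiffD.
Qed.

Lemma cdiff_affine f z a b l : cdiff f (a + z * b) l ->
  cdiff (fun x => f (a + x * b)) z (l * b).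
Proof.
move=> fl e e0; have b1 : 0 < cabs b + 1 by rewrite ltr_wpDl ?cabs_ge0.
have [d d0 hd] := fl _ (divr_gt0 e0 b1).
exists (d / (cabs b + 1)); first exact: divr_gt0.
move=> h; rewrite ltr_pdivlMr// => hh.
have := hd (h * b); rewrite cabsM => /(_ _)/le_trans.
have -> : a + (z + h) * b = a + z * b + h * b by ring.
rewrite -mulrA [b * h]mulrC; apply.
  by apply: le_lt_trans hh; rewrite ler_wpM2l ?cabs_ge0// lerDl.
rewrite mulrAC ler_pdivrMr// mulrA ler_wpM2l ?mulr_ge0 ?cabs_ge0 ?ltW//.
by rewrite ltrDl.
Qed.

Lemma cdiff_poly (p : {poly R[i]}) z : cdiff (horner p) z p^`().[z].
Proof.
elim/poly_ind: p => [|p c IH].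
  have -> : horner (0 : {poly R[i]}) = fun=> 0 by apply/funext => x; rewrite horner0.
  by rewrite deriv0 horner0; exact: cdiff_cst.
move=> e e0; rewrite derivD derivM derivX derivC addr0 !hornerE.
set l := p^`().[z] in IH *.
pose A := cabs z + cabs l + 2.
have A0 : 0 < A by rewrite ltr_wpDl// addr_ge0 ?cabs_ge0.
have eA := divr_gt0 e0 A0.
have [d d0 hd] := IH _ eA.
exists (Num.min d (Num.min 1 (e / A))); first by rewrite !lt_min d0 ltr01 eA.
move=> h; rewrite !lt_min => /andP[/hd {}hd /andP[h1 hA]]; rewrite !hornerE.
have -> : p.[z + h] * (z + h) + c - (p.[z] * z + c) - (l * z + p.[z]) * h =
  (p.[z + h] - p.[z] - l * h) * (z + h) + l * h * h by ring.
rewrite (le_trans (cabsD _ _))// !cabsM.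
have zh : cabs (z + h) <= cabs z + 1 by rewrite (le_trans (cabsD _ _))// lerD2l ltW.
apply: (@le_trans _ _ (e / A * cabs h * (cabs z + 1) + cabs l * cabs h * (e / A))).
  apply: lerD; first by rewrite ler_pM ?cabs_ge0.
  by rewrite ler_wpM2l ?mulr_ge0 ?cabs_ge0// ltW.
have -> : e / A * cabs h * (cabs z + 1) + cabs l * cabs h * (e / A) =
  (e / A * cabs h) * (cabs z + 1 + cabs l) by ring.
have zlA : cabs z + 1 + cabs l <= A by rewrite /A; lra.
have h0 : 0 <= e / A * cabs h by rewrite mulr_ge0 ?cabs_ge0 ?ltW.
apply: (le_trans (ler_wpM2l h0 zlA)).
by rewrite mulrAC divfK ?gt_eqF.
Qed.

Let is_derive_Re f (u a b : R[i]) (t : R) l : cdiff f (a + t%:C * b) l ->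
  is_derive t (1 : R) (fun s : R => complex.Re (u * f (a + s%:C * b)) : R)
    (complex.Re (u * (l * b))).
Proof.
move=> fl; have {}fl : cdiff (fun x => u * f (a + x * b)) t%:C (u * (l * b)).
  by apply: cdiffZ; exact: cdiff_affine.
set F := fun s : R => _; set m := complex.Re _.
have cv : (fun h : R => h^-1 *: ((F \o shift t) (h *: (1 : R)) - F t)) @ 0^' --> m.
  apply/cvgrPdist_le => e e0; have [d d0 hd] := fl e e0.
  apply/nbhs_ballP; exists d => // h /=; rewrite /ball/= sub0r normrN => hd' h0.
  have := hd h%:C; rewrite cabsR => /(_ hd') H.
  have -> : m - h^-1 *: (F (h *: 1 + t) - F t) =
     - h^-1 * (F (t + h) - F t - h * m).
    by rewrite /GRing.scale/= mulr1 [h + t]addrC; field.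
  rewrite normrM normrN normfV mulrC ler_pdivrMr ?normr_gt0//.
  apply: le_trans H; rewrite -lecR -normcE; apply: le_trans (normc_ge_Re _).
  by rewrite lecR /F /m rmorphD [u * (l * b) * _]mulrC !ReB ReZ.
have dF : derivable F t 1 by apply/cvg_ex; exists m.
by apply: DeriveDef => //; exact: (cvg_lim _ cv).
Qed.

(** The real mean value theorem is applied on the segment to the real part of [u * f], with [u] the
    conjugate of [f b - f a]; its increment is the square of [cabs (f b - f a)]. *)
Lemma cdiff_mean_value f g a b (M : R) :
  (forall t : R, 0 <= t <= 1 -> cdiff f (a + t%:C * (b - a)) (g (a + t%:C * (b - a)))) ->
  (forall t : R, 0 < t < 1 -> cabs (g (a + t%:C * (b - a))) <= M) ->
  cabs (f b - f a) <= M * cabs (b - a).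
Proof.
move=> fg gM; pose u := Num.conj (f b - f a).
pose F (s : R) : R := complex.Re (u * f (a + s%:C * (b - a))).
pose dF (s : R) : R := complex.Re (u * (g (a + s%:C * (b - a)) * (b - a))).
have dFF (s : R) : 0 <= s <= 1 -> is_derive s (1 : R) F (dF s).
  by move=> s01; apply: is_derive_Re; exact: fg.
have [||c] := @MVT R F dF 0 1 ltr01.
- by move=> s; rewrite in_itv/= => /andP[s0 s1]; apply: dFF; rewrite !ltW.
- apply: continuous_in_subspaceT => s; rewrite inE/= in_itv/= => s01.
  by apply: differentiable_continuous; apply/derivable1_diffP; have [] := dFF _ s01.
rewrite in_itv/= => c01; rewrite subr0 mulr1.
rewrite /F mul0r addr0 mul1r subrKC -ReB -mulrBr /u [_ * (f b - _)]mulrC mulcC_cabs/=.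
move=> E; set D := cabs (f b - f a) in E *.
have {E} : D ^+ 2 <= D * (M * cabs (b - a)).
  rewrite E (le_trans (Re_le_cabs _))// !cabsM cabs_conj ler_wpM2l ?cabs_ge0//.
  by rewrite ler_wpM2r ?cabs_ge0// gM.
have M0 : 0 <= M by rewrite (le_trans _ (gM c c01))// cabs_ge0.
have [->|D0] := eqVneq D 0; first by rewrite mulr_ge0 ?cabs_ge0.
by rewrite expr2 ler_pM2l// lt_def D0 cabs_ge0.
Qed.

Lemma cdiff_mean_value_sub f g a b c (M : R) :
  (forall t : R, 0 <= t <= 1 -> cdiff f (a + t%:C * (b - a)) (g (a + t%:C * (b - a)))) ->
  (forall t : R, 0 < t < 1 -> cabs (g (a + t%:C * (b - a)) - c) <= M) ->
  cabs (f b - f a - c * (b - a)) <= M * cabs (b - a).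
Proof.
move=> fg gM.
have -> : f b - f a - c * (b - a) = (f b + (- c) * b) - (f a + (- c) * a) by ring.
apply: (@cdiff_mean_value (fun x => f x + (- c) * x) (fun x => g x + (- c) * 1)).
  move=> t /fg fgt; apply: cdiffD => //; apply: cdiffZ => e e0; exists 1 => // h _.
  have -> : a + t%:C * (b - a) + h - (a + t%:C * (b - a)) - 1 * h = 0 by ring.
  by rewrite cabs0 mulr_ge0 ?cabs_ge0// ltW.
by move=> t /gM; rewrite mulr1.
Qed.

Lemma cabs_segment a b (t rho : R) : 0 <= t <= 1 -> cabs a <= rho -> cabs b <= rho ->
  cabs (a + t%:C * (b - a)) <= rho.
Proof.
move=> /andP[t0 t1] ar br.
have -> : a + t%:C * (b - a) = (1 - t)%:C * a + t%:C * b.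
  by rewrite rmorphB rmorph1; ring.
rewrite (le_trans (cabsD _ _))// !cabsM !cabs_real_ge0 ?subr_ge0//.
have : (1 - t) * cabs a <= (1 - t) * rho by rewrite ler_wpM2l ?subr_ge0.
have : t * cabs b <= t * rho by rewrite ler_wpM2l.
lra.
Qed.

End ComplexDifferentiation.

(** * Polynomials approximating a function together with its derivative *)

Section DiskAlgebraApproximation.
Context {R : realType}.
Implicit Types (f g : R[i] -> R[i]) (z w : R[i]).

Lemma closed_diskE z : closed_disk z = (cabs z <= 1) :> Prop.
Proof. by rewrite /closed_disk/= normcE (lecR _ 1). Qed.

Lemma diskE z : disk z = (cabs z < 1) :> Prop.
Proof. by rewrite /disk/= normcE (ltcR _ 1). Qed.

Lemma cabs_le_coords (x y : R) : cabs (x +i* y) <= `|x| + `|y|.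
Proof.
have -> : x +i* y = x%:C + 'i%C * y%:C by rewrite [LHS]complexE.
rewrite (le_trans (cabsD _ _))// cabsM !cabsR.
have -> : cabs ('i%C : R[i]) = 1 by rewrite /cabs/= expr0n/= add0r expr1n sqrtr1.
by rewrite mul1r.
Qed.

Lemma Im_le_cabs z : `|complex.Im z| <= cabs z.
Proof.
by case: z => a b; rewrite /cabs/= -sqrtr_sqr ler_wsqrtr// lerDr sqr_ge0.
Qed.

Lemma normRe_le_cabs z : `|complex.Re z| <= cabs z.
Proof.
by case: z => a b; rewrite /cabs/= -sqrtr_sqr ler_wsqrtr// lerDl sqr_ge0.
Qed.

(** Compactness in the form needed for uniform bounds: a local threshold for [n] becomes a global
    one. The disk is placed in the square of [R * R], so centres [c] outside the disk occur as
    well. *)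
Lemma closed_disk_cover (P : nat -> R[i] -> Prop) :
  (forall c, exists2 d : R, 0 < d & exists N, forall n, (N <= n)%N ->
     forall z, cabs z <= 1 -> cabs (z - c) < d -> P n z) ->
  exists n, forall z, cabs z <= 1 -> P n z.
Proof.
move=> hP.
have : compact (`[-1, 1]%classic `*` `[-1, 1]%classic : set (R * R)).
  by apply: compact_setX; exact: segment_compact.
move=> /compact_near_coveringP /(_ nat \oo
  (fun n p => cabs (p.1 +i* p.2) <= 1 -> P n (p.1 +i* p.2)) _).
case.
  move=> [x y] _; have [d d0 [N hN]] := hP (x +i* y).
  exists (ball (x, y) (d / 2), [set n | (N <= n)%N]).
    by split => /=; [exact: nbhsx_ballx (divr_gt0 d0 (ltr0n R 2))|exists N].
  move=> [[x' y'] n] /= [[xx' yy'] Nn] z1; apply: hN => //.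
  have -> : x' +i* y' - (x +i* y) = (x' - x) +i* (y' - y) by [].
  rewrite (le_lt_trans (cabs_le_coords _ _))// [d]splitr.
  by rewrite ltrD// distrC.
move=> N _ hN; exists N => -[x y] z1.
apply: (hN N (leqnn N) (x, y)) => //=.
by split=> /=; rewrite in_itv/= -ler_norml (le_trans _ z1) ?(normRe_le_cabs (x +i* y)) ?(Im_le_cabs (x +i* y)).
Qed.

Section Continuous.
Variable g : R[i] -> R[i].
Hypothesis gc : forall c, cabs c <= 1 -> forall e : R, 0 < e -> exists2 d : R, 0 < d &
  forall z, cabs z <= 1 -> cabs (z - c) < d -> cabs (g z - g c) <= e.

(** Makes the local condition of [closed_disk_cover] vacuous at centres outside the disk. *)
Lemma disk_outside c : 1 < cabs c -> exists2 d : R, 0 < d & forall z, cabs z <= 1 ->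
  cabs (z - c) < d -> False.
Proof.
move=> c1; exists (cabs c - 1); first by rewrite subr_gt0.
move=> z z1; have := cabsD (c - z) z; rewrite subrK cabs_distC; lra.
Qed.

Lemma disk_bounded : exists M : R, forall z, cabs z <= 1 -> cabs (g z) <= M.
Proof.
have [|n hn] := @closed_disk_cover (fun n z => cabs (g z) <= n%:R).
  move=> c; have [c1|c1] := leP (cabs c) 1; last first.
    have [d d0 hd] := disk_outside c1; exists d => //; exists 0%N => n _ z z1 zc.
    by have := hd z z1 zc.
  have [d d0 hd] := gc c1 ltr01; exists d => //.
  exists (Num.trunc (cabs (g c) + 1)).+1 => n Nn z z1 zc.
  rewrite (le_trans (_ : _ <= cabs (g c) + 1))//.
    have := cabsD (g z - g c) (g c); rewrite subrK; have := hd z z1 zc; lra.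
  rewrite (le_trans (ltW (truncnS_gt _)))// ler_nat//.
by exists n%:R.
Qed.

Lemma disk_uniformly_continuous (e : R) : 0 < e -> exists2 d : R, 0 < d &
  forall z w, cabs z <= 1 -> cabs w <= 1 -> cabs (z - w) < d -> cabs (g z - g w) <= e.
Proof.
move=> e0; have e2 := divr_gt0 e0 (ltr0n R 2).
have [|n hn] := @closed_disk_cover (fun n z => forall w, cabs w <= 1 ->
   cabs (z - w) < n.+1%:R^-1 -> cabs (g z - g w) <= e).
  move=> c; have [c1|c1] := leP (cabs c) 1; last first.
    have [d d0 hd] := disk_outside c1; exists d => //; exists 0%N => n _ z z1 zc.
    by have := hd z z1 zc.
  have [d d0 hd] := gc c1 e2; exists (d / 2); first exact: divr_gt0.
  have [N hN] := @rate_inv R (d / 2) (divr_gt0 d0 (ltr0n R 2)).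
  exists N => n /hN/= dn z z1 zc w w1 zw.
  have h1 : cabs (g z - g c) <= e / 2 by apply: hd => //; lra.
  have h2 : cabs (g w - g c) <= e / 2.
    apply: hd => //; have := cabsD (w - z) (z - c); rewrite subrKA [cabs (w - z)]cabs_distC => h.
    by rewrite (le_lt_trans h)// [d]splitr ltrD// (lt_le_trans zw).
  have := cabsD (g z - g c) (g c - g w); rewrite subrKA [cabs (g c - g w)]cabs_distC => h.
  by rewrite (le_trans h)// [e]splitr lerD.
by exists n.+1%:R^-1; [rewrite invr_gt0 ltr0Sn|move=> z w z1 w1; exact: hn].
Qed.

End Continuous.

Lemma unity_root_near1 (d : R) : 0 < d ->
  exists N0, forall N, (N0 <= N)%N -> cabs (unity_root N - 1 : R[i]) < d.
Proof.
move=> d0; have d2 := divr_gt0 d0 (ltr0n R 2).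
have /cvgrPdist_lt/(_ _ d2) hc := @continuous_cos R 0.
have /cvgrPdist_lt/(_ _ d2) hs := @continuous_sin R 0.
have [t /= t0 ht] := (iffLR (nbhs_ballP _ _)) (filterI hc hs).
have p2 : 0 < (pi : R) *+ 2 by rewrite pmulrn_lgt0// pi_gt0.
have [N0 hN0] := rateZ (ltW p2) (@rate_inv R) (divr_gt0 t0 (ltr0n R 2)).
exists N0.+1 => -[//|N] /hN0 hN; rewrite /= in hN.
have a0 : 0 < pi *+ 2 / N.+1%:R :> R by rewrite divr_gt0// ltr0Sn.
have [|h1 h2] := ht (pi *+ 2 / N.+1%:R).
  by rewrite /ball/= sub0r normrN gtr0_norm// (le_lt_trans hN)// ltr_pdivrMr// ltr_pMr// ltr1n.
rewrite /= cos0 in h1; rewrite /= sin0 in h2.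
have E : unity_root N.+1 - 1 = (cos (pi *+ 2 / N.+1%:R) - 1) +i* (sin (pi *+ 2 / N.+1%:R) - 0).
  by rewrite /unity_root /cis; simpc.
rewrite -[ltLHS]/(cabs (unity_root N.+1 - 1)) E.
by rewrite (le_lt_trans (cabs_le_coords _ _))// [d]splitr ltrD// distrC.
Qed.

Section InnerApproximation.
Variables phi g : R[i] -> R[i].
Hypothesis dphi : forall z, cabs z < 1 -> cdiff phi z (g z).
Hypothesis gc : forall c, cabs c <= 1 -> forall e : R, 0 < e -> exists2 d : R, 0 < d &
  forall z, cabs z <= 1 -> cabs (z - c) < d -> cabs (g z - g c) <= e.

(* A discrete Cauchy integral formula.  With the nodes [zeta k = r * w ^+ k], [w]
   an [N]-th root of unity, the function
   [h t = N^-1 * \sum_k phi (z + t (zeta k - z)) * \sum_(n < N) (z / zeta k) ^+ n]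
   equals [phi z] at [0] and a polynomial in [z] at [1].  The sum
   [\sum_k phi' (z + t (zeta k - z)) * zeta k] in its derivative is small because the
   increments of [phi] around a closed polygon add up to [0]. *)
Lemma inner_poly_approx (rho e : R) : 0 <= rho < 1 -> 0 < e ->
  exists p : {poly R[i]}, forall z, cabs z <= rho -> cabs (phi z - p.[z]) <= e.
Proof.
move=> /andP[rho0 rho1] e0.
have [r [r0 r1 rhor]] : exists r : R, [/\ 0 < r, r < 1 & rho < r].
  by exists ((1 + rho) / 2); split; lra.
have [M gM] := disk_bounded gc.
have M0 : 0 <= M by rewrite (le_trans (cabs_ge0 (g 0)))// gM// cabs0.
have e2 := divr_gt0 e0 (ltr0n R 2).
have [d d0 hd] := disk_uniformly_continuous gc e2.
have [N0 hN0] := unity_root_near1 d0.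
have q01 : 0 <= rho / r < 1 by rewrite divr_ge0 ?(ltW r0)//= ltr_pdivrMr// mul1r.
have eM : 0 < e / 2 / (M + 1) by rewrite divr_gt0// ltr_wpDl.
have [n0 hn0] := expr_small q01 eM.
(* Beyond [N0] neighbouring nodes are closer than the modulus of continuity [d]; beyond [n0] the
   geometric tail is small. Adding 2 ensures [w != 1]. *)
pose N := (maxn N0 n0).+2.
pose w : R[i] := unity_root N.
have wd : cabs (w - 1) < d by apply: hN0; rewrite /N !leqW// leq_maxl.
have qN : M * (rho / r) ^+ N <= e / 2.
  have /andP[q0 q1] := q01.
  have : (rho / r) ^+ N <= (rho / r) ^+ n0.
    by rewrite ler_wiXn2l// ?(ltW q1)// /N !leqW// leq_maxr.
  move=> /le_lt_trans/(_ hn0); rewrite ltr_pdivlMr ?ltr_wpDl// => /ltW h.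
  by rewrite (le_trans _ h)// mulrC ler_wpM2l ?exprn_ge0// lerDl.
have w1 : w != 1 by apply: (@unity_root_neq1 R N 1).
have NC : (N%:R : R[i]) != 0 by rewrite pnatr_eq0.
pose rC : R[i] := r%:C; have rC0 : rC != 0 by rewrite -cabs_eq0 cabs_real_ge0 ?gt_eqF ?ltW.
pose zeta k : R[i] := rC * w ^+ k.
pose v k : R[i] := Num.conj (w ^+ k).
have vw k : v k * w ^+ k = 1.
  by rewrite mulrC mulcC_cabs cabsX cabs_unity_root !expr1n.
have cz k : cabs (zeta k) = r.
  by rewrite cabsM cabsX cabs_unity_root expr1n mulr1 cabs_real_ge0// ltW.
have cv k : cabs (v k) = 1 by rewrite cabs_conj cabsX cabs_unity_root expr1n.
have zetaN : zeta N = zeta 0%N by rewrite /zeta unity_rootN.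
pose u z k := z * v k / rC.
have uz z k : zeta k * u z k = z.
  by rewrite /u /zeta; transitivity (z * (v k * w ^+ k)); [field|rewrite vw mulr1].
pose s z k := \sum_(n < N) u z k ^+ n.
pose p : {poly R[i]} := \poly_(n < N) (N%:R^-1 * \sum_(k < N) phi (zeta k) * (v k / rC) ^+ n).
exists p => z zrho.
pose h x := N%:R^-1 * \sum_(k < N) s z k * phi (z + x * (zeta k - z)).
pose h' x := N%:R^-1 * \sum_(k < N) s z k * (g (z + x * (zeta k - z)) * (zeta k - z)).
have h1 : h 1 = p.[z].
  rewrite /h /p horner_poly.
  under [RHS]eq_bigr do rewrite -mulrA; rewrite -mulr_sumr; congr (_ * _).
  under [RHS]eq_bigr do rewrite mulr_suml.
  rewrite [RHS]exchange_big/=; apply: eq_bigr => k _; rewrite mul1r addrC subrK mulr_suml.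
  apply: eq_bigr => n _; rewrite /u mulrC -[in RHS]mulrA; congr (_ * _).
  by rewrite -exprMn; congr (_ ^+ _); ring.
have h0 : h 0 = phi z.
  rewrite /h; under eq_bigr do rewrite mul0r addr0; rewrite -mulr_suml /s exchange_big/=.
  (* For [0 < j < N] the inner sum runs over a nontrivial character and vanishes; only [j = 0]
     contributes. *)
  have -> : \sum_(j < N) \sum_(i < N) u z i ^+ j = N%:R.
    rewrite /N big_ord_recl [X in _ + X]big1 ?addr0; last first.
      move=> j _; rewrite (eq_bigr (fun i : 'I_N => (z / rC) ^+ bump 0 j * Num.conj ((w ^+ bump 0 j) ^+ i))).
        rewrite -mulr_sumr -rmorph_sum/= unity_root_sum ?conjC0 ?mulr0//.
        by rewrite /bump/= add1n ltnS ltn_ord.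
      move=> i _; rewrite /u /v mulrAC exprMn; congr (_ * _).
      by rewrite -rmorphXn/= exprAC.
    by under eq_bigr do rewrite expr0; rewrite sumr_const card_ord.
  by rewrite mulrA mulVf// mul1r.
have seg k (t : R) : 0 <= t <= 1 -> cabs (z + t%:C * (zeta k - z)) <= r.
  by move=> t01; apply: cabs_segment; rewrite ?cz// (le_trans zrho)// ltW.
have hh' (t : R) : 0 <= t <= 1 -> cdiff h t%:C (h' t%:C).
  move=> t01; apply: cdiffZ; apply: cdiff_sum => k; apply: cdiffZ.
  by apply: cdiff_affine; apply: dphi; rewrite (le_lt_trans (seg k t t01)).
have h'le (t : R) : 0 < t < 1 -> cabs (h' t%:C) <= e.
  move=> /andP[t0 t1]; have t01 : 0 <= t <= 1 by rewrite !ltW.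
  pose W k := z + t%:C * (zeta k - z).
  (* Since [zeta k - z = zeta k * (1 - u z k)] and [s z k] is a geometric sum, their product is
     [zeta k * (1 - u z k ^+ N)]. *)
  have sz k : s z k * (g (W k) * (zeta k - z)) =
      g (W k) * zeta k - g (W k) * zeta k * u z k ^+ N.
    have := subrX1 (u z k) N; rewrite -/(s z k) => /eqP; rewrite subr_eq => /eqP ->.
    by rewrite -{2}(uz z k); ring.
  have -> : h' t%:C = N%:R^-1 * (\sum_(k < N) g (W k) * zeta k) -
      N%:R^-1 * \sum_(k < N) g (W k) * zeta k * u z k ^+ N.
    by rewrite -mulrBr -sumrB; congr (_ * _); apply: eq_bigr => k _; rewrite sz.
  have Nr : cabs (N%:R^-1 : R[i]) = N%:R^-1.
    by rewrite cabsV -(rmorph_nat (real_complex R)) cabs_real_ge0.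
  have gW k : cabs (g (W k)) <= M by rewrite gM// (le_trans (seg k t t01))// ltW.
  rewrite (le_trans (cabsB _ _))// [e]splitr lerD//; last first.
    rewrite cabsM Nr ler_pdivrMl ?ltr0n// (le_trans (cabs_sum _ _ _))//.
    apply: (@le_trans _ _ (\sum_(k < N) (e / 2))); last first.
      by rewrite sumr_const card_ord mulr_natl.
    apply: ler_sum => k _; apply: le_trans qN; rewrite cabsM [X in X * _]cabsM cabsX cz.
    have gr : cabs (g (W k)) * r <= M.
      by rewrite -[leRHS]mulr1 ler_pM ?cabs_ge0 ?(ltW r0) ?(ltW r1).
    have uq : cabs (u z k) <= rho / r.
      by rewrite /u !cabsM cv mulr1 cabsV cabs_real_ge0 ?(ltW r0)// ler_pM2r ?invr_gt0.
    rewrite ler_pM ?exprn_ge0 ?cabs_ge0 ?mulr_ge0 ?cabs_ge0 ?(ltW r0)//.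
    by rewrite lerXn2r ?nnegrE ?cabs_ge0 ?divr_ge0 ?(ltW r0).
  rewrite cabsM Nr ler_pdivrMl ?ltr0n//.
  pose D k := W k.+1 - W k.
  have DE k : D k = t%:C * (w - 1) * zeta k by rewrite /D /W /zeta exprS; ring.
  have cD k : cabs (D k) = t * cabs (w - 1) * r.
    by rewrite DE cabsM cz cabsM cabs_real_ge0 ?(ltW t0).
  have tw : 0 < cabs (t%:C * (w - 1)).
    by rewrite lt_def cabs_ge0 andbT cabs_eq0 mulf_neq0 ?subr_eq0// -cabs_eq0 cabs_real_ge0 ?gt_eqF ?ltW.
  rewrite -(ler_pM2l tw) -cabsM.
  (* The factor [t (w - 1)] turns [zeta k] into the edge from [W k] to [W k.+1]. Each edge then
     leaves only the first-order error of [phi], at most [e / 2] times its length. *)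
  have -> : t%:C * (w - 1) * \sum_(k < N) g (W k) * zeta k =
      - \sum_(k < N) (phi (W k.+1) - phi (W k) - g (W k) * (W k.+1 - W k)).
    rewrite sumrB -[X in _ = - (X - _)](big_mkord xpredT (fun k => phi (W k.+1) - phi (W k))).
    rewrite telescope_sumr// /W zetaN subrr sub0r opprK mulr_sumr.
    by apply: eq_bigr => k _; rewrite -/(W _) -/(W _) -/(D k) DE; ring.
  rewrite cabsN (le_trans (cabs_sum _ _ _))//.
  apply: (@le_trans _ _ (\sum_(k < N) (e / 2 * cabs (D k)))).
    apply: ler_sum => k _; apply: (@cdiff_mean_value_sub _ phi g).
      move=> x x01; apply: dphi; apply: le_lt_trans r1.
      by apply: cabs_segment => //; exact: seg.
    move=> x /andP[x0 x1]; have x01 : 0 <= x <= 1 by rewrite !ltW.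
    have W1 m : cabs (W m) <= 1 by rewrite (le_trans (seg m t t01))// ltW.
    apply: hd; [by apply: cabs_segment|by []|].
      rewrite addrAC subrr add0r -/(D k) cabsM cabs_real_ge0 ?(ltW x0)// cD.
      apply: le_lt_trans wd; rewrite -[leRHS]mul1r ler_pM ?(ltW x0) ?(ltW x1)//.
        by rewrite mulr_ge0 ?mulr_ge0 ?cabs_ge0 ?(ltW r0) ?(ltW t0).
      rewrite mulrAC -[leRHS]mul1r ler_pM ?cabs_ge0 ?mulr_ge0 ?(ltW r0) ?(ltW t0)//.
      by rewrite -[leRHS]mulr1 ler_pM ?(ltW r0) ?(ltW r1) ?(ltW t0) ?(ltW t1).
  under eq_bigr do rewrite cD.
  rewrite sumr_const card_ord -[leLHS]mulr_natl cabsM cabs_real_ge0 ?(ltW t0)//.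
  have -> : t * cabs (w - 1) * (N%:R * (e / 2)) = N%:R * (e / 2 * (t * cabs (w - 1))) by ring.
  rewrite ler_wpM2l ?ler0n// ler_wpM2l ?(ltW e2)//.
  by rewrite -[leRHS]mulr1 ler_wpM2l ?(ltW r1)// mulr_ge0 ?cabs_ge0 ?(ltW t0).
have := @cdiff_mean_value _ h h' 0 1 e.
rewrite subr0 cabs1 mulr1 h1 h0 cabs_distC; apply => t t01; rewrite mulr1 add0r.
  exact: hh'.
exact: h'le.
Qed.

(** The polynomial is a difference quotient, with step [h], of an approximation of [phi], taken at
    [rho z] so that all points stay inside the disk. The shares of [e / 3] pay for moving [z] to
    [rho z], for the quotient of [phi], and for the approximation, whose error enters twice and is
    divided by [h]. *)
Lemma derivative_poly_approx (e : R) : 0 < e ->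
  exists q : {poly R[i]}, forall z, cabs z <= 1 -> cabs (g z - q.[z]) <= e.
Proof.
move=> e0; have e3 := divr_gt0 e0 (ltr0n R 3).
have [d d0 hd] := disk_uniformly_continuous gc e3.
have [rho [rho0 rho1 rhod]] : exists rho : R, [/\ 0 <= rho, rho < 1 & 1 - rho < d].
  exists (1 - Num.min d 1 / 2).
  have m0 : 0 < Num.min d 1 by rewrite lt_min d0 ltr01.
  have m1 : Num.min d 1 <= 1 by rewrite ge_min lexx orbT.
  have md : Num.min d 1 <= d by rewrite ge_min lexx.
  by split; lra.
have [h [h0 hd' h1]] : exists h : R, [/\ 0 < h, h < d & rho + h < 1].
  exists (Num.min d (1 - rho) / 2).
  have m0 : 0 < Num.min d (1 - rho) by rewrite lt_min d0 subr_gt0.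
  have m1 : Num.min d (1 - rho) <= 1 - rho by rewrite ge_min lexx orbT.
  have md : Num.min d (1 - rho) <= d by rewrite ge_min lexx.
  by split; lra.
have rh : 0 <= rho + h < 1 by rewrite h1 addr_ge0// ltW.
have eh : 0 < e / 3 * h / 2 by rewrite divr_gt0// mulr_gt0.
have [p hp] := inner_poly_approx rh eh.
pose hC : R[i] := h%:C; pose rC : R[i] := rho%:C.
have hC0 : hC != 0 by rewrite -cabs_eq0 cabs_real_ge0 ?gt_eqF ?ltW.
exists (hC^-1 *: ((p \Po (rC *: 'X + hC%:P)) - (p \Po (rC *: 'X)))) => z z1.
rewrite hornerZ hornerD hornerN !horner_comp hornerD hornerC hornerZ hornerX.
set y := rC * z.
have yr : cabs y <= rho by rewrite cabsM cabs_real_ge0// -[leRHS]mulr1 ler_wpM2l.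
have yhr : cabs (y + hC) <= rho + h.
  by rewrite (le_trans (cabsD _ _))// lerD// cabs_real_ge0// ltW.
have A1 : cabs (g z - g y) <= e / 3.
  apply: hd => //; first by rewrite (le_trans yr)// ltW.
  have -> : z - y = (1 - rho)%:C * z by rewrite /y rmorphB rmorph1 mulrBl mul1r.
  rewrite cabsM cabs_real_ge0 ?subr_ge0 ?(ltW rho1)// (le_lt_trans _ rhod)//.
  by rewrite -[leRHS]mulr1 ler_wpM2l// subr_ge0 ltW.
have A2 : cabs (phi (y + hC) - phi y - g y * (y + hC - y)) <= e / 3 * cabs (y + hC - y).
  have seg (t : R) : 0 <= t <= 1 -> cabs (y + t%:C * (y + hC - y)) <= rho + h.
    by move=> t01; apply: cabs_segment => //; rewrite (le_trans yr)// lerDl ltW.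
  apply: (@cdiff_mean_value_sub _ phi g).
    by move=> t t01; apply: dphi; rewrite (le_lt_trans (seg t t01)).
  move=> t /andP[t0 t1]; have t01 : 0 <= t <= 1 by rewrite !ltW.
  apply: hd; [by rewrite (le_trans (seg t t01))// ltW|by rewrite (le_trans yr)// ltW|].
  rewrite [y + hC]addrC addrK [y + _]addrC addrK cabsM !cabs_real_ge0 ?(ltW t0) ?(ltW h0)//.
  by rewrite (le_lt_trans _ hd')// -[leRHS]mul1r ler_wpM2r ?ltW.
have B1 := hp y (le_trans yr (_ : rho <= rho + h)).
have B2 := hp _ yhr.
have {}B1 : cabs (phi y - p.[y]) <= e / 3 * h / 2 by apply: B1; rewrite lerDl ltW.
rewrite [y + hC]addrC addrK [hC + y]addrC cabs_real_ge0 ?(ltW h0)// in A2.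
have -> : g z - hC^-1 * (p.[y + hC] - p.[y]) = (g z - g y) +
   hC^-1 * ((phi (y + hC) - p.[y + hC]) - (phi y - p.[y])
            - (phi (y + hC) - phi y - g y * hC)) by field.
rewrite (le_trans (cabsD _ _))//.
have -> : e = e / 3 + h^-1 * (e / 3 * h / 2 + e / 3 * h / 2 + e / 3 * h).
  by field; rewrite gt_eqF.
rewrite lerD// cabsM cabsV cabs_real_ge0 ?(ltW h0)// ler_wpM2l ?invr_ge0 ?(ltW h0)//.
rewrite (le_trans (cabsB _ _))// lerD// (le_trans (cabsB _ _))// lerD//.
Qed.

End InnerApproximation.

Lemma poly_antiderivative (q : {poly R[i]}) c : exists P : {poly R[i]}, P^`() = q /\ P.[0] = c.
Proof.
exists (\poly_(i < (size q).+1) (if i is j.+1 then q`_j / j.+1%:R else c)); split.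
  apply/polyP => i; rewrite coef_deriv coef_poly ltnS.
  case: ltnP => iq; last by rewrite mul0rn nth_default.
  by rewrite -[LHS]mulr_natr divfK// pnatr_eq0.
by rewrite horner_coef0 coef_poly.
Qed.

Lemma complex_complete (u : nat -> R[i]) (e : nat -> R) : rate e ->
  (forall m n, (m <= n)%N -> cabs (u m - u n) <= e m) ->
  exists l, forall m, cabs (u m - l) <= 2 * e m.
Proof.
move=> re ue.
have real_complete (v : nat -> R) : (forall m n, (m <= n)%N -> `|v m - v n| <= e m) ->
    exists l, forall m, `|v m - l| <= e m.
  move=> ve; have /cauchy_cvg/cvg_ex[/= l vl] : cauchy (v @ \oo).
    apply: cauchy_exP => d d0; have [N hN] := re _ (divr_gt0 d0 (ltr0n R 2)).
    exists (v N); exists N => // n /= Nn; rewrite /ball/= (le_lt_trans (ve _ _ Nn))//.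
    by rewrite (le_lt_trans (hN _ (leqnn N)))// ltr_pdivrMr// ltr_pMr// ltr1n.
  exists l => m; apply/ler_addgt0Pr => d d0.
  have /cvgrPdist_lt/(_ _ d0)[N _ hN] := vl.
  have h := hN (maxn N m) (leq_maxl _ _); have h' := ve m _ (leq_maxr N m).
  by rewrite (le_trans (ler_distD (v (maxn N m)) _ _))// lerD// distrC ltW.
have [x hx] := real_complete (fun n => complex.Re (u n))
  (fun m n mn => le_trans (eq_ind _ (fun a => `|a| <= _) (normRe_le_cabs (u m - u n)) _ (ReB _ _)) (ue m n mn)).
have ImB z w : complex.Im (z - w) = complex.Im z - complex.Im w by case: z w => a b [].
have [y hy] := real_complete (fun n => complex.Im (u n))
  (fun m n mn => le_trans (eq_ind _ (fun a => `|a| <= _) (Im_le_cabs (u m - u n)) _ (ImB _ _)) (ue m n mn)).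
exists (x +i* y) => m; rewrite mulr_natl mulr2n.
have -> : u m - (x +i* y) = (complex.Re (u m) - x) +i* (complex.Im (u m) - y).
  by case: (u m).
by rewrite (le_trans (cabs_le_coords _ _))// lerD.
Qed.

(** The value of the [lim] is determined because the filter is proper: the points [(1 - m / 2) z] of
    the open disk approach [z], also when [z] is on the circle. *)
Lemma disk_ext_lim f l z : cabs z <= 1 ->
  (forall e : R, 0 < e -> exists2 d : R, 0 < d & forall w, cabs w < 1 -> cabs (w - z) < d ->
     cabs (f w - l) <= e) ->
  disk_ext f z = l.
Proof.
move=> z1 fl.
have PF : ProperFilter (within disk (nbhs z)).
  apply: within_nbhs_proper => B /nbhs_ballP[_ /= /complex_gt0P[d d0 ->] dB].
  have m0 : 0 < Num.min d 1 by rewrite lt_min d0 ltr01.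
  have m1 : Num.min d 1 <= 1 by rewrite ge_min lexx orbT.
  have md : Num.min d 1 <= d by rewrite ge_min lexx.
  exists ((1 - Num.min d 1 / 2)%:C * z); split.
    rewrite diskE cabsM cabs_real_ge0; last by lra.
    by apply: (@le_lt_trans _ _ (1 - Num.min d 1 / 2)); [rewrite -[leRHS]mulr1 ler_wpM2l//; lra|lra].
  apply: dB; rewrite /ball/= normcE ltcR.
  have -> : z - (1 - Num.min d 1 / 2)%:C * z = (Num.min d 1 / 2)%:C * z.
    by rewrite rmorphB rmorph1 mulrBl mul1r opprB addrC subrK.
  rewrite cabsM cabs_real_ge0; last by lra.
  by apply: (@le_lt_trans _ _ (Num.min d 1 / 2)); [rewrite -[leRHS]mulr1 ler_wpM2l//; lra|lra].
apply: cvg_lim; first exact: norm_hausdorff.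
apply/cvgrPdist_le => eps /complex_gt0P[e e0 ->]; have [d d0 hd] := fl e e0.
apply/nbhs_ballP; exists d%:C => /=; first by rewrite ltr0C.
move=> w; rewrite /ball/= normcE ltcR cabs_distC => wz; rewrite diskE => w1.
by rewrite normcE lecR cabs_distC hd.
Qed.

(** Only [phi'] is approximated. Antiderivatives that agree with [phi] at 0 converge by the mean
    value inequality on radii, and their limits supply the boundary values of [phi]. Two of them
    differ by at most twice the first rate, and [complex_complete] doubles this to the constant
    4. *)
Theorem disk_algebra_approximation phi :
  analytic_disk phi -> in_disk_algebra (derive1 phi) ->
  exists P : nat -> {poly R[i]},
    (forall n z, cabs z <= 1 -> cabs ((P n).[z] - disk_ext phi z) <= 4 * n.+1%:R^-1) /\
    (forall n z, cabs z <= 1 ->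
       cabs ((P n)^`().[z] - disk_ext (derive1 phi) z) <= n.+1%:R^-1).
Proof.
move=> aphi [g [_ cg] phig].
have dphi z : cabs z < 1 -> cdiff phi z (g z).
  by rewrite -diskE => zd; rewrite -phig//; apply: derivable_cdiff; exact: aphi.
have gc c : cabs c <= 1 -> forall e : R, 0 < e -> exists2 d : R, 0 < d &
  forall z, cabs z <= 1 -> cabs (z - c) < d -> cabs (g z - g c) <= e.
  rewrite -closed_diskE => c1 e e0.
  move/subspace_continuousP/(_ c c1)/cvgrPdist_le : cg => /(_ e%:C).
  rewrite ltr0C => /(_ e0)/nbhs_ballP[_ /= /complex_gt0P[d d0 ->] hd].
  exists d => // z z1 zc; have := hd z.
  rewrite /ball/= !normcE ltcR lecR [cabs (c - z)]cabs_distC [cabs (g c - _)]cabs_distC; apply => //.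
  by move: z1; rewrite -closed_diskE.
pose e n : R := n.+1%:R^-1.
have e0 n : 0 < e n by rewrite invr_gt0 ltr0Sn.
have e_le m n : (m <= n)%N -> e n <= e m.
  by move=> mn; rewrite lef_pV2 ?posrE ?ltr0Sn// ler_nat ltnS.
have exP n : exists P : {poly R[i]}, P.[0] = phi 0 /\
    (forall z, cabs z <= 1 -> cabs (g z - P^`().[z]) <= e n).
  have [q hq] := derivative_poly_approx dphi gc (e0 n).
  by have [P [Pq P0]] := poly_antiderivative q (phi 0); exists P; rewrite Pq.
pose P n := sval (cid (exP n)).
have P0 n : (P n).[0] = phi 0 by rewrite /P; case: cid => ? [].
have dP n z : cabs z <= 1 -> cabs (g z - (P n)^`().[z]) <= e n.
  by rewrite /P; case: cid => ? [] /= _; exact.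
have seg z (t : R) : cabs z <= 1 -> 0 < t < 1 -> cabs (0 + t%:C * (z - 0)) < 1.
  move=> z1 /andP[t0 t1]; rewrite add0r subr0 cabsM cabs_real_ge0 ?(ltW t0)//.
  by rewrite (le_lt_trans _ t1)// -[leRHS]mulr1 ler_wpM2l// ltW.
have PP m n z : (m <= n)%N -> cabs z <= 1 -> cabs ((P m).[z] - (P n).[z]) <= 2 * e m.
  move=> mn z1.
  have -> : (P m).[z] - (P n).[z] = (P m - P n).[z] - (P m - P n).[0].
    by rewrite !hornerE !P0; ring.
  apply: (@le_trans _ _ (2 * e m * cabs (z - 0))); last first.
    by rewrite subr0 -[leRHS]mulr1 ler_wpM2l// mulr_ge0// ltW.
  apply: (@cdiff_mean_value _ (horner (P m - P n)) (horner (P m - P n)^`())).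
    by move=> t _; exact: cdiff_poly.
  move=> t /(seg z t z1)/ltW h; rewrite derivB hornerD hornerN.
  set y := _ + _ in h *.
  have -> : (P m)^`().[y] - (P n)^`().[y] = (g y - (P n)^`().[y]) - (g y - (P m)^`().[y]) by ring.
  by rewrite (le_trans (cabsB _ _))// mulr_natl mulr2n lerD ?dP// (le_trans (dP n y h))// e_le.
have phiP n z : cabs z < 1 -> cabs (phi z - (P n).[z]) <= e n.
  move=> z1; have -> : phi z - (P n).[z] =
     (phi z + (-1) * (P n).[z]) - (phi 0 + (-1) * (P n).[0]) by rewrite P0; ring.
  apply: (@le_trans _ _ (e n * cabs (z - 0))); last first.
    by rewrite subr0 -[leRHS]mulr1 ler_wpM2l// ltW.
  apply: (@cdiff_mean_value _ (fun x => phi x + (-1) * (P n).[x])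
     (fun x => g x + (-1) * (P n)^`().[x])).
    move=> t t01; apply: cdiffD; last by apply: cdiffZ; exact: cdiff_poly.
    apply: dphi; rewrite (le_lt_trans _ z1)// cabs_segment// ?cabs0 ?cabs_ge0//.
  by move=> t /(seg z t (ltW z1))/ltW h; rewrite mulN1r; exact: dP.
exists P; split=> [n z z1|n z z1]; last first.
  rewrite cabs_distC (_ : disk_ext _ _ = g z) ?dP//.
  apply: disk_ext_lim => // d /(gc z z1)[d' d'0 hd']; exists d' => // w w1 wz.
  by rewrite phig ?diskE// hd'// ltW.
have [l hl] := @complex_complete (fun n => (P n).[z]) _ (rateZ (ler0n R 2) (@rate_inv R))
  (fun m n mn => PP m n z mn z1).
rewrite (_ : disk_ext _ _ = l); first by rewrite (le_trans (hl n))// mulrA -natrM.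
apply: disk_ext_lim => // d d0.
(* Of the 5, one is for [phi w - (P N).[w]] and four for [(P N).[z] - l]. *)
have [N /(_ N (leqnn N)) hN] := rateZ (ler0n R 5) (@rate_inv R) (divr_gt0 d0 (ltr0n R 2)).
have [d' d'0 hd'] := cdiff_poly (P N) z ltr01.
pose K := cabs (P N)^`().[z] + 1; have K0 : 0 < K by rewrite ltr_wpDl ?cabs_ge0.
exists (Num.min d' (d / 2 / K)); first by rewrite lt_min d'0 divr_gt0// divr_gt0.
move=> w w1; rewrite lt_min => /andP[/hd' h1]; rewrite ltr_pdivlMr// => h2.
rewrite [z + _]addrC subrK in h1.
have h3 : cabs ((P N).[w] - (P N).[z]) <= d / 2.
  rewrite (le_trans _ (ltW h2))// /K mulrDr mulr1.
  rewrite -(subrK ((P N)^`().[z] * (w - z)) ((P N).[w] - (P N).[z])).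
  rewrite (le_trans (cabsD _ _))// addrC lerD//; first by rewrite cabsM mulrC.
  by rewrite mul1r in h1.
have -> : phi w - l = (phi w - (P N).[w]) + ((P N).[w] - (P N).[z]) + ((P N).[z] - l) by ring.
have h4 : cabs (phi w - (P N).[w]) <= N.+1%:R^-1 := phiP N w w1.
have h5 : cabs ((P N).[z] - l) <= 2 * (2 * N.+1%:R^-1) := hl N.
have h6 : 5 * N.+1%:R^-1 <= d / 2 := hN.
apply: le_trans (cabsD _ _) _; apply: le_trans (lerD (cabsD _ _) (lexx _)) _.
apply: le_trans (lerD (lerD h4 h3) h5) _.
have aux (x : R) : 5 * x <= d / 2 -> x + d / 2 + 2 * (2 * x) <= d by lra.
exact: aux h6.
Qed.
End DiskAlgebraApproximation.

(** * Divided differences and differentiability *)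

Section DividedDifferences.
Context {R : realType}.
Implicit Types p q : {poly R[i]}.

Section Sums.
Context {V : lmodType R[i]}.

Lemma big_ord_trunc (f : nat -> V) m n : (m <= n)%N ->
  (forall i, (m <= i)%N -> f i = 0) -> \sum_(i < n) f i = \sum_(i < m) f i.
Proof.
move=> mn f0; rewrite [RHS](big_ord_widen n f mn) [RHS]big_mkcond/=.
by apply: eq_bigr => i _; case: ltnP => // /f0.
Qed.

(** A module-valued [f] serves numbers, polynomials and operators alike. The bound [d] is free so
    that polynomials of different sizes can be compared. *)
Definition dd_sum d p (f : nat -> nat -> V) : V :=
  \sum_(j < d) \sum_(k < d) p`_(j + k).+1 *: f j k.

Lemma dd_sum_size d p f : (size p <= d)%N -> dd_sum d p f = dd_sum (size p) p f.
Proof.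
move=> pd; rewrite /dd_sum.
rewrite (@big_ord_trunc (fun j => \sum_(k < d) p`_(j + k).+1 *: f j k) (size p) d)//.
  apply: eq_bigr => j _.
  rewrite (@big_ord_trunc (fun k => p`_(j + k).+1 *: f j k) (size p) d)// => k pk.
  by rewrite nth_default ?scale0r// (leq_trans pk)// (leq_trans (leq_addl j k)).
move=> j pj; rewrite big1// => k _.
by rewrite nth_default ?scale0r// (leq_trans pj)// (leq_trans (leq_addr k j)).
Qed.

Lemma dd_sumB p q f :
  dd_sum (size (p - q)) (p - q) f = dd_sum (size p) p f - dd_sum (size q) q f.
Proof.
pose d := maxn (size (p - q)) (maxn (size p) (size q)).
rewrite -(@dd_sum_size d (p - q))//; last by rewrite /d leq_maxl.
rewrite -(@dd_sum_size d p); last by rewrite /d !leq_max leqnn orbT.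
rewrite -(@dd_sum_size d q); last by rewrite /d !leq_max leqnn !orbT.
rewrite /dd_sum -sumrB; apply: eq_bigr => j _; rewrite -sumrB.
by apply: eq_bigr => k _; rewrite coefB scalerBl.
Qed.

(** Up to terms beyond the size of [p], the two parts are the sum of [G] over a square without its
    first row and without its first column; the difference of these borders remains. *)
Lemma dd_telescope p (g : nat -> nat -> V) :
  dd_sum (size p) p (fun j k => g j.+1 k - g j k.+1) =
  \sum_(i < size p) p`_i *: (g i 0%N - g 0%N i).
Proof.
set d := size p; pose G j k := p`_(j + k) *: g j k.
have G0 j k : (d <= j + k)%N -> G j k = 0.
  by move=> djk; rewrite /G nth_default ?scale0r.
have h1 : \sum_(j < d) \sum_(k < d) p`_(j + k).+1 *: g j.+1 k =
    \sum_(j < d) \sum_(k < d) G j k - \sum_(k < d) G 0%N k.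
  apply/eqP; rewrite eq_sym subr_eq addrC eq_sym; apply/eqP.
  rewrite -(big_ord_recl d (fun j => \sum_(k < d) G j k)).
  rewrite big_ord_recr/= [X in _ + X]big1 ?addr0// => k _.
  by rewrite G0// leq_addr.
have h2 : \sum_(j < d) \sum_(k < d) p`_(j + k).+1 *: g j k.+1 =
    \sum_(j < d) \sum_(k < d) G j k - \sum_(j < d) G j 0%N.
  rewrite -sumrB; apply: eq_bigr => j _.
  apply/eqP; rewrite eq_sym subr_eq addrC eq_sym; apply/eqP.
  rewrite (eq_bigr (fun k : 'I_d => G j (bump 0 k))); last first.
    by move=> k _; rewrite /G /bump leq0n add1n addnS.
  rewrite -(big_ord_recl d (fun k => G j k)) big_ord_recr/= G0 ?addr0//.
  by rewrite leq_addl.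
rewrite /dd_sum; under eq_bigr do under eq_bigr do rewrite scalerBr.
under eq_bigr do rewrite sumrB; rewrite sumrB h1 h2 opprB addrC addrA subrK.
rewrite -sumrB; apply: eq_bigr => i _.
by rewrite /G addn0 add0n scalerBr.
Qed.

End Sums.

Definition ddp p (z w : R[i]) : R[i] :=
  dd_sum (size p) p (fun j k => z ^+ j * w ^+ k : R[i]^o).

Lemma ddp_mul p z w : (z - w) * ddp p z w = p.[z] - p.[w].
Proof.
rewrite !horner_coef -sumrB.
have := @dd_telescope R[i]^o p (fun j k => z ^+ j * w ^+ k).
rewrite (eq_bigr (fun i : 'I_(size p) => p`_i * z ^+ i - p`_i * w ^+ i)); last first.
  by move=> i _; rewrite /GRing.scale/= !expr0 mul1r mulr1 mulrBr.
move=> <-; rewrite /ddp /dd_sum mulr_sumr; apply: eq_bigr => j _.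
rewrite mulr_sumr; apply: eq_bigr => k _; rewrite /GRing.scale/= !exprS; ring.
Qed.

(** On the diagonal [ddp_mul] reads [0 = 0]. With the indeterminate as second argument it is an
    identity of polynomials, which is differentiated and then evaluated at [z]. *)
Lemma ddp_diag p z : ddp p z z = p^`().[z].
Proof.
pose g (j k : nat) : {poly R[i]} := (z ^+ j)%:P * 'X^k.
have := @dd_telescope {poly R[i]} p g; pose q := dd_sum (size p) p g.
have -> : dd_sum (size p) p (fun j k => g j.+1 k - g j k.+1) = (z%:P - 'X) * q.
  rewrite /q /dd_sum mulr_sumr; apply: eq_bigr => j _.
  rewrite mulr_sumr; apply: eq_bigr => k _; rewrite -!mul_polyC /g !exprS polyCM; ring.
have -> : \sum_(i < size p) p`_i *: (g i 0%N - g 0%N i) = p.[z]%:P - p.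
  rewrite /g; under eq_bigr do rewrite !expr0 mulr1 mul1r scalerBr.
  rewrite sumrB -[X in _ - X = _]poly_def coefK; congr (_ - _).
  rewrite horner_coef rmorph_sum; apply: eq_bigr => i _.
  by rewrite -mul_polyC -polyCM.
move=> /(congr1 deriv); rewrite derivM !derivB derivX !derivC !sub0r.
move=> /(congr1 (horner^~ z)); rewrite !hornerE subrr mul0r addr0 => /eqP.
rewrite mulN1r eqr_opp => /eqP <-.
rewrite /ddp /q /dd_sum horner_sum; apply: eq_bigr => j _.
by rewrite horner_sum; apply: eq_bigr => k _; rewrite hornerZ /g hornerM hornerC hornerXn.
Qed.

(** Off the diagonal this is the mean value inequality on the segment from [w] to [z], which stays
    in the disk by convexity. *)
Lemma ddp_le p (M : R) : (forall z, cabs z <= 1 -> cabs p^`().[z] <= M) ->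
  forall z w, cabs z <= 1 -> cabs w <= 1 -> cabs (ddp p z w) <= M.
Proof.
move=> pM z w z1 w1; have [->|zw] := eqVneq z w; first by rewrite ddp_diag pM.
have zw0 : 0 < cabs (z - w) by rewrite lt_def cabs_ge0 andbT cabs_eq0 subr_eq0.
rewrite -(ler_pM2l zw0) -cabsM ddp_mul [leRHS]mulrC.
apply: (@cdiff_mean_value _ (horner p) (horner p^`())).
  by move=> t _; exact: cdiff_poly.
by move=> t /andP[t0 t1]; apply: pM; apply: cabs_segment; rewrite ?(ltW t0) ?(ltW t1).
Qed.

Section Operators.
Context {H : hilbertType R}.
Implicit Types (A B : contr H H) (X : S2 H).

Definition ddop p A B X : S2 H :=
  dd_sum (size p) p (fun j k => sandwich (contr_iter A j) (contr_iter B k) X).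

Lemma ddopB p q A B X : ddop (p - q) A B X = ddop p A B X - ddop q A B X.
Proof. exact: dd_sumB. Qed.

Lemma ddop_le p A B X (M : R) : (forall z, cabs z <= 1 -> cabs p^`().[z] <= M) ->
  rnorm (ddop p A B X) <= M * rnorm X.
Proof.
move=> pM; have M0 : 0 <= M by rewrite (le_trans _ (pM 0 _))// ?cabs_ge0// cabs0.
apply: (bidisk_inequality A B (c := fun j k => p`_(j + k).+1)) => // z w z1 w1.
by apply: (ddp_le pM); rewrite ?z1 ?w1.
Qed.

Lemma poly_op_size p n (A : H -> H) x : (size p <= n)%N ->
  poly_op p A x = \sum_(i < n) p`_i *: iter i A x.
Proof.
move=> pn; rewrite (@big_ord_trunc _ (fun i => p`_i *: iter i A x) _ _ pn)// => i pi.
by rewrite nth_default// scale0r.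
Qed.

Lemma poly_opB p q (A : H -> H) x :
  poly_op (p - q) A x = poly_op p A x - poly_op q A x.
Proof.
pose d := maxn (size (p - q)) (maxn (size p) (size q)).
rewrite (@poly_op_size (p - q) d)//; last by rewrite /d leq_maxl.
rewrite (@poly_op_size p d); last by rewrite /d !leq_max leqnn orbT.
rewrite (@poly_op_size q d); last by rewrite /d !leq_max leqnn !orbT.
by rewrite -sumrB; apply: eq_bigr => i _; rewrite coefB scalerBl.
Qed.

Lemma poly_op_le p A x (M : R) : 0 <= M -> (forall z, cabs z <= 1 -> cabs p.[z] <= M) ->
  rnorm (poly_op p A x) <= M * rnorm x.
Proof.
move=> M0 pM; rewrite -(@ler_pXn2r _ 2)// ?nnegrE ?mulr_ge0 ?rnorm_ge0//.
rewrite exprMn !sqr_rnorm.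
apply: (qform_scalar_poly (g := fun k => p`_k) (hdot_psd H) (L := A)) => //.
  by move=> y; rewrite -!sqr_rnorm lerXn2r ?nnegrE ?rnorm_ge0// contrP.
by move=> w w1; rewrite -horner_coef pM ?w1.
Qed.

Lemma iter_linearB (L : {linear H -> H}) n x y :
  iter n L (x - y) = iter n L x - iter n L y.
Proof. by elim: n => // n IH; rewrite !iterS IH linearB. Qed.

(** The scalar [c] stands for the increment of the parameter, so that [X] stays the same along the
    segment. *)
Lemma ddop_telescope p A B X c x : (forall x, A x - B x = c *: val X x) ->
  poly_op p A x - poly_op p B x = c *: val (ddop p A B X) x.
Proof.
move=> AB; have := @dd_telescope H p (fun j k => iter j A (iter k B x)).
rewrite (_ : \sum_(i < _) _ = poly_op p A x - poly_op p B x); last first.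
  by rewrite -sumrB; apply: eq_bigr => i _; rewrite scalerBr.
move=> <-; rewrite /ddop /dd_sum S2_suml scaler_sumr; apply: eq_bigr => j _.
rewrite S2_suml scaler_sumr; apply: eq_bigr => k _.
rewrite S2Z sandwichE !contr_iterE scalerA mulrC -scalerA; congr (_ *: _).
by rewrite -iter_linearZ -AB iterSr (iterS k) iter_linearB.
Qed.

End Operators.
End DividedDifferences.

(** * The functional calculus along a segment and its derivative *)

Section Differentiability.
Context {R : realType} {H : hilbertType R}.
Implicit Types (A B : contr H H) (X : S2 H).

Lemma iter_contr_dist A B (r : R) : (forall x, rnorm (A x - B x) <= r * rnorm x) ->
  0 <= r -> forall j x, rnorm (iter j A x - iter j B x) <= j%:R * r * rnorm x.
Proof.
move=> AB r0; elim=> [|j IH] x; first by rewrite subrr rnorm0 !mul0r.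
have iterB y : rnorm (iter j B y) <= rnorm y.
  by rewrite -contr_iterE contrP.
rewrite !iterS -(subrKA (A (iter j B x))) -linearB (le_trans (rnormD _ _))//.
rewrite -natr1 !mulrDl mul1r lerD//; first exact: le_trans (contrP _ _) (IH x).
by rewrite (le_trans (AB _))// ler_wpM2l.
Qed.

(** The constant may depend on [p], since the polynomial is fixed before the increment becomes
    small. Only the left operator moves: the right one is the base point in both expressions. *)
Lemma ddop_lipschitz (p : {poly R[i]}) : exists2 K : R, 0 <= K &
  forall A B X r, 0 <= r -> (forall x, rnorm (A x - B x) <= r * rnorm x) ->
    rnorm (ddop p A B X - ddop p B B X) <= K * r * rnorm X.
Proof.
pose K := \sum_(j < size p) \sum_(k < size p) cabs p`_(j + k).+1 * j%:R.
exists K.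
  by apply: sumr_ge0 => j _; apply: sumr_ge0 => k _; rewrite mulr_ge0 ?cabs_ge0.
move=> A B X r r0 AB; rewrite /ddop /dd_sum -sumrB (le_trans (rnorm_sum _ _ _))//.
rewrite /K !mulr_suml; apply: ler_sum => j _.
rewrite -sumrB (le_trans (rnorm_sum _ _ _))// !mulr_suml; apply: ler_sum => k _.
rewrite -scalerBr rnormZ -!mulrA ler_wpM2l ?cabs_ge0// mulrA.
apply: (@S2_le _ _ _ _ _ (contr_iter B k)); first by rewrite mulr_ge0.
by move=> x; rewrite S2B !sandwichE !(contr_iterE _ j); exact: iter_contr_dist.
Qed.

Section Calculus.
Variables (phi : R[i] -> R[i]) (P : nat -> {poly R[i]}).
Let e n : R := n.+1%:R^-1.
Hypothesis Pphi : forall n z, cabs z <= 1 -> cabs ((P n).[z] - disk_ext phi z) <= 4 * e n.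
Hypothesis dPphi : forall n z, cabs z <= 1 ->
  cabs ((P n)^`().[z] - disk_ext (derive1 phi) z) <= e n.

Let e_gt0 n : 0 < e n. Proof. by rewrite invr_gt0 ltr0Sn. Qed.
Let e_le m n : (m <= n)%N -> e n <= e m.
Proof. by move=> mn; rewrite lef_pV2 ?posrE ?ltr0Sn// ler_nat ltnS. Qed.

Lemma closed_disk_cabs (z : R[i]) : closed_disk z -> cabs z <= 1.
Proof. by rewrite closed_diskE. Qed.

(** The polynomials that witness [is_disk_calculus] are arbitrary; von Neumann's inequality compares
    them with the fixed [P n]. *)
Lemma disk_calculus_approx A (F : H -> H) : is_disk_calculus phi A F ->
  forall n x, rnorm (poly_op (P n) A x - F x) <= 4 * e n * rnorm x.
Proof.
move=> [p [pphi pF]] n x; apply/ler_addgt0Pr => d d0.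
pose c := d / 2 / (rnorm x + 1).
have x1 : 0 < rnorm x + 1 by rewrite ltr_wpDl ?rnorm_ge0.
have c0 : 0 < c by rewrite !divr_gt0.
have cC : 0 < c%:C by rewrite ltr0C.
have [N1 _ h1] := pphi _ cC; have [N2 _ h2] := pF _ cC.
pose m := maxn N1 N2.
have {}h1 z : cabs z <= 1 -> cabs ((p m).[z] - disk_ext phi z) <= c.
  move=> z1; have := h1 m (leq_maxl _ _) z; rewrite normcE lecR; apply.
  by rewrite closed_diskE.
have {}h2 y : rnorm (poly_op (p m) A y - F y) <= c * rnorm y.
  by have := h2 m (leq_maxr _ _) y; rewrite !rnormE -rmorphM/= lecR.
rewrite (le_trans (rnorm_dist_triangle _ _ (poly_op (p m) A x)))//.
have h3 : rnorm (poly_op (P n) A x - poly_op (p m) A x) <= (4 * e n + c) * rnorm x.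
  rewrite -poly_opB; apply: poly_op_le; first by apply: addr_ge0; [apply: mulr_ge0 => //|]; exact: ltW.
  move=> z z1; rewrite hornerD hornerN.
  have -> : (P n).[z] - (p m).[z] = ((P n).[z] - disk_ext phi z) - ((p m).[z] - disk_ext phi z) by ring.
  by rewrite (le_trans (cabsB _ _))// lerD ?Pphi ?h1.
have hc : c * rnorm x <= d / 2.
  rewrite -[leRHS](divfK (_ : rnorm x + 1 != 0)) ?gt_eqF// -/c.
  by rewrite ler_wpM2l ?lerDl// ltW.
by apply: le_trans (lerD h3 (h2 x)) _; rewrite mulrDl; lra.
Qed.

(** [disk_calculus] is a [get], so its specification rests on existence, shown here by the limit of
    the [P n]. *)
Lemma disk_calculusP A : is_disk_calculus phi A (disk_calculus phi A).
Proof.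
suff [F hF] : exists F, is_disk_calculus phi A F.
  exact: (@getPex _ [set A' | is_disk_calculus phi A A'] (ex_intro _ F hF)).
have lim_ex x : exists y, forall n, rnorm (poly_op (P n) A x - y) <= rnorm x * (8 * e n).
  apply: complete_rate; first by apply: rateZ; rewrite ?rnorm_ge0//; apply: rateZ => //; exact: rate_inv.
  move=> m n mn; rewrite -poly_opB mulrC; apply: poly_op_le; first by apply: mulr_ge0 => //; exact: ltW.
  move=> z z1; rewrite hornerD hornerN.
  have -> : (P m).[z] - (P n).[z] = ((P m).[z] - disk_ext phi z) - ((P n).[z] - disk_ext phi z) by ring.
  rewrite (le_trans (cabsB _ _))// (le_trans (lerD (Pphi m z1) (Pphi n z1)))//.
  by have := e_le mn; lra.
exists (fun x => sval (cid (lim_ex x))), P; split=> eps /complex_gt0P[d d0 ->].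
  have [N hN] := rateZ (ler0n R 4) (@rate_inv R) d0.
  exists N => // n /= /hN hn z /closed_disk_cabs z1.
  by rewrite normcE lecR (le_trans (Pphi n z1)).
have [N hN] := rateZ (ler0n R 8) (@rate_inv R) d0.
exists N => // n /= /hN hn x; case: cid => /= y hy.
rewrite !rnormE -rmorphM/= lecR (le_trans (hy n))// mulrC ler_wpM2r ?rnorm_ge0//.
Qed.

Lemma ddop_limit A B X : exists L : S2 H, forall n,
  rnorm (ddop (P n) A B X - L) <= rnorm X * (2 * e n).
Proof.
apply: (@complete_rate R (S2 H) (fun n => ddop (P n) A B X)).
  by apply: rateZ; rewrite ?rnorm_ge0//; apply: rateZ => //; exact: rate_inv.
move=> m n mn; rewrite -ddopB mulrC; apply: ddop_le => z z1.
rewrite derivB hornerD hornerN.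
have -> : (P m)^`().[z] - (P n)^`().[z] = ((P m)^`().[z] - disk_ext (derive1 phi) z)
   - ((P n)^`().[z] - disk_ext (derive1 phi) z) by ring.
rewrite (le_trans (cabsB _ _))// (le_trans (lerD (dPphi m z1) (dPphi n z1)))//.
by have := e_le mn; lra.
Qed.

Lemma disk_calculus_diff A B X L c x : (forall x, A x - B x = c *: val X x) ->
  (forall n, rnorm (ddop (P n) A B X - L) <= rnorm X * (2 * e n)) ->
  disk_calculus phi A x - disk_calculus phi B x = c *: val L x.
Proof.
move=> AB hL; apply: rnorm_small_eq => d d0.
pose K := 8 * rnorm x + cabs c * rnorm X * 2 * rnorm x.
have K0 : 0 <= K by rewrite addr_ge0// ?mulr_ge0 ?rnorm_ge0 ?cabs_ge0.
have [N /(_ N (leqnn N)) hN] := rateZ K0 (@rate_inv R) d0.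
apply: le_trans hN; rewrite -/(e N).
have := ddop_telescope (P N) x AB.
set DA := disk_calculus phi A x; set DB := disk_calculus phi B x.
set pA := poly_op (P N) A x; set pB := poly_op (P N) B x => tel.
have -> : DA - DB - c *: val L x = - (pA - DA) + (pB - DB)
    + c *: (val (ddop (P N) A B X - L) x).
  by rewrite S2B scalerBr -tel opprB addrA -(addrA (DA - pA)) (addrC (pB - DB)) !subrKA.
rewrite (le_trans (rnormD _ _))// /K mulrDl lerD//.
  rewrite (le_trans (rnormD _ _))// rnormN.
  have h1 := disk_calculus_approx (disk_calculusP A) N x.
  have h2 := disk_calculus_approx (disk_calculusP B) N x.
  by rewrite (le_trans (lerD h1 h2))//; lra.
rewrite rnormZ -!mulrA ler_wpM2l ?cabs_ge0//.
rewrite (le_trans (S2_apply_le _ _))// -S2_rnorm.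
rewrite (le_trans (ler_wpM2r (rnorm_ge0 x) (hL N)))// le_eqVlt; apply/orP; left; apply/eqP; ring.
Qed.

(** The difference quotient [Q] and [L] are both within the same rate of their [N]-th
    approximations, uniformly in [s]; for fixed [N] these approximations differ by a multiple of
    [s]. *)
Lemma disk_calculus_hs_derivative (C : R -> contr H H) (F : R -> H -> H) X (t : R) L :
  0 <= t <= 1 ->
  (forall s, 0 <= s <= 1 -> F s = disk_calculus phi (C s)) ->
  (forall s x, 0 <= t + s <= 1 -> C (t + s) x - C t x = s%:C *: val X x) ->
  (forall n, rnorm (ddop (P n) (C t) (C t) X - L) <= rnorm X * (2 * e n)) ->
  hs_derivative F t L.
Proof.
move=> t01 FC CX hL eps /complex_gt0P[d d0 ->].
have [N /(_ N (leqnn N)) hN] := rateZ (rnorm_ge0 X) (rateZ (ler0n R 4) (@rate_inv R)) (divr_gt0 d0 (ltr0n R 2)).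
have [K K0 hK] := ddop_lipschitz (P N).
pose M := K * rnorm X * rnorm X + 1.
have M0 : 0 < M by rewrite ltr_wpDl// !mulr_ge0 ?rnorm_ge0.
exists (d / 2 / M); first by rewrite !divr_gt0.
move=> s s0 sd ts01; have [Q hQ] := ddop_limit (C (t + s)) (C t) X.
exists Q; split=> [x|].
  rewrite !FC// (disk_calculus_diff (c := s%:C) x _ hQ); last by move=> y; exact: CX.
  by rewrite scalerA -rmorphM/= mulVf// scale1r.
rewrite hs_normE ltcR -S2_rnorm.
have h1 := hQ N; have h2 := hL N.
have h3 : rnorm (ddop (P N) (C (t + s)) (C t) X - ddop (P N) (C t) (C t) X) <=
    K * (`|s| * rnorm X) * rnorm X.
  apply: hK => [|x]; first by rewrite mulr_ge0 ?rnorm_ge0.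
  by rewrite CX// rnormZ cabsR -mulrA ler_wpM2l// S2_rnorm S2_apply_le.
have h4 : K * (`|s| * rnorm X) * rnorm X < d / 2.
  move: sd; rewrite ltr_pdivlMr// => sd; apply: le_lt_trans sd.
  rewrite /M mulrDr mulr1.
  have -> : K * (`|s| * rnorm X) * rnorm X = `|s| * (K * rnorm X * rnorm X) by ring.
  by rewrite lerDl.
rewrite rnorm_distC in h1.
apply: le_lt_trans (rnorm_dist_triangle _ _ (ddop (P N) (C (t + s)) (C t) X)) _.
apply: le_lt_trans (lerD (lexx _) (rnorm_dist_triangle _ _ (ddop (P N) (C t) (C t) X))) _.
rewrite rnorm_distC in h1.
have h5 : rnorm X * (2 * e N) + rnorm X * (2 * e N) <= d / 2.
  by apply: le_trans hN; rewrite -/(e N) -mulrDr ler_wpM2l ?rnorm_ge0//; lra.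
rewrite [rnorm (Q - _)]rnorm_distC.
apply: le_lt_trans (lerD h1 (lerD h3 h2)) _; lra.
Qed.

End Calculus.
End Differentiability.

(** * Extension of spectral measures *)

Section Projections.
Context {R : realType} {K : hilbertType R}.

Lemma minimal_orthogonal (u v : K) :
  (forall c : R[i], rnorm u <= rnorm (u + c *: v)) -> hdot u v = 0.
Proof.
move=> uv; set a := hdot u v.
have [v0|v0] := eqVneq (rnorm v) 0; first by rewrite /a (rnorm_eq0 v0) linear0r.
pose q := rnorm v ^+ 2; have q0 : 0 < q by rewrite exprn_gt0// lt_def v0 rnorm_ge0.
have := uv (- (q^-1%:C * a)).
rewrite -(@ler_pXn2r _ 2)// ?nnegrE ?rnorm_ge0// !sqr_rnorm (qformD (hdot_psd K)).
rewrite (qformZ (hdot_psd K)) -[qform _ v]sqr_rnorm -/q cabsN cabsM cabsR exprMn.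
rewrite real_normK ?num_real// hdotZr rmorphN rmorphM/= conjR.
have -> : - (q^-1%:C * Num.conj a) * hdot u v = - (q^-1 * cabs a ^+ 2)%:C.
  by rewrite -/a rmorphM/= -mulcC_cabs; ring.
have -> : complex.Re (- (q^-1 * cabs a ^+ 2)%:C) = - (q^-1 * cabs a ^+ 2) by [].
have -> : q^-1 ^+ 2 * cabs a ^+ 2 * q = q^-1 * cabs a ^+ 2 by field; rewrite gt_eqF.
rewrite mulr2n => h.
have : q^-1 * cabs a ^+ 2 <= 0 by lra.
rewrite pmulr_rle0 ?invr_gt0// => h2.
have /eqP : cabs a ^+ 2 == 0 by rewrite eq_le h2 sqr_ge0.
by move/eqP; rewrite expf_eq0/= cabs_eq0 => /eqP.
Qed.

Section ContractiveIdempotent.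
Variable P : {linear K -> K}.
Hypothesis Pc : forall x, rnorm (P x) <= rnorm x.
Hypothesis PP : forall x, P (P x) = P x.

(** [P] maps [u + c *: v] to [u], so a contractive [P] makes [u] the shortest vector of that
    line. *)
Lemma proj_ker_orthogonal u v : P u = u -> P v = 0 -> hdot u v = 0.
Proof.
move=> Pu Pv; apply: minimal_orthogonal => c.
by have := Pc (c *: v + u); rewrite linearP Pu Pv scaler0 add0r [u + _]addrC.
Qed.

Lemma proj_orthogonal x y : hdot (P x) (y - P y) = 0.
Proof. by apply: proj_ker_orthogonal; rewrite ?PP// linearB PP subrr. Qed.

Lemma proj_hdot x y : hdot (P x) y = hdot (P x) (P y).
Proof. by apply/eqP; rewrite -subr_eq0 -hdotBr proj_orthogonal. Qed.

End ContractiveIdempotent.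

End Projections.

(** * Finite real-valued measures *)

Section FiniteMeasures.
Context {R : realType} d {X : measurableType d}.
Implicit Types (m : set X -> R) (A B : set X).

(** Countable additivity is expressed by continuity at the empty set, and the values are real, so
    that measures can be added and scaled inside norm estimates. *)
Record fin_measure m : Prop := FinMeasure {
  fmeas_ge0 : forall A, measurable A -> 0 <= m A;
  fmeasU : forall A B, measurable A -> measurable B -> A `&` B = set0 ->
    m (A `|` B) = m A + m B;
  fmeas_cvg0 : forall F : nat -> set X, (forall n, measurable (F n)) ->
    (forall n, F n.+1 `<=` F n) -> \bigcap_n F n = set0 ->
    forall e, 0 < e -> exists n, m (F n) <= e }.

Lemma fin_measureD m1 m2 : fin_measure m1 -> fin_measure m2 ->
  fin_measure (fun A => m1 A + m2 A).
Proof.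
move=> f1 f2; split.
- by move=> A mA; rewrite addr_ge0 ?(fmeas_ge0 f1) ?(fmeas_ge0 f2).
- by move=> A B mA mB AB; rewrite (fmeasU f1)// (fmeasU f2)// addrACA.
- move=> F mF dF F0 e e0; have e2 := divr_gt0 e0 (ltr0n R 2).
  have mono m : fin_measure m -> forall i j, (i <= j)%N -> m (F j) <= m (F i).
    move=> fm i j ij; have sub : F j `<=` F i.
      elim: j ij => [|j IH]; first by rewrite leqn0 => /eqP ->.
      rewrite leq_eqVlt => /orP[/eqP ->//|]; rewrite ltnS => /IH.
      by apply: subset_trans; exact: dF.
    have -> : F i = F j `|` (F i `\` F j) by rewrite setDUK.
    rewrite (fmeasU fm)//; [|exact: measurableD|by rewrite setDIK].
    by rewrite lerDl (fmeas_ge0 fm)//; exact: measurableD.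
  have [n1 h1] := fmeas_cvg0 f1 mF dF F0 e2.
  have [n2 h2] := fmeas_cvg0 f2 mF dF F0 e2.
  exists (maxn n1 n2); rewrite [e]splitr lerD//.
    by rewrite (le_trans _ h1)// mono// leq_maxl.
  by rewrite (le_trans _ h2)// mono// leq_maxr.
Qed.

Lemma fin_measureZ c m : 0 <= c -> fin_measure m -> fin_measure (fun A => c * m A).
Proof.
move=> c0 f; split.
- by move=> A mA; rewrite mulr_ge0 ?(fmeas_ge0 f).
- by move=> A B mA mB AB; rewrite (fmeasU f)// mulrDr.
- move=> F mF dF F0 e e0; have c1 : 0 < c + 1 by rewrite ltr_wpDl.
  have [n h] := fmeas_cvg0 f mF dF F0 (divr_gt0 e0 c1).
  exists n; move: h; rewrite ler_pdivlMr// => h; rewrite (le_trans _ h)// mulrC.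
  by rewrite ler_wpM2l ?(fmeas_ge0 f)// lerDl.
Qed.

Lemma fin_measure0 : fin_measure (fun=> 0).
Proof. by split => // [|F _ _ _ e e0]; [rewrite addr0|exists 0%N; exact: ltW]. Qed.

Section Theory.
Variable m : set X -> R.
Hypothesis fm : fin_measure m.

Lemma fmeas_set0 : m set0 = 0.
Proof.
have := fmeasU fm measurable0 measurable0 (setI0 set0); rewrite setU0 => h.
by apply: (addrI (m set0)); rewrite addr0.
Qed.

Lemma fmeas_le A B : measurable A -> measurable B -> A `<=` B -> m A <= m B.
Proof.
move=> mA mB AB; have -> : B = A `|` (B `\` A) by rewrite setDUK.
rewrite (fmeasU fm)//; [|exact: measurableD|by rewrite setDIK].
by rewrite lerDl (fmeas_ge0 fm)//; exact: measurableD.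
Qed.

Lemma fmeasU2 A B : measurable A -> measurable B -> m (A `|` B) <= m A + m B.
Proof.
move=> mA mB; have -> : A `|` B = A `|` (B `\` A) by rewrite setUDr setDv setD0.
rewrite (fmeasU fm)//; [|exact: measurableD|by rewrite setDIK].
by rewrite lerD2l fmeas_le//; exact: measurableD.
Qed.

End Theory.

Definition symdiff A B := (A `\` B) `|` (B `\` A).

Lemma measurable_symdiff A B : measurable A -> measurable B -> measurable (symdiff A B).
Proof. by move=> mA mB; apply: measurableU; exact: measurableD. Qed.

Lemma symdiffC A B : symdiff (~` A) (~` B) = symdiff A B.
Proof.
rewrite /symdiff; apply/seteqP; split => x /=; have := EM (A x); have := EM (B x); tauto.
Qed.

Lemma symdiffU A A' B B' :
  symdiff (A `|` A') (B `|` B') `<=` symdiff A B `|` symdiff A' B'.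
Proof. by move=> x; rewrite /symdiff /=; have := EM (A x); have := EM (B x); have := EM (A' x); have := EM (B' x); tauto. Qed.

End FiniteMeasures.

(** * Extension of projections from an algebra of sets to its sigma-algebra *)

Section SpectralExtension.
Context {R : realType} {K : hilbertType R} d {X : measurableType d} {I : Type}.
Variables (s : I -> set X) (P : I -> contr K K).
Hypothesis ms : forall i, measurable (s i).
Hypothesis hC : forall i, exists2 j, s j = ~` s i & forall x, P j x = x - P i x.
Hypothesis hI : forall i i', exists2 j, s j = s i `&` s i' & forall x, P j x = P i (P i' x).
Hypothesis hT : exists2 i, s i = setT & forall x, P i x = x.
(* Domination by finite measures makes [P i f] a Cauchy filter as [s i] approaches
   a measurable set. *)
Hypothesis hdom : forall f (e : R), 0 < e -> exists2 m, fin_measure m &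
  forall i, rnorm (P i f) ^+ 2 <= m (s i) + e.
Hypothesis hgen : forall D : set X, measurable D -> <<s range s >> D.

Let hU i i' : exists2 j, s j = s i `|` s i' &
  forall x, P j x = P i x + P i' x - P i (P i' x).
Proof.
have [j jE jP] := hC i; have [j' jE' jP'] := hC i'.
have [k kE kP] := hI j j'; have [l lE lP] := hC k; exists l.
  by rewrite lE kE jE jE' setCI !setCK.
by move=> x; rewrite lP kP jP jP' (linearB (P i)) opprB opprB addrCA (addrCA x) subrr addr0 addrAC.
Qed.

(** The sets that can be approximated in every finite measure form a sigma-algebra: a countable
    union is first cut to a finite one, at the price of a tail of small measure. *)
Lemma algebra_approximation D : measurable D -> forall m : set X -> R, fin_measure m ->
  forall e, 0 < e -> exists i, m (symdiff D (s i)) <= e.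
Proof.
move=> /hgen; pose C := [set D | measurable D /\ forall m : set X -> R, fin_measure m ->
  forall e, 0 < e -> exists i, m (symdiff D (s i)) <= e].
suff sub : <<s range s >> `<=` C by move=> /sub[].
have [t tE _] := hT.
have CC D' : C D' -> C (~` D').
  move=> [mD hD]; split; first exact: measurableC.
  move=> m fm e /(hD m fm)[i hi]; have [j jE _] := hC i; exists j.
  by rewrite jE symdiffC.
have Cs i : C (s i).
  split=> // m fm e e0; exists i.
  by rewrite /symdiff setDv setU0 (fmeas_set0 fm) ltW.
have C0 : C set0 by rewrite -setCT -tE; apply: CC; exact: Cs.
have CU A B : C A -> C B -> C (A `|` B).
  move=> [mA hA] [mB hB]; split; first exact: measurableU.
  move=> m fm e e0; have e2 := divr_gt0 e0 (ltr0n R 2).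
  have [i hi] := hA m fm _ e2; have [j hj] := hB m fm _ e2.
  have [k kE _] := hU i j; exists k; rewrite kE.
  have m1 := measurable_symdiff mA (ms i); have m2 := measurable_symdiff mB (ms j).
  apply: (@le_trans _ _ (m (symdiff A (s i) `|` symdiff B (s j)))).
    apply: fmeas_le => //; [|exact: measurableU|exact: symdiffU].
    by apply: measurable_symdiff; exact: measurableU.
  by rewrite [e]splitr (le_trans (fmeasU2 fm _ _))// lerD.
apply: smallest_sub; last by move=> _ [i _ <-].
split => //; first by move=> A CA; rewrite setTD; exact: CC.
move=> F CF; have mF n : measurable (F n) by have [] := CF n.
pose U n := \bigcup_(k in `I_n) F k.
have CUn n : C (U n).
  rewrite /U; elim: n => [|n IH]; first by rewrite II0 bigcup_set0.
  by rewrite bigcup_mkord big_ord_recr/= -bigcup_mkord; exact: CU.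
split=> [|m fm e e0]; first exact: bigcup_measurable.
have e2 := divr_gt0 e0 (ltr0n R 2).
have mU n : measurable (U n) by have [] := CUn n.
have mT : measurable (\bigcup_n F n) by exact: bigcup_measurable.
have [|||n hn] := fmeas_cvg0 fm (F := fun n => (\bigcup_n F n) `\` U n) _ _ _ e2.
- by move=> n; exact: measurableD.
- move=> n x [xF nU]; split => // -[k kn Fkx]; apply: nU; exists k => //=.
  exact: ltnW.
- apply/seteqP; split => // x /= hx; have [[k _ Fkx] _] := hx 0%N Logic.I.
  by have [_] := hx k.+1 Logic.I; apply; exists k => /=.
have [i hi] := (CUn n).2 m fm _ e2.
exists i; rewrite [e]splitr.
apply: (@le_trans _ _ (m (((\bigcup_n F n) `\` U n) `|` symdiff (U n) (s i)))).
  apply: fmeas_le => //.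
  - exact: measurable_symdiff.
  - by apply: measurableU; [exact: measurableD|exact: measurable_symdiff].
  - move=> x [[xF nsx]|[sx nF]].
      by have [Ux|nUx] := EM (U n x); [right; left|left].
    by right; right; split => // -[k _ Fkx]; apply: nF; exists k.
rewrite (le_trans (fmeasU2 fm _ _)) ?lerD//; first exact: measurableD.
exact: measurable_symdiff.
Qed.

(** The dominating measure changes with the vector [f], so the approach to [D] is measured by all
    finite measures at once; sums of measures make this a filter. *)
Let Fil D := filter_from [set p : (set X -> R) * R | fin_measure p.1 /\ 0 < p.2]
  (fun p => [set i | p.1 (symdiff D (s i)) <= p.2]).

Let Fil_proper D : measurable D -> ProperFilter (Fil D).
Proof.
move=> mD; apply: filter_from_proper; last first.
  by move=> [m e] [/= fm e0]; have [i hi] := algebra_approximation mD fm e0; exists i.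
apply: filter_from_filter; first by exists (fun=> 0, 1); split => //; exact: fin_measure0.
move=> [m e] [m' e'] /= [fm e0] [fm' e0'].
exists (fun A => m A + m' A, Num.min e e').
  by split=> /=; [exact: fin_measureD|rewrite lt_min e0].
move=> i /=; rewrite le_min => /andP[h h']; have mS := measurable_symdiff mD (ms i).
split=> /=; first by apply: le_trans h; rewrite lerDl (fmeas_ge0 fm').
by apply: le_trans h'; rewrite lerDr (fmeas_ge0 fm).
Qed.

Let Fil_meas D (m : set X -> R) (e : R) : fin_measure m -> 0 < e -> Fil D [set i | m (symdiff D (s i)) <= e].
Proof. by move=> fm e0; exists (m, e). Qed.

(** [P i - P j] is the difference of the operators attached to the two halves of the symmetric
    difference, and [m] dominates each of them. *)
Let P_dist f (m : set X -> R) (e : R) i j : fin_measure m -> (forall i, rnorm (P i f) ^+ 2 <= m (s i) + e) ->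
  rnorm (P i f - P j f) <= 2 * Num.sqrt (m (symdiff (s i) (s j)) + e).
Proof.
move=> fm hm; have [i' iE iP] := hC i; have [j' jE jP] := hC j.
have aux k k' : s k `\` s k' `<=` symdiff (s i) (s j) ->
    rnorm (P k f - P k (P k' f)) <= Num.sqrt (m (symdiff (s i) (s j)) + e).
  move=> sub; have [l lE lP] := hC k'; have [n nE nP] := hI k l.
  rewrite -linearB -lP -nP -[leLHS]ger0_norm ?rnorm_ge0// -sqrtr_sqr ler_wsqrtr//.
  rewrite (le_trans (hm n))// lerD2r; apply: fmeas_le => //.
    exact: measurable_symdiff.
  by rewrite nE lE.
have -> : P i f - P j f = (P i f - P i (P j f)) - (P j f - P i (P j f)).
  by rewrite opprB addrA subrK.
rewrite mulr_natl mulr2n (le_trans (rnormB _ _))// lerD//; first by apply: aux => x; left.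
have -> : P j f - P i (P j f) = P i' (P j f) by rewrite iP.
have [n nE nP] := hI i' j; rewrite -nP.
rewrite -[leLHS]ger0_norm ?rnorm_ge0// -sqrtr_sqr ler_wsqrtr//.
rewrite (le_trans (hm n))// lerD2r; apply: fmeas_le => //.
  exact: measurable_symdiff.
by rewrite nE iE => x [nx sx]; right.
Qed.

Let approx_limit D f g := forall e : R, 0 < e -> Fil D [set i | rnorm (P i f - g) <= e].

Let approx_limit_ex D f : measurable D -> exists g, approx_limit D f g.
Proof.
move=> mD; have PF := Fil_proper mD.
have /cauchy_cvg/cvg_ex[g hg] : cauchy ((fun i => P i f) @ Fil D).
  apply: cauchy_exP => eps /complex_gt0P[d0 d00 ->].
  pose e := (d0 / 4) ^+ 2 / 3; have e0 : 0 < e by rewrite divr_gt0// exprn_gt0// divr_gt0.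
  have [m fm hm] := hdom f e0.
  have [i0 hi0] := algebra_approximation mD fm e0.
  exists (P i0 f); apply: filterS (Fil_meas D fm e0) => i hi /=.
  rewrite -ball_normE /ball_/= rnormE ltcR (le_lt_trans (P_dist i0 i fm hm))//.
  have h1 : m (symdiff (s i0) (s i)) <= e + e.
    rewrite (le_trans _ (lerD hi0 hi))// (le_trans _ (fmeasU2 fm _ _))//; last 2 first.
    - exact: measurable_symdiff.
    - exact: measurable_symdiff.
    apply: fmeas_le => //; [exact: measurable_symdiff|by apply: measurableU; exact: measurable_symdiff|].
    by move=> x; rewrite /symdiff/=; have := EM (D x); tauto.
  apply: (@le_lt_trans _ _ (2 * (d0 / 4))); last by lra.
  rewrite ler_pM2l// -[leRHS]ger0_norm ?divr_ge0 ?(ltW d00)// -sqrtr_sqr ler_wsqrtr//.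
  by rewrite (_ : (d0 / 4) ^+ 2 = e + e + e) ?lerD2r// /e; field.
exists g => e e0; have eC : 0 < e%:C by rewrite ltr0C.
move/cvgrPdist_le : hg => /(_ _ eC); apply: filterS => i /=.
by rewrite rnormE lecR rnorm_distC.
Qed.

(** The value 0 at nonmeasurable sets keeps [G0 D] linear, contractive and idempotent for every
    [D]. *)
Let G0 D f : K :=
  if pselect (measurable D) is left mD then sval (cid (approx_limit_ex f mD)) else 0.

Let G0P D f : measurable D -> approx_limit D f (G0 D f).
Proof. by move=> mD; rewrite /G0; case: pselect => // mD'; case: cid. Qed.

Let G0_eq D f g : measurable D -> (forall e : R, 0 < e ->
  exists i, rnorm (P i f - G0 D f) <= e /\ rnorm (P i f - g) <= e) -> G0 D f = g.
Proof.
move=> mD h; apply: rnorm_small_eq => e e0.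
have [i [h1 h2]] := h _ (divr_gt0 e0 (ltr0n R 2)).
rewrite (le_trans (rnorm_dist_triangle _ _ (P i f)))// [e]splitr lerD//.
by rewrite rnorm_distC.
Qed.

Let G0_linear D : linear (G0 D).
Proof.
move=> a f h; have [mD|nD] := EM (measurable D); last first.
  by rewrite /G0; case: pselect => // _; rewrite scaler0 addr0.
apply: G0_eq => // e e0; have PF := Fil_proper mD.
have a0 : 0 < cabs a + 1 by rewrite ltr_wpDl ?cabs_ge0.
pose c := e / 2 / (cabs a + 1); have c0 : 0 < c by rewrite !divr_gt0.
have [i [[h1 h2] h3]] := filter_ex (filterI (filterI (G0P f mD c0) (G0P h mD (divr_gt0 e0 (ltr0n R 2))))
  (G0P (a *: f + h) mD e0)).
exists i; split; first exact: h3.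
rewrite linearP opprD addrACA -scalerBr (le_trans (rnormD _ _))// [e]splitr lerD//.
rewrite rnormZ -[leRHS](divfK (_ : cabs a + 1 != 0)) ?gt_eqF// mulrC.
by rewrite ler_pM ?rnorm_ge0 ?cabs_ge0// lerDl.
Qed.

Let G0_contr D f : rnorm (G0 D f) <= rnorm f.
Proof.
have [mD|nD] := EM (measurable D); last first.
  by rewrite /G0; case: pselect => // _; rewrite rnorm0 rnorm_ge0.
apply/ler_addgt0Pr => e e0; have PF := Fil_proper mD.
have [i hi] := filter_ex (G0P f mD e0).
rewrite -(subKr (P i f) (G0 D f)) (le_trans (rnormB _ _))// lerD//.
exact: contrP.
Qed.

(** [P i f - P i (P i f)] belongs to the intersection of [s i] with its complement; domination on
    the empty set leaves only the arbitrary constant. *)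
Let P_idem i f : P i (P i f) = P i f.
Proof.
have [j jE jP] := hC i; have [k kE kP] := hI i j.
apply/esym/eqP; rewrite -subr_eq0 -linearB -jP -kP; apply/eqP.
apply: rnorm_small_eq => e e0; rewrite subr0.
have [m fm hm] := hdom f (exprn_gt0 2 e0).
rewrite -(@ler_pXn2r _ 2)// ?nnegrE ?rnorm_ge0 ?(ltW e0)// (le_trans (hm k))//.
by rewrite kE jE setICr (fmeas_set0 fm) add0r.
Qed.

Let G0_idem D f : G0 D (G0 D f) = G0 D f.
Proof.
have [mD|nD] := EM (measurable D); last first.
  by rewrite /G0; case: pselect.
apply: G0_eq => // e e0; have PF := Fil_proper mD.
have e2 := divr_gt0 e0 (ltr0n R 2).
have [i [h1 h2]] := filter_ex (filterI (G0P f mD e2) (G0P (G0 D f) mD e0)).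
exists i; split; first exact: h2.
rewrite (le_trans (rnorm_dist_triangle _ _ (P i f)))// [e]splitr lerD//.
rewrite -[X in _ - X](P_idem i f) -linearB (le_trans (contrP _ _))// rnorm_distC//.
Qed.

Let G0_dom f e : 0 < e -> exists2 m, fin_measure m &
  forall D, measurable D -> rnorm (G0 D f) ^+ 2 <= m D + e.
Proof.
move=> e0; have e2 := divr_gt0 e0 (ltr0n R 2); have [m fm hm] := hdom f e2.
exists m => // D mD; have PF := Fil_proper mD.
pose c := Num.min 1 (e / 2 / (2 * rnorm f + 2)).
have f0 : 0 < 2 * rnorm f + 2 by rewrite ltr_wpDl// mulr_ge0 ?rnorm_ge0.
have c0 : 0 < c by rewrite lt_min ltr01 divr_gt0.
have c1 : c <= 1 by rewrite ge_min lexx.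
have cf : c * (2 * rnorm f + 2) <= e / 2 by rewrite -ler_pdivlMr// ge_min lexx orbT.
have [i [h1 h2]] := filter_ex (filterI (G0P f mD c0) (Fil_meas D fm c0)).
have h3 : rnorm (G0 D f) <= rnorm (P i f) + c.
  by rewrite -(subKr (P i f) (G0 D f)) (le_trans (rnormB _ _))// lerD.
have h4 : rnorm (P i f) <= rnorm f by exact: contrP.
have h5 := rnorm_ge0 (P i f).
have h6 : m (s i) <= m D + c.
  rewrite (le_trans _ (lerD (lexx _) h2))// (le_trans _ (fmeasU2 fm _ _))//; last exact: measurable_symdiff.
  apply: fmeas_le => //; first by apply: measurableU => //; exact: measurable_symdiff.
  by move=> x sx; have [Dx|nDx] := EM (D x); [left|right; right].
have h7 : rnorm (G0 D f) ^+ 2 <= (rnorm (P i f) + c) ^+ 2.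
  by rewrite lerXn2r// nnegrE ?rnorm_ge0// addr_ge0// ltW.
have h8 := hm i.
have h9 : c * rnorm (P i f) <= c * rnorm f by rewrite ler_pM2l.
have h10 : c * c <= c by rewrite ger_pMl.
by rewrite sqrrD in h7; rewrite expr2 in h7; rewrite !expr2 in h8 h7 *; lra.
Qed.

Let G0_s i f : G0 (s i) f = P i f.
Proof.
have mD := ms i; have PF := Fil_proper mD.
apply: G0_eq => // e e0.
pose c := (e / 2) ^+ 2 / 2; have c0 : 0 < c by rewrite divr_gt0// exprn_gt0// divr_gt0.
have [m fm hm] := hdom f c0.
have [j [h1 h2]] := filter_ex (filterI (G0P f mD e0) (Fil_meas (s i) fm c0)).
exists j; split; first exact: h1.
rewrite rnorm_distC (le_trans (P_dist i j fm hm))// -ler_pdivlMl//.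
rewrite mulrC -[leRHS]ger0_norm ?divr_ge0 ?(ltW e0)// -sqrtr_sqr ler_wsqrtr//.
by rewrite [leRHS](_ : _ = c + c) ?lerD2r// /c; field.
Qed.

(** For [s i] near [A] and [s j] near [B], the operator of the union is [P i + P j - P i P j]. As
    [A] and [B] are disjoint, [s i] and [s j] overlap only inside the two symmetric differences, so
    the product is small on [f]. *)
Let G0_U A B f : measurable A -> measurable B -> A `&` B = set0 ->
  G0 (A `|` B) f = G0 A f + G0 B f.
Proof.
move=> mA mB AB0; have mU := measurableU _ _ mA mB.
have PFA := Fil_proper mA; have PFB := Fil_proper mB.
apply: rnorm_small_eq => e e0.
pose c := e / 5; have c0 : 0 < c by rewrite divr_gt0.
have c20 : 0 < c ^+ 2 / 3 by rewrite divr_gt0// exprn_gt0.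
have [m fm hm] := hdom f c20.
have [[m' r] [/= fm' r0] hU'] := G0P f mU c0.
pose r' := Num.min (c ^+ 2 / 3) (r / 2).
have r'0 : 0 < r' by rewrite lt_min c20 divr_gt0.
have fmm := fin_measureD fm fm'.
have [i [h1 h2]] := filter_ex (filterI (G0P f mA c0) (Fil_meas A fmm r'0)).
have [j [h3 h4]] := filter_ex (filterI (G0P f mB c0) (Fil_meas B fmm r'0)).
move: h2 h4 => /=; rewrite !le_min => /andP[h2 h2'] /andP[h4 h4'].
have mSi := measurable_symdiff mA (ms i); have mSj := measurable_symdiff mB (ms j).
have pm := fmeas_ge0 fm mSi; have pm' := fmeas_ge0 fm' mSi.
have qm := fmeas_ge0 fm mSj; have qm' := fmeas_ge0 fm' mSj.
have [k kE kP] := hU i j; have [l lE lP] := hI i j.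
have hk : rnorm (P k f - G0 (A `|` B) f) <= c.
  apply: hU' => /=; rewrite kE.
  apply: (@le_trans _ _ (m' (symdiff A (s i) `|` symdiff B (s j)))).
    apply: fmeas_le => //; [|exact: measurableU|exact: symdiffU].
    by apply: measurable_symdiff => //; exact: measurableU.
  by rewrite (le_trans (fmeasU2 fm' _ _))//; lra.
have hl : rnorm (P i (P j f)) <= c.
  rewrite -lP -(@ler_pXn2r _ 2)// ?nnegrE ?rnorm_ge0 ?(ltW c0)// (le_trans (hm l))//.
  have : m (s l) <= m (symdiff A (s i) `|` symdiff B (s j)).
    apply: fmeas_le => //; first exact: measurableU.
    rewrite lE => x [six sjx]; have [Ax|nAx] := EM (A x); last by left; right.
    by right; right; split => // Bx; have : (A `&` B) x by []; rewrite AB0.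
  have := fmeasU2 fm mSi mSj; lra.
have -> : G0 (A `|` B) f - (G0 A f + G0 B f) =
  - (P k f - G0 (A `|` B) f) + (P i f - G0 A f) + (P j f - G0 B f) - P i (P j f).
  rewrite kP opprB [RHS]addrAC [X in _ = X + _]addrAC -[X in _ = X + _ + _]addrA -opprD subrK.
  by rewrite -addrA (addrACA (P i f)) -opprD addrA subrK.
apply: le_trans (rnormB _ _) _.
apply: (@le_trans _ _ ((c + c + c) + c)); last by rewrite /c; lra.
rewrite lerD// (le_trans (rnormD _ _))// lerD// (le_trans (rnormD _ _))// lerD//.
by rewrite rnormN.
Qed.

Definition spectral_ext D : {linear K -> K} := mk_linear (G0_linear D).

Let spectral_ext_proj D x y : hdot (spectral_ext D x) y = hdot (spectral_ext D x) (spectral_ext D y).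
Proof. by apply: proj_hdot; [exact: G0_contr|exact: G0_idem]. Qed.

(** Countable additivity comes from finite additivity, because [G0_dom] makes the projection of [x]
    on the tails [Rm n] small. *)
Theorem spectral_extension :
  spectral spectral_ext /\ forall i x, spectral_ext (s i) x = P i x.
Proof.
split; last by move=> i x; exact: G0_s.
have GU n (D : nat -> set X) x : (forall i, measurable (D i)) -> trivIset setT D ->
    \sum_(i < n) spectral_ext (D i) x = spectral_ext (\bigcup_(k in `I_n) D k) x.
  move=> mD tD; elim: n => [|n IH].
    rewrite big_ord0 II0 bigcup_set0; have [t tE tP] := hT; have [j jE jP] := hC t.
    by rewrite mk_linearE -setCT -tE -jE G0_s jP tP subrr.
  have mU : measurable (\bigcup_(k in `I_n) D k).
    by rewrite bigcup_mkord; exact: bigsetU_measurable.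
  rewrite big_ord_recr/= IH -G0_U//.
    by rewrite !bigcup_mkord big_ord_recr.
  apply/seteqP; split => // y [[k /= kn Dky] Dny].
  have := tD k n Logic.I Logic.I (ex_intro _ y (conj Dky Dny)).
  by move=> kn'; rewrite kn' ltnn in kn.
split; last by move=> D mD x; exact: G0_idem.
split.
- move=> D mD; split.
    exists 1 => x; rewrite mul1r !hdotxx lecR lerXn2r ?nnegrE ?rnorm_ge0//.
    exact: G0_contr.
  by move=> x; rewrite spectral_ext_proj hdotxx ler0c sqr_ge0.
- move=> x; have tr : trivIset setT (fun _ : nat => set0 : set X) by move=> i j _ _ [? []].
  by have := GU 0%N _ x (fun=> measurable0) tr; rewrite big_ord0 II0 bigcup_set0.
- by move=> x; have [t <- tP] := hT; rewrite mk_linearE G0_s tP.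
move=> D mD tD x y.
have mT : measurable (\bigcup_n D n) by exact: bigcup_measurable.
have mU n : measurable (\bigcup_(k in `I_n) D k).
  by rewrite bigcup_mkord; exact: bigsetU_measurable.
apply/cvgrPdist_le => eps /complex_gt0P[e e0 ->].
pose c := e / (rnorm y + 1).
have y0 : 0 < rnorm y + 1 by rewrite ltr_wpDl ?rnorm_ge0.
have c0 : 0 < c by rewrite divr_gt0.
have c2 : 0 < c ^+ 2 / 2 by rewrite divr_gt0// exprn_gt0.
have [m fm hm] := G0_dom x c2.
pose Rm n := (\bigcup_n D n) `\` \bigcup_(k in `I_n) D k.
have mR n : measurable (Rm n) by exact: measurableD.
have Rdec i j : (i <= j)%N -> Rm j `<=` Rm i.
  move=> ij z [zT nz]; split => // -[k /= ki Dkz]; apply: nz; exists k => //=.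
  exact: leq_trans ij.
have [|N hN] := fmeas_cvg0 fm mR (fun n => Rdec n n.+1 (leqnSn n)) _ c2.
  apply/seteqP; split => // z hz; have [[k _ Dkz] _] := hz 0%N Logic.I.
  by have [_] := hz k.+1 Logic.I; apply; exists k => /=.
exists N => // n /= Nn.
rewrite -hdot_suml GU// -hdotBl.
have -> : spectral_ext (\bigcup_n D n) x - spectral_ext (\bigcup_(k in `I_n) D k) x =
    spectral_ext (Rm n) x.
  apply/eqP; rewrite subr_eq addrC; apply/eqP; rewrite !mk_linearE -G0_U//.
    by rewrite setDUK// => z [k _ Dkz]; exists k.
  by rewrite setDIK.
rewrite normcE lecR (le_trans (hdot_rnorm _ _))//.
apply: (@le_trans _ _ (c * rnorm y)); last first.
  by rewrite /c mulrAC ler_pdivrMr// ler_wpM2l ?(ltW e0)// lerDl.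
rewrite ler_wpM2r ?rnorm_ge0// -(@ler_pXn2r _ 2)// ?nnegrE ?rnorm_ge0 ?(ltW c0)//.
rewrite mk_linearE (le_trans (hm _ (mR n)))//.
have : m (Rm n) <= m (Rm N) by apply: fmeas_le => //; exact: Rdec.
lra.
Qed.

End SpectralExtension.

(** * The product spectral measure *)

Section SpectralMeasures.
Context {R : realType} {K : hilbertType R} d {X : measurableType d}.
Variable E : set X -> {linear K -> K}.
Hypothesis spE : spectral E.

Lemma spectral_hdot_ge0 D x : measurable D -> 0 <= hdot (E D x) x.
Proof. by move=> mD; have [[h _ _ _] _] := spE; have [_] := h D mD; exact. Qed.

Lemma spectral0 x : E set0 x = 0. Proof. by have [[_ h _ _] _] := spE. Qed.

Lemma spectralT x : E setT x = x. Proof. by have [[_ _ h _] _] := spE. Qed.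

Lemma spectral_idem D x : measurable D -> E D (E D x) = E D x.
Proof. by move=> mD; have [_ h] := spE; exact: h. Qed.

(** Over the complex numbers a form that is real on the diagonal is Hermitian: its values at [x + y]
    and [x + i y] give the two coordinates. *)
Lemma spectral_hermitian D x y : measurable D ->
  hdot (E D x) y = Num.conj (hdot (E D y) x).
Proof.
move=> mD; pose b x y := hdot (E D x) y.
have bDl u v w : b (u + v) w = b u w + b v w by rewrite /b linearD hdotDl.
have bDr u v w : b w (u + v) = b w u + b w v by rewrite /b (psdDr (hdot_psd K)).
have real u : complex.Im (b u u) = 0 by apply: ger0_Im; exact: spectral_hdot_ge0.
have ImD (u v : R[i]) : complex.Im (u + v) = complex.Im u + complex.Im v by case: u v => ? ? [].
have h1 : complex.Im (b x y) + complex.Im (b y x) = 0.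
  have := real (x + y); rewrite bDl !bDr !ImD !real; lra.
have h2 : complex.Re (b x y) = complex.Re (b y x).
  have := real (x + 'i%C *: y); rewrite bDl !bDr !ImD !real.
  have -> : b x ('i%C *: y) = - 'i%C * b x y.
    by rewrite /b hdotZr; congr (_ * _); simpc.
  have -> : b ('i%C *: y) x = 'i%C * b y x by rewrite /b linearZ hdotZl.
  by case: (b x y) (b y x) => p q [p' q'] /=; lra.
rewrite -/(b x y) -/(b y x); move: h1 h2; case: (b x y) (b y x) => p q [p' q'] /= h1 h2.
by apply/eqP; rewrite eq_complex /= h2 eqxx/=; apply/eqP; lra.
Qed.

Lemma spectral_selfadjoint D x y : measurable D -> hdot (E D x) y = hdot x (E D y).
Proof. by move=> mD; rewrite spectral_hermitian// -hdotC. Qed.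

Lemma spectral_contr D x : measurable D -> rnorm (E D x) <= rnorm x.
Proof.
move=> mD; have h : rnorm (E D x) ^+ 2 <= rnorm (E D x) * rnorm x.
  have := hdotxx (E D x); rewrite spectral_selfadjoint// spectral_idem// => e.
  have := hdot_rnorm x (E D x); rewrite e cabsR ger0_norm ?sqr_ge0// mulrC//.
have [->|n0] := eqVneq (rnorm (E D x)) 0; first exact: rnorm_ge0.
by move: h; rewrite expr2 ler_pM2l// lt_def n0 rnorm_ge0.
Qed.

Definition spectral_proj D : contr K K :=
  if pselect (measurable D) is left mD then Contr (fun x => spectral_contr x mD)
  else contr_id K.

Lemma spectral_projE D x : measurable D -> spectral_proj D x = E D x.
Proof. by move=> mD; rewrite /spectral_proj; case: pselect. Qed.

Lemma spectralU A B x : measurable A -> measurable B -> A `&` B = set0 ->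
  E (A `|` B) x = E A x + E B x.
Proof.
move=> mA mB AB; apply: hdot_eq => y; have [[_ _ _ h] _] := spE.
have mD n : measurable (bigcup2 A B n).
  by case: n => [//|[//|n]]; exact: measurable0.
have := h (bigcup2 A B) mD; rewrite bigcup2E.
have tr : trivIset setT (bigcup2 A B) by rewrite -trivIset_bigcup2.
move=> /(_ tr x y) cv1; have cv2 : (fun n => \sum_(i < n) hdot (E (bigcup2 A B i) x) y) @ \oo -->
    hdot (E A x + E B x) y.
  apply: cvg_near_cst; exists 2%N => // -[|[|n]] //= _.
  rewrite !big_ord_recl big1 ?addr0/= => [|i _]; last by rewrite spectral0 linear0l.
  by rewrite hdotDl.
exact: (cvg_unique (@norm_hausdorff _ R[i]) cv1 cv2).
Qed.

(** Since [E A + E B] is idempotent, [E A] and [E B] anticommute, and anticommuting idempotents have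
    product 0. *)
Lemma spectral_disjoint A B x : measurable A -> measurable B -> A `&` B = set0 ->
  E A (E B x) = 0.
Proof.
move=> mA mB AB; have mU := measurableU _ _ mA mB.
have key z : E A (E B z) = - E B (E A z).
  have := spectral_idem z mU; rewrite !spectralU// !linearD !spectral_idem//.
  rewrite -addrA => /addrI; rewrite addrA -[RHS]add0r => /addIr/eqP.
  by rewrite addr_eq0 => /eqP.
have h1 : E A (E B x) = - E A (E B x).
  by rewrite -{1}(spectral_idem (E B x) mA) key linearN key spectral_idem// -key.
have : (2 : R[i]) *: E A (E B x) = 0.
  by rewrite scaler_nat mulr2n {1}h1 addNr.
by move/eqP; rewrite scaler_eq0 pnatr_eq0/= => /eqP.
Qed.

Lemma spectralI A B x : measurable A -> measurable B -> E A (E B x) = E (A `&` B) x.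
Proof.
move=> mA mB; have mI := measurableI _ _ mA mB.
have mAB := measurableD mA mB; have mBA := measurableD mB mA.
have -> : E B x = E (A `&` B) x + E (B `\` A) x.
  rewrite -spectralU//; first by rewrite setIC setUIDK.
  by apply/seteqP; split => z //=; tauto.
rewrite linearD (spectral_disjoint x mA mBA) ?setDIK// addr0.
have EA z : E A z = E (A `&` B) z + E (A `\` B) z.
  rewrite -spectralU//; first by rewrite setUIDK.
  by apply/seteqP; split => y //=; tauto.
rewrite EA spectral_idem// (spectral_disjoint x mAB mI) ?addr0//.
by apply/seteqP; split => y //=; tauto.
Qed.

Lemma spectral_partition (I : finType) (c : X -> I) (Q : pred I) x :
  (forall i, measurable (c @^-1` [set i])) ->
  measurable [set p | Q (c p)] /\
  \sum_(i | Q i) E (c @^-1` [set i]) x = E [set p | Q (c p)] x.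
Proof.
move=> mc; have := index_enum_uniq I.
(* Restricting to the classes in a list without repetitions allows adding one fibre at a time. *)
suff : forall r : seq I, uniq r -> measurable [set p | (c p \in r) && Q (c p)] /\
    \sum_(i <- r | Q i) E (c @^-1` [set i]) x = E [set p | (c p \in r) && Q (c p)] x.
  move=> h /h[]; suff -> : [set p | (c p \in index_enum I) && Q (c p)] = [set p | Q (c p)] by [].
  by apply/seteqP; split => p /=; rewrite mem_index_enum.
elim=> [|i r IH] /=.
  move=> _; rewrite big_nil (_ : [set p | _] = set0) ?spectral0//.
  by apply/seteqP; split.
move=> /andP[ir /IH[mr {}IH]]; rewrite big_cons; case: ifPn => Qi.
  have -> : [set p | (c p \in i :: r) && Q (c p)] =
      c @^-1` [set i] `|` [set p | (c p \in r) && Q (c p)].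
    apply/seteqP; split => p /=.
      by rewrite inE => /andP[/orP[/eqP ->|cr] Qc]; [left|right; rewrite cr].
    by move=> [->|/andP[cr ->]]; rewrite inE ?eqxx ?Qi// cr orbT.
  split; first exact: measurableU.
  rewrite IH spectralU//; apply/seteqP; split => // p [/= -> /andP[ir' _]].
  by rewrite ir' in ir.
have -> // : [set p | (c p \in i :: r) && Q (c p)] = [set p | (c p \in r) && Q (c p)].
apply/seteqP; split => p /=.
  rewrite inE => /andP[/orP[/eqP cpi Qc|-> -> //]].
  by rewrite -cpi Qc in Qi.
by move=> /andP[cr ->]; rewrite inE cr orbT.
Qed.

(** The proof [sp] is an argument so that the measure structure, which depends on it, can be
    attached to the term. *)
Definition vmeas (sp : spectral E) (u : K) (D : set X) : \bar R := (rnorm (E D u) ^+ 2)%:E.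

Section Measure.
Variable u : K.

Let vmeas0 : vmeas spE u set0 = 0%E.
Proof. by rewrite /vmeas spectral0 rnorm0 expr0n. Qed.

Let vmeas_ge0 D : (0 <= vmeas spE u D)%E.
Proof. by rewrite lee_fin sqr_ge0. Qed.

Lemma spectral_hdotxx D : measurable D -> hdot (E D u) u = (rnorm (E D u) ^+ 2)%:C.
Proof. by move=> mD; rewrite -(spectral_idem u mD) spectral_selfadjoint// spectral_idem// hdotxx. Qed.

Let vmeas_sigma : semi_sigma_additive (vmeas spE u).
Proof.
move=> D mD tD mU; have [[_ _ _ h] _] := spE.
have := h D mD tD u u; rewrite spectral_hdotxx// => cv.
rewrite /vmeas; under eq_fun do rewrite sumEFin.
apply: cvg_EFin; first by near=> n.
apply/cvgrPdist_le => e e0; have eC : 0 < e%:C by rewrite ltr0C.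
move/cvgrPdist_le : cv => /(_ _ eC); apply: filterS => n /=.
have -> : \sum_(i < n) hdot (E (D i) u) u = (\sum_(i < n) rnorm (E (D i) u) ^+ 2)%:C.
  by rewrite rmorph_sum; apply: eq_bigr => i _; rewrite spectral_hdotxx.
rewrite -rmorphB normcE lecR cabsR big_mkord//.
Unshelve. all: by end_near. Qed.

HB.instance Definition _ := isMeasure.Build d X R (vmeas spE u)
  vmeas0 vmeas_ge0 vmeas_sigma.

Let vmeas_fin : fin_num_fun (vmeas spE u).
Proof. by []. Qed.

HB.instance Definition _ := Measure_isFinite.Build d X R (vmeas spE u) vmeas_fin.

End Measure.
End SpectralMeasures.

Section ProductMeasure.
Context {R : realType} {K : hilbertType R} d {X : measurableType d}.
Variable E : set X -> {linear K -> K}.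
Hypothesis spE : spectral E.

Lemma product_fin_measure (u v : K) : exists2 m : set (X * X) -> R, fin_measure m &
  forall A B, measurable A -> measurable B ->
    m (A `*` B) = rnorm (E A u) ^+ 2 * rnorm (E B v) ^+ 2.
Proof.
pose mu := (vmeas spE u \x vmeas spE v)%E.
have muT : mu setT = (rnorm (E setT u) ^+ 2 * rnorm (E setT v) ^+ 2)%:E.
  by rewrite -setXTT /mu product_measure1E.
have fin D : measurable D -> mu D \is a fin_num.
  move=> mD; rewrite ge0_fin_numE//; apply: (@le_lt_trans _ _ (mu setT)).
    by apply: le_measure; rewrite ?inE.
  by rewrite muT ltry.
exists (fun D => fine (mu D)); last first.
  by move=> A B mA mB; rewrite /mu product_measure1E//.
split.
- by move=> A mA; rewrite fine_ge0.
- move=> A B mA mB AB; rewrite -fineD ?fin//; congr fine.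
  by rewrite /mu measureU.
- move=> F mF dF F0 e e0.
  have dec : nonincreasing_seq F.
    by apply/nonincreasing_seqP => n; apply/subsetPset; exact: dF.
  have := @nonincreasing_cvg_mu _ _ R mu F _ mF.
  rewrite F0 measure0 => /(_ _ measurable0 dec) h.
  have /fine_cvgP[_ /cvgrPdist_le/(_ e e0)[N _ hN]] : mu \o F @ \oo --> 0%E.
    by apply: h; rewrite -ge0_fin_numE// fin.
  exists N; have := hN N (leqnn N); rewrite /= sub0r normrN ger0_norm// fine_ge0//.
Qed.

End ProductMeasure.

(** * Finite orthogonal families of projections *)

Section OrthogonalFamilies.
Context {R : realType} {V : hilbertType R} {J : finType}.
Variable G : J -> contr V V.
Hypothesis GG : forall p q x, G p (G q x) = if p == q then G q x else 0.

Lemma orth_family_norm (a : J -> R[i]) x :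
  rnorm (\sum_p a p *: G p x) ^+ 2 = \sum_p cabs (a p) ^+ 2 * rnorm (G p x) ^+ 2.
Proof.
have orth p q : p != q -> hdot (G p x) (G q x) = 0.
  move=> pq; apply: (@proj_ker_orthogonal _ _ (G p)).
  - exact: contrP.
  - by rewrite GG eqxx.
  - by rewrite GG (negPf pq).
apply: (@complexI R); rewrite -hdotxx hdot_suml rmorph_sum/=; apply: eq_bigr => p _.
rewrite hdot_sumr (bigD1 p)//= big1 ?addr0 => [|q qp]; last first.
  by rewrite hdotZl hdotZr orth 1?eq_sym// !mulr0.
by rewrite hdotZl hdotZr mulrA mulcC_cabs hdotxx -rmorphM.
Qed.

Hypothesis GT : forall x, \sum_p G p x = x.

(** The alternative [G p x = 0] covers indices with an empty fibre, where nothing is known about the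
    coefficient. *)
Lemma orth_family_le (a : J -> R[i]) (M : R) x : 0 <= M ->
  (forall p, G p x = 0 \/ cabs (a p) <= M) ->
  rnorm (\sum_p a p *: G p x) <= M * rnorm x.
Proof.
move=> M0 aM; rewrite -(@ler_pXn2r _ 2)// ?nnegrE ?mulr_ge0 ?rnorm_ge0//.
rewrite orth_family_norm exprMn -[in leRHS](GT x) -[in leRHS](eq_bigr _ (fun p _ => scale1r _)).
rewrite orth_family_norm mulr_sumr; apply: ler_sum => p _.
rewrite cabs1 expr1n mul1r; have [->|h] := aM p.
  by rewrite rnorm0 expr0n/= !mulr0.
by rewrite ler_wpM2r ?sqr_ge0// lerXn2r ?nnegrE ?cabs_ge0.
Qed.

End OrthogonalFamilies.

Definition sandwich_c {R : realType} {H K : hilbertType R} (P : contr H K) (Q : contr K H) :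
  contr (S2 H) (S2 K) := Contr (sandwich_contr P Q).

(** * Projections attached to unions of rectangles *)

Section ProductSpectralMeasure.
Context {R : realType} {K : hilbertType R} d {X : measurableType d}.
Variable E : set X -> {linear K -> K}.
Hypothesis spE : spectral E.

(* A finite measurable partition of [X], given by its classifying map, together
   with a union of rectangles of the induced partition of [X * X]. *)
Record grid := Grid {
  grid_index : finType;
  grid_map : X -> grid_index;
  grid_measurable : forall i, measurable (grid_map @^-1` [set i]);
  grid_rel : grid_index -> grid_index -> bool }.

Definition grid_set (g : grid) : set (X * X) :=
  [set p | grid_rel (@grid_map g p.1) (@grid_map g p.2)].

Lemma sum_pair (V : zmodType) (I J : finType) (F : I * J -> V) :
  \sum_p F p = \sum_i \sum_j F (i, j).
Proof. by rewrite pair_bigA/=; apply: eq_bigr => -[]. Qed.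

Section Grid.
Variable g : grid.
Let I := grid_index g.
Let c := @grid_map g.
Let S := @grid_rel g.

Definition fibre_proj (i : I) : contr K K := spectral_proj spE (c @^-1` [set i]).

Definition cell (p : I * I) : contr (S2 K) (S2 K) :=
  sandwich_c (fibre_proj p.1) (fibre_proj p.2).

Lemma fibre_projE i x : fibre_proj i x = E (c @^-1` [set i]) x.
Proof. by rewrite /fibre_proj spectral_projE//; exact: grid_measurable. Qed.

Lemma fibre_proj_mul i j x : fibre_proj i (fibre_proj j x) = if i == j then fibre_proj j x else 0.
Proof.
have mg := @grid_measurable g; rewrite !fibre_projE; case: eqP => [->|ij].
  exact: spectral_idem.
apply: spectral_disjoint => //; apply/seteqP; split => // p [/= ci cj].
by case: ij; rewrite -ci -cj.
Qed.

Lemma cellE p A x : val (cell p A) x = fibre_proj p.1 (val A (fibre_proj p.2 x)).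
Proof. by []. Qed.

Lemma cell_mul p q A : cell p (cell q A) = if p == q then cell q A else 0.
Proof.
apply: S2_eq => x; rewrite !cellE fibre_proj_mul.
case: p q => [i j] [i' j'] /=; rewrite xpair_eqE; case: eqP => [<-|_]; last by [].
rewrite /= fibre_proj_mul eq_sym; case: eqP => [->|_] //.
by rewrite S2_app0 linear0.
Qed.

Lemma fibre_proj_sum (Q : pred I) x : \sum_(i | Q i) fibre_proj i x = E [set p | Q (c p)] x.
Proof.
have [_ <-] := spectral_partition spE Q x (@grid_measurable g).
by apply: eq_bigr => i _; exact: fibre_projE.
Qed.

Lemma cell_rect_sum (Q1 Q2 : pred I) A x :
  \sum_(p : I * I) (Q1 p.1 && Q2 p.2)%:R *: val (cell p A) x =
  E [set p | Q1 (c p)] (val A (E [set p | Q2 (c p)] x)).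
Proof.
rewrite -!fibre_proj_sum sum_pair [RHS]big_mkcond/=; apply: eq_bigr => i _.
have -> : val A (\sum_(j | Q2 j) fibre_proj j x) = \sum_(j | Q2 j) val A (fibre_proj j x).
  exact: (linear_sum (S2_lin A)).
case: (Q1 i); last by rewrite big1// => j _; rewrite scale0r.
rewrite linear_sum [RHS]big_mkcond/=; apply: eq_bigr => j _.
by case: (Q2 j); rewrite ?scale1r ?scale0r.
Qed.

Lemma cell_sum A : \sum_p cell p A = A.
Proof.
apply: S2_eq => x; rewrite S2_suml.
have := cell_rect_sum predT predT A x.
have -> : [set p | predT (c p)] = setT by apply/seteqP; split.
rewrite !spectralT// => <-; apply: eq_bigr => p _; by rewrite scale1r.
Qed.

Lemma grid_op_linear : linear (fun A => \sum_(p : I * I) (S p.1 p.2)%:R *: cell p A).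
Proof.
move=> a A B; rewrite scaler_sumr -big_split; apply: eq_bigr => p _.
have -> : cell p (a *: A + B) = a *: cell p A + cell p B by exact: (linearP (cell p)).
by rewrite scalerDr !scalerA [_ * a]mulrC.
Qed.

Lemma grid_op_contr A : rnorm (mk_linear grid_op_linear A) <= rnorm A.
Proof.
rewrite mk_linearE -[leRHS]mul1r.
apply: (orth_family_le cell_mul cell_sum) => // p; right.
by case: (S _ _); rewrite ?cabs1 ?cabs0.
Qed.

Definition grid_op : contr (S2 K) (S2 K) := Contr grid_op_contr.

Lemma grid_opE A : grid_op A = \sum_(p : I * I) (S p.1 p.2)%:R *: cell p A.
Proof. by []. Qed.

Lemma grid_op_rect (Q1 Q2 : pred I) A x : (forall i j, S i j = Q1 i && Q2 j) ->
  val (grid_op A) x = E [set p | Q1 (c p)] (val A (E [set p | Q2 (c p)] x)).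
Proof.
move=> SQ; rewrite grid_opE S2_suml -cell_rect_sum; apply: eq_bigr => p _.
by rewrite S2Z SQ.
Qed.

Lemma grid_set_measure (m : set (X * X) -> R) (M : I -> I -> R) : fin_measure m ->
  (forall i j, m ((c @^-1` [set i]) `*` (c @^-1` [set j])) = M i j) ->
  measurable (grid_set g) /\ m (grid_set g) = \sum_(p : I * I | S p.1 p.2) M p.1 p.2.
Proof.
move=> fm mM; pose cc (q : X * X) := (c q.1, c q.2).
have mcc (p : I * I) : measurable (cc @^-1` [set p]).
  have -> : cc @^-1` [set p] = (c @^-1` [set p.1]) `*` (c @^-1` [set p.2]).
    by apply/seteqP; split => -[x y]; rewrite /cc/=; [move=> <-|case: p => i j /= [-> ->]].
  by apply: measurableX; exact: grid_measurable.
have := index_enum_uniq (I * I)%type.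
suff : forall r : seq (I * I), uniq r ->
  measurable [set q | (cc q \in r) && S (c q.1) (c q.2)] /\
  m [set q | (cc q \in r) && S (c q.1) (c q.2)] = \sum_(p <- r | S p.1 p.2) M p.1 p.2.
  move=> h /h; have -> // : [set q | (cc q \in index_enum (I * I)%type) && S (c q.1) (c q.2)] = grid_set g.
  by apply/seteqP; split => q /=; rewrite mem_index_enum.
elim=> [_|p r IH /= /andP[pr /IH[mr {}IH]]].
  rewrite big_nil (_ : [set q | _] = set0) ?(fmeas_set0 fm)//.
  by apply/seteqP; split.
rewrite big_cons; case: ifPn => Sp.
  have -> : [set q | (cc q \in p :: r) && S (c q.1) (c q.2)] =
      cc @^-1` [set p] `|` [set q | (cc q \in r) && S (c q.1) (c q.2)].
    apply/seteqP; split => q /=.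
      by rewrite inE => /andP[/orP[/eqP ->|cr] Qc]; [left|right; rewrite cr].
    move=> [cq|/andP[cr ->]]; last by rewrite inE cr orbT.
    by rewrite inE cq eqxx/= -[c q.1]/(cc q).1 -[c q.2]/(cc q).2 cq.
  split; first exact: measurableU.
  rewrite (fmeasU fm)// ?IH; last first.
    by apply/seteqP; split => // q [/= -> /andP[pr' _]]; rewrite pr' in pr.
  congr (_ + _); rewrite -mM; congr m.
  by apply/seteqP; split => -[x y]; rewrite /cc/=; [move=> <-|case: p {Sp pr} => i j /= [-> ->]].
have -> // : [set q | (cc q \in p :: r) && S (c q.1) (c q.2)] = [set q | (cc q \in r) && S (c q.1) (c q.2)].
apply/seteqP; split => q /=.
  rewrite inE => /andP[/orP[/eqP cpi Qc|-> -> //]].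
  by rewrite -cpi/= Qc in Sp.
by move=> /andP[cr ->]; rewrite inE cr orbT.
Qed.

End Grid.

Lemma grid_set_measurable g : measurable (grid_set g).
Proof.
by have [] := @grid_set_measure g _ (fun _ _ => 0) (@fin_measure0 R _ (X * X)%type) (fun _ _ => erefl).
Qed.

Definition grid_compl (g : grid) : grid :=
  Grid (@grid_measurable g) (fun i j => ~~ @grid_rel g i j).

Lemma grid_compl_set g : grid_set (grid_compl g) = ~` grid_set g.
Proof. by apply/seteqP; split => p /=; [move/negP|move=> /negP]. Qed.

Lemma grid_compl_op g A : grid_op (grid_compl g) A = A - grid_op g A.
Proof.
rewrite -{2}(cell_sum g A) !grid_opE -sumrB; apply: eq_bigr => p _ /=.
by case: (grid_rel _ _); rewrite /= ?scale0r ?scale1r ?subrr ?subr0.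
Qed.

Lemma grid_meet_measurable (g h : grid) (p : grid_index g * grid_index h) :
  measurable ((fun x => (@grid_map g x, @grid_map h x)) @^-1` [set p]).
Proof.
have -> : (fun x => (@grid_map g x, @grid_map h x)) @^-1` [set p] =
    (@grid_map g @^-1` [set p.1]) `&` (@grid_map h @^-1` [set p.2]).
  by apply/seteqP; split => x /=; [move=> <-|case: p => i j /= [-> ->]].
by apply: measurableI; exact: grid_measurable.
Qed.

Definition grid_meet (g h : grid) : grid :=
  Grid (@grid_meet_measurable g h)
    (fun p q => @grid_rel g p.1 q.1 && @grid_rel h p.2 q.2).

Lemma grid_meet_set g h : grid_set (grid_meet g h) = grid_set g `&` grid_set h.
Proof. by apply/seteqP; split => p /=; [move/andP|move=> /andP]. Qed.

Lemma grid_meet_fibre g h (p : grid_index g * grid_index h) x :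
  @fibre_proj (grid_meet g h) p x = @fibre_proj g p.1 (@fibre_proj h p.2 x).
Proof.
rewrite !fibre_projE spectralI//; [|exact: grid_measurable..].
congr (E _ x); apply/seteqP; split => y /=; first by move=> <-.
by case: p => i j /= [-> ->].
Qed.

Lemma fibre_proj_comm g h i j x :
  @fibre_proj g i (@fibre_proj h j x) = @fibre_proj h j (@fibre_proj g i x).
Proof.
rewrite !fibre_projE; have mi := @grid_measurable g i; have mj := @grid_measurable h j.
by rewrite (spectralI spE x mi mj) (spectralI spE x mj mi) setIC.
Qed.

(** Both sides are sums over four indices; [f] exchanges the middle two, and on the right of [A] the
    projections of the two grids have to be commuted. *)
Lemma grid_meet_op g h A : grid_op (grid_meet g h) A = grid_op g (grid_op h A).
Proof.
pose S := @grid_rel g; pose S' := @grid_rel h.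
rewrite (grid_opE (grid_meet g h) A) (grid_opE g (grid_op h A)).
have -> : \sum_p (S p.1 p.2)%:R *: cell p (grid_op h A) =
    \sum_pq (S pq.1.1 pq.1.2 && S' pq.2.1 pq.2.2)%:R *: cell pq.1 (cell pq.2 A).
  rewrite -(pair_bigA _ (fun p q => (S p.1 p.2 && S' q.1 q.2)%:R *: cell p (cell q A))).
  apply: eq_bigr => p _; rewrite (grid_opE h A).
  have -> : cell p (\sum_q (S' q.1 q.2)%:R *: cell q A) =
      \sum_q (S' q.1 q.2)%:R *: cell p (cell q A).
    have := linear_sum (cell p) (index_enum _) xpredT (fun q => (S' q.1 q.2)%:R *: cell q A).
    move=> ->; apply: eq_bigr => q _; exact: (linearZ_LR (cell p)).
  rewrite scaler_sumr; apply: eq_bigr => q _.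
  by rewrite scalerA -natrM mulnb.
pose Ig := grid_index g; pose Ih := grid_index h.
pose f (pq : (Ig * Ig) * (Ih * Ih)) := ((pq.1.1, pq.2.1), (pq.1.2, pq.2.2)).
pose f' (r : (Ig * Ih) * (Ig * Ih)) := ((r.1.1, r.2.1), (r.1.2, r.2.2)).
have fK : cancel f f' by case=> -[? ?] [? ?].
have f'K : cancel f' f by case=> -[? ?] [? ?].
rewrite (reindex f); last by exists f' => r _; [exact: fK|exact: f'K].
apply: eq_bigr => -[[i j] [i' j']] _; congr (_ *: _).
apply: S2_eq => x; rewrite !(cellE (g := g)) !(cellE (g := h)) (cellE (g := grid_meet g h)) !grid_meet_fibre.
by rewrite (fibre_proj_comm j j').
Qed.

Lemma grid_total_measurable : forall i : unit, measurable ((fun _ : X => tt) @^-1` [set i]).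
Proof. by case; rewrite (_ : _ @^-1` _ = setT)//; apply/seteqP; split. Qed.

Definition grid_total : grid := Grid grid_total_measurable (fun _ _ => true).

Lemma grid_total_op A : grid_op grid_total A = A.
Proof. by rewrite -[RHS](cell_sum grid_total) grid_opE; apply: eq_bigr => p _; rewrite scale1r. Qed.

Section Rectangle.
Variables A B : set X.
Hypotheses (mA : measurable A) (mB : measurable B).

Lemma grid_rect_meas (p : bool * bool) :
  measurable ((fun x => (x \in A, x \in B)) @^-1` [set p]).
Proof.
have mb (C : set X) (b : bool) : measurable C -> measurable [set x | (x \in C) = b].
  move=> mC; case: b.
    by rewrite (_ : [set x | _] = C)//; apply/seteqP; split => x /=; [move/set_mem|move/mem_set].
  rewrite (_ : [set x | _] = ~` C); first exact: measurableC.
  by apply/seteqP; split => x /=; [move=> h Cx; rewrite (mem_set Cx) in h|move=> nC; apply/negbTE; rewrite notin_setE].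
have -> : (fun x => (x \in A, x \in B)) @^-1` [set p] =
    [set x | (x \in A) = p.1] `&` [set x | (x \in B) = p.2].
  by apply/seteqP; split => x /=; [move=> <-|case: p => i j /= [-> ->]].
by apply: measurableI; exact: mb.
Qed.

(** A grid has one partition for both axes, so points are classified by membership in [A] and in [B]
    together. *)
Definition grid_rect : grid := Grid grid_rect_meas (fun p q => p.1 && q.2).

Lemma grid_rect_set : grid_set grid_rect = A `*` B.
Proof.
apply/seteqP; split => -[x y] /=; rewrite /grid_set/=; first by move=> /andP[/set_mem ? /set_mem ?].
by move=> [? ?]; rewrite !mem_set.
Qed.

Lemma grid_rect_op Y x : val (grid_op grid_rect Y) x = E A (val Y (E B x)).
Proof.
rewrite (@grid_op_rect grid_rect (fun p => p.1) (fun p => p.2)) //=.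
have eqs (C : set X) : [set p | p \in C] = C.
  by apply/seteqP; split => z /=; [move/set_mem|move/mem_set].
by rewrite !eqs.
Qed.

End Rectangle.

Lemma cell_rank_one_S2 g (p : grid_index g * grid_index g) u v :
  cell p (rank_one_S2 u v) = rank_one_S2 (fibre_proj p.1 u) (fibre_proj p.2 v).
Proof.
apply: S2_eq => x; rewrite cellE !rank_one_S2E linearZ_LR; congr (_ *: _).
by rewrite !fibre_projE spectral_selfadjoint//; exact: grid_measurable.
Qed.

(** Each cell maps a rank-one operator to a rank-one operator, whose squared norm is the product
    measure of the cell; orthogonality of the cells adds these up. *)
Lemma grid_op_rank_one_S2 g u v (m : set (X * X) -> R) : fin_measure m ->
  (forall A B, measurable A -> measurable B ->
    m (A `*` B) = rnorm (E A u) ^+ 2 * rnorm (E B v) ^+ 2) ->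
  rnorm (grid_op g (rank_one_S2 u v)) ^+ 2 = m (grid_set g).
Proof.
move=> fm mE; rewrite grid_opE (orth_family_norm (@cell_mul g)).
have [_ ->] := grid_set_measure fm (fun i j => mE _ _ (@grid_measurable g i) (@grid_measurable g j)).
rewrite [RHS]big_mkcond; apply: eq_bigr => p _; rewrite cell_rank_one_S2 rnorm_rank_one_S2 exprMn !fibre_projE.
by case: (grid_rel _ _); rewrite ?cabs1 ?cabs0 ?expr1n ?mul1r// expr0n mul0r.
Qed.

Lemma sqr_rnorm_add2 (V : hilbertType R) (x y : V) :
  rnorm (x + y) ^+ 2 <= 2 * rnorm x ^+ 2 + 2 * rnorm y ^+ 2.
Proof.
apply: (@le_trans _ _ ((rnorm x + rnorm y) ^+ 2)).
  by rewrite lerXn2r ?nnegrE ?addr_ge0 ?rnorm_ge0// rnormD.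
have := sqr_ge0 (rnorm x - rnorm y).
by move: (rnorm x) (rnorm y) => a b; nra.
Qed.

Lemma grid_op_finite_rank (r : seq K) (f : K -> K) : exists2 m, fin_measure m &
  forall g, rnorm (grid_op g (\sum_(a <- r) rank_one_S2 (f a) a)) ^+ 2 <= m (grid_set g).
Proof.
elim: r => [|a r [m fm mh]].
  exists (fun=> 0) => [|g]; first exact: fin_measure0.
  by rewrite big_nil linear0 rnorm0 expr0n.
have [m1 fm1 m1E] := product_fin_measure spE (f a) a.
exists (fun D => 2 * m1 D + 2 * m D).
  by apply: fin_measureD; apply: fin_measureZ.
move=> g; rewrite big_cons linearD (le_trans (sqr_rnorm_add2 _ _))//.
by rewrite lerD// ler_wpM2l// (grid_op_rank_one_S2 g fm1 m1E).
Qed.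

(** The truncation to finitely many basis vectors leaves an operator that vanishes on them and
    equals [f] on the rest of the basis, so its squared norm is a tail of that of [f]. *)
Lemma S2_tail (f : S2 K) (e : R) : 0 < e -> exists F : seq K,
  rnorm (f - \sum_(a <- F) rank_one_S2 (val f a) a) ^+ 2 <= e.
Proof.
move=> e0; have [_ /(_ e e0)[F bF hF]] := hs_qform_sup f.
exists F; rewrite S2_rnorm (sqr_snorm hs_dot_psd); apply: hs_qform_le => G bG.
have fF b : onb K b -> val (f - \sum_(a <- F) rank_one_S2 (val f a) a) b = if b \in F then 0 else val f b.
  move=> ob; rewrite S2B S2_suml; have [oF _] := onbP K.
  have [bF'|bF'] := boolP (b \in F).
    rewrite (bigD1_seq b)// ?fset_uniq// big1_seq; last first.
      by move=> c /andP[cb cF]; rewrite rank_one_S2E (oF _ _ ob (bF _ cF)) eq_sym (negPf cb) scale0r.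
    transitivity (val f b - (val (rank_one_S2 (val f b) b) b + 0)); first by [].
    by rewrite addr0 rank_one_S2E (oF _ _ ob ob) eqxx scale1r subrr.
  rewrite big1_seq ?subr0// => c /andP[_ cF]; rewrite rank_one_S2E (oF _ _ ob (bF _ cF)).
  by case: eqP => [bc|_]; [rewrite bc cF in bF'|rewrite scale0r].
set f' := f - _ in fF *; have bFG := basis_fsetU bF bG.
have := hs_qform_ub f bFG; have := hs_sum_sub f' (fsubsetUr F G).
suff : hs_sum f (F `|` G)%fset = hs_sum f F + hs_sum f' (F `|` G)%fset.
  by move: hF; rewrite /hs_sum; lra.
rewrite /hs_sum (big_fsetID _ (mem F) (F `|` G)%fset) [X in _ + X](big_fsetID _ (mem F)).
have -> : [fset x in (F `|` G)%fset | x \in mem F]%fset = F.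
  by apply/fsetP => x; rewrite !inE; case: (x \in F); rewrite ?andbF ?andbT ?orbT.
rewrite [X in _ = _ + (X + _)]big1_seq ?add0r; last first.
  move=> b /andP[_ bF']; have := fF b (bF b bF'); case: ifPn => [_ ->|/negP//].
  by rewrite rnorm0 expr0n.
congr (_ + _); apply: eq_big_seq => b; rewrite !inE => /andP[/orP h bnF].
by rewrite fF ?(negPf bnF)//; case: h => [/bF|/bG].
Qed.

Lemma grid_op_dominated (f : S2 K) (e : R) : 0 < e -> exists2 m, fin_measure m &
  forall g, rnorm (grid_op g f) ^+ 2 <= m (grid_set g) + e.
Proof.
move=> e0; have e2 : 0 < e / 2 by rewrite divr_gt0.
have [F hF] := S2_tail f e2; set f' := f - _ in hF.
have [m fm mh] := grid_op_finite_rank F (val f).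
exists (fun D => 2 * m D); first exact: fin_measureZ.
move=> g; rewrite -[f](subrK (\sum_(a <- F) rank_one_S2 (val f a) a)) -/f' linearD.
rewrite (le_trans (sqr_rnorm_add2 _ _))// addrC.
apply: lerD; first by rewrite ler_wpM2l.
have -> : e = 2 * (e / 2) by rewrite mulrC divfK.
rewrite ler_wpM2l// (le_trans _ hF)// lerXn2r ?nnegrE ?rnorm_ge0//; exact: contrP.
Qed.

Lemma rectangles_generate (D : set (X * X)) : measurable D ->
  <<s [set A `*` B | A in measurable & B in measurable] >> D.
Proof. by rewrite measurable_prod_measurableType. Qed.

(* [grid] lives in too large a universe to index a family of sets. *)
Definition small_grid := {p : set (X * X) * contr (S2 K) (S2 K) |
  exists g, p = (grid_set g, grid_op g)}.

Definition small_grid_of g : small_grid := exist _ _ (ex_intro _ g erefl).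

Theorem product_spectral : exists G : set (X * X) -> {linear S2 K -> S2 K},
  spectral G /\ forall A B, measurable A -> measurable B -> forall (Y : S2 K) x,
    val (G (A `*` B) Y) x = E A (val Y (E B x)).
Proof.
pose s (i : small_grid) := (sval i).1; pose P (i : small_grid) := (sval i).2.
have sP (i : small_grid) : exists2 g, s i = grid_set g & P i = grid_op g.
  by rewrite /s /P; case: (svalP i) => g ->; exists g.
have ms i : measurable (s i) by have [g -> _] := sP i; exact: grid_set_measurable.
have hC i : exists2 j, s j = ~` s i & forall x, P j x = x - P i x.
  have [g -> ->] := sP i; exists (small_grid_of (grid_compl g)).
    exact: grid_compl_set.
  exact: grid_compl_op.
have hI i i' : exists2 j, s j = s i `&` s i' & forall x, P j x = P i (P i' x).
  have [g -> ->] := sP i; have [h -> ->] := sP i'; exists (small_grid_of (grid_meet g h)).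
    exact: grid_meet_set.
  exact: grid_meet_op.
have hT : exists2 i, s i = setT & forall x, P i x = x.
  by exists (small_grid_of grid_total); [apply/seteqP; split|exact: grid_total_op].
have hdom (f : S2 K) (e : R) : 0 < e -> exists2 m, fin_measure m &
    forall i, rnorm (P i f) ^+ 2 <= m (s i) + e.
  move=> e0; have [m fm mh] := grid_op_dominated f e0; exists m => // i.
  by have [g -> ->] := sP i.
have hgen (D : set (X * X)) : measurable D -> <<s range s >> D.
  move=> /rectangles_generate; apply: sub_sigma_algebra2 => _ [A mA [B mB <-]].
  by exists (small_grid_of (grid_rect mA mB)) => //; exact: grid_rect_set.
have [spG GP] := spectral_extension ms hC hI hT hdom hgen.
eexists; split; first exact: spG.
move=> A B mA mB Y x; rewrite -(grid_rect_set mA mB) (GP (small_grid_of (grid_rect mA mB))).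
exact: grid_rect_op.
Qed.

End ProductSpectralMeasure.

(** * Integrals and compressions *)

Section SpectralCalculus.
Context {R : realType} {V : hilbertType R} d {Om : measurableType d}.
Variable G : set Om -> {linear V -> V}.
Hypothesis spG : spectral G.

Section Partition.
Context {J : finType}.
Variable k : Om -> J.
Hypothesis mk : forall j, measurable (k @^-1` [set j]).

Definition simple_integral (c : J -> R[i]) h : V := \sum_j c j *: G (k @^-1` [set j]) h.

Let Gj (j : J) : contr V V := spectral_proj spG (k @^-1` [set j]).

Let GjE j h : Gj j h = G (k @^-1` [set j]) h.
Proof. exact: spectral_projE. Qed.

Let GG p q x : Gj p (Gj q x) = if p == q then Gj q x else 0.
Proof.
rewrite !GjE; case: eqP => [->|pq]; first exact: spectral_idem.
apply: spectral_disjoint => //; apply/seteqP; split => // y [/= kp kq].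
by case: pq; rewrite -kp -kq.
Qed.

Let GT x : \sum_j Gj j x = x.
Proof.
have [_ h] := spectral_partition spG predT x mk.
rewrite -[RHS](spectralT spG) (_ : setT = [set p | predT (k p)]); last by apply/seteqP; split.
by rewrite -h; apply: eq_bigr => j _; rewrite GjE.
Qed.

Lemma simple_integral_le c M h : 0 <= M -> (forall x, cabs (c (k x)) <= M) ->
  rnorm (simple_integral c h) <= M * rnorm h.
Proof.
move=> M0 cM; rewrite /simple_integral (eq_bigr (fun j => c j *: Gj j h)); last by move=> j _; rewrite GjE.
apply: (orth_family_le GG GT) => // j.
have [[x kx]|nx] := pselect (exists x, k x = j); first by right; rewrite -kx.
left; rewrite GjE (_ : k @^-1` [set j] = set0) ?(spectral0 spG)//.
by apply/seteqP; split => // x kx; case: nx; exists x.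
Qed.

End Partition.

(* The same as [spectral_integral]; classifying the points by a map [k] makes a
   common refinement of two partitions a pair of maps. *)
Definition has_integral (f : Om -> R[i]) (B : V -> V) :=
  forall e : R, 0 < e -> exists (J : finType) (k : Om -> J) (c : J -> R[i]),
    [/\ forall j, measurable (k @^-1` [set j]),
        forall x, cabs (f x - c (k x)) <= e &
        forall h, rnorm (B h - simple_integral k c h) <= e * rnorm h].

Lemma spectral_integralP f B : spectral_integral G f B -> has_integral f B.
Proof.
move=> fB e e0; have eC : 0 < e%:C by rewrite ltr0C.
have [n [c [D [mD tD DT fc Bc]]]] := fB _ eC.
have cov x : exists i, D i x by have : setT x by []; rewrite -DT => -[i _ Dix]; exists i.
pose k x := sval (cid (cov x)).
have kE i : k @^-1` [set i] = D i.
  apply/seteqP; split => x /=; first by rewrite /k; case: cid => j /= Dj <-.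
  move=> Dix; rewrite /k; case: cid => j /= Djx.
  by apply: (tD j i) => //; exists x.
exists 'I_n, k, c; split=> [j|x|h]; first by rewrite kE.
  rewrite -lecR -normcE; apply: fc; rewrite /k; by case: cid.
rewrite -lecR rmorphM/= -!rnormE /simple_integral.
by under eq_bigr do rewrite kE; exact: Bc.
Qed.

Lemma has_integralP f B : has_integral f B -> spectral_integral G f B.
Proof.
move=> fB eps /complex_gt0P[e e0 ->]; have [J [k [c [mk fc Bc]]]] := fB e e0.
exists #|J|, (fun i => c (enum_val i)), (fun i => k @^-1` [set enum_val i]); split.
- by move=> i; exact: mk.
- move=> i j _ _ [x /= [ki kj]]; apply: enum_val_inj; by rewrite -ki -kj.
- by apply/seteqP; split => // x _; exists (enum_rank (k x)) => //=; rewrite enum_rankK.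
- by move=> i x /= <-; rewrite normcE lecR.
move=> h; rewrite !rnormE -rmorphM/= lecR.
rewrite -(big_enum_val (fun j => c j *: G (k @^-1` [set j]) h)); exact: Bc.
Qed.

Section Join.
Context {J1 J2 : finType} (k1 : Om -> J1) (k2 : Om -> J2).
Hypotheses (mk1 : forall j, measurable (k1 @^-1` [set j]))
  (mk2 : forall j, measurable (k2 @^-1` [set j])).

Definition join_map x := (k1 x, k2 x).

Lemma join_fibre p : join_map @^-1` [set p] = (k1 @^-1` [set p.1]) `&` (k2 @^-1` [set p.2]).
Proof.
apply/seteqP; split => x /=; first by move=> <-.
by case: p => i j /= [<- <-].
Qed.

Lemma join_measurable p : measurable (join_map @^-1` [set p]).
Proof. by rewrite join_fibre; exact: measurableI. Qed.

Lemma join_mul c1 c2 h : simple_integral join_map (fun p => c1 p.1 * c2 p.2) h =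
  simple_integral k1 c1 (simple_integral k2 c2 h).
Proof.
rewrite /simple_integral sum_pair; apply: eq_bigr => i _; rewrite linear_sum scaler_sumr.
apply: eq_bigr => j _; rewrite linearZ_LR scalerA.
by rewrite (spectralI spG _ (mk1 i) (mk2 j)) join_fibre.
Qed.

End Join.

Lemma simple_integral1 (J : finType) (k : Om -> J) h :
  (forall j, measurable (k @^-1` [set j])) -> simple_integral k (fun=> 1) h = h.
Proof.
move=> mk; have [_ hk] := spectral_partition spG predT h mk.
rewrite -[RHS](spectralT spG) (_ : setT = [set p | predT (k p)]); last by apply/seteqP; split.
by rewrite -hk; apply: eq_bigr => j _; rewrite scale1r.
Qed.

Lemma simple_integralP (J : finType) (k : Om -> J) a c1 c2 h :
  simple_integral k (fun j => a * c1 j + c2 j) h =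
  a *: simple_integral k c1 h + simple_integral k c2 h.
Proof.
by rewrite /simple_integral scaler_sumr -big_split; apply: eq_bigr => j _; rewrite scalerDl scalerA.
Qed.

(** Passing to the join of the two partitions leaves each simple integral unchanged, and there they
    multiply, since the projections of two fibres compose to that of the intersection. *)
Lemma common_partition f1 B1 f2 B2 (e : R) : has_integral f1 B1 -> has_integral f2 B2 -> 0 < e ->
  exists (J : finType) (k : Om -> J) (c1 c2 : J -> R[i]),
  [/\ forall j, measurable (k @^-1` [set j]),
      (forall x, cabs (f1 x - c1 (k x)) <= e) /\
      (forall h, rnorm (B1 h - simple_integral k c1 h) <= e * rnorm h),
      (forall x, cabs (f2 x - c2 (k x)) <= e) /\
      (forall h, rnorm (B2 h - simple_integral k c2 h) <= e * rnorm h) &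
      forall h, simple_integral k (fun j => c1 j * c2 j) h =
        simple_integral k c1 (simple_integral k c2 h)].
Proof.
move=> fB1 fB2 e0; have [J1 [k1 [c1 [mk1 fc1 Bc1]]]] := fB1 e e0.
have [J2 [k2 [c2 [mk2 fc2 Bc2]]]] := fB2 e e0.
have E1 h : simple_integral (join_map k1 k2) (fun p => c1 p.1) h = simple_integral k1 c1 h.
  rewrite -[in RHS](simple_integral1 h mk2) -join_mul//.
  by apply: eq_bigr => p _; rewrite mulr1.
have E2 h : simple_integral (join_map k1 k2) (fun p => c2 p.2) h = simple_integral k2 c2 h.
  rewrite -[RHS](simple_integral1 _ mk1) -join_mul//.
  by apply: eq_bigr => p _; rewrite mul1r.
exists (J1 * J2)%type, (join_map k1 k2), (fun p => c1 p.1), (fun p => c2 p.2); split.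
- exact: join_measurable.
- by split=> [x|h]; [exact: fc1|rewrite E1].
- by split=> [x|h]; [exact: fc2|rewrite E2].
by move=> h; rewrite E1 E2 join_mul.
Qed.

Lemma has_integral_const a : has_integral (fun=> a) ( *:%R a).
Proof.
move=> e e0; exists unit, (fun=> tt), (fun=> a).
have mk j : measurable ((fun _ : Om => tt) @^-1` [set j]).
  by case: j; rewrite (_ : _ @^-1` _ = setT)//; apply/seteqP; split.
split=> // [x|h]; first by rewrite subrr cabs0 ltW.
rewrite (_ : simple_integral _ _ _ = a *: h).
  by rewrite subrr rnorm0 mulr_ge0 ?rnorm_ge0// ltW.
rewrite -[in RHS](simple_integral1 h mk) /simple_integral scaler_sumr.
by apply: eq_bigr => j _; rewrite scale1r.
Qed.

Lemma has_integralD a f1 B1 f2 B2 : has_integral f1 B1 -> has_integral f2 B2 ->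
  has_integral (fun x => a * f1 x + f2 x) (fun h => a *: B1 h + B2 h).
Proof.
move=> fB1 fB2 e e0; have a1 : 0 < cabs a + 1 by rewrite ltr_wpDl ?cabs_ge0.
have e1 := divr_gt0 e0 a1.
have [J [k [c1 [c2 [mk [fc1 Bc1] [fc2 Bc2] _]]]]] := common_partition fB1 fB2 e1.
have eE : e = cabs a * (e / (cabs a + 1)) + e / (cabs a + 1).
  by rewrite -[X in _ + X]mul1r -mulrDl mulrC divfK// gt_eqF.
exists J, k, (fun j => a * c1 j + c2 j); split=> // [x|h].
  have -> : a * f1 x + f2 x - (a * c1 (k x) + c2 (k x)) =
    a * (f1 x - c1 (k x)) + (f2 x - c2 (k x)) by ring.
  by rewrite eE (le_trans (cabsD _ _))// cabsM lerD ?ler_wpM2l ?cabs_ge0.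
rewrite simple_integralP opprD addrACA -scalerBr eE mulrDl (le_trans (rnormD _ _))//.
by rewrite rnormZ lerD// -mulrA ler_wpM2l ?cabs_ge0.
Qed.

Lemma has_integral_sum (I : Type) (r : seq I) (a : I -> R[i]) f B :
  (forall i, has_integral (f i) (B i)) ->
  has_integral (fun x => \sum_(i <- r) a i * f i x) (fun h => \sum_(i <- r) a i *: B i h).
Proof.
move=> fB; elim: r => [|i r IH].
  have := has_integral_const 0; congr has_integral; apply/funext => x.
    by rewrite big_nil.
  by rewrite big_nil scale0r.
have := has_integralD (a i) (fB i) IH; congr has_integral; apply/funext => x; by rewrite big_cons.
Qed.

Lemma has_integralM f1 (B1 : {linear V -> V}) f2 B2 :
  (forall x, cabs (f1 x) <= 1) -> (forall x, cabs (f2 x) <= 1) ->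
  (forall h, rnorm (B1 h) <= rnorm h) ->
  has_integral f1 B1 -> has_integral f2 B2 ->
  has_integral (fun x => f1 x * f2 x) (fun h => B1 (B2 h)).
Proof.
move=> f1b f2b B1b fB1 fB2 e e0.
(* [e' <= 1] bounds [c2] by 2, so the error of the product is at most [e' + 2 e']. *)
pose e' := Num.min 1 (e / 3); have e'0 : 0 < e' by rewrite lt_min ltr01 divr_gt0.
have e'1 : e' <= 1 by rewrite ge_min lexx.
have e'3 : 3 * e' <= e by rewrite mulrC -ler_pdivlMr// ge_min lexx orbT.
have [J [k [c1 [c2 [mk [fc1 Bc1] [fc2 Bc2] cc]]]]] := common_partition fB1 fB2 e'0.
have c2b x : cabs (c2 (k x)) <= 2.
  have -> : c2 (k x) = f2 x - (f2 x - c2 (k x)) by ring.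
  by rewrite (le_trans (cabsB _ _))// (le_trans (lerD (f2b x) (fc2 x))) ; lra.
exists J, k, (fun j => c1 j * c2 j); split=> // [x|h].
  have -> : f1 x * f2 x - c1 (k x) * c2 (k x) =
    f1 x * (f2 x - c2 (k x)) + (f1 x - c1 (k x)) * c2 (k x) by ring.
  rewrite (le_trans (cabsD _ _))// !cabsM (le_trans _ e'3)//.
  have -> : 3 * e' = 1 * e' + e' * 2 by ring.
  by rewrite lerD// ler_pM ?cabs_ge0.
rewrite cc -(subrKA (B1 (simple_integral k c2 h))) -linearB (le_trans (rnormD _ _))//.
apply: (@le_trans _ _ (3 * e' * rnorm h)); last by rewrite ler_wpM2r ?rnorm_ge0.
have -> : 3 * e' * rnorm h = e' * rnorm h + e' * (2 * rnorm h) by ring.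
rewrite lerD ?(le_trans (B1b _))// (le_trans (Bc1 _))// ler_wpM2l ?(ltW e'0)//.
exact: (simple_integral_le mk).
Qed.

Lemma has_integral_iter f (B : contr V V) n : (forall x, cabs (f x) <= 1) ->
  has_integral f B -> has_integral (fun x => f x ^+ n) (contr_iter B n).
Proof.
move=> fb fB; elim: n => [|n IH].
  have := has_integral_const 1; congr has_integral; apply/funext => h /=.
  by rewrite scale1r.
have fn1 x : cabs (f x ^+ n) <= 1 by rewrite cabsX exprn_ile1 ?cabs_ge0.
have := has_integralM fb fn1 (contrP B) fB IH; congr has_integral.
by apply/funext => x; rewrite exprS.
Qed.

Lemma has_integral_lim f (r : nat -> R) (fn : nat -> Om -> R[i]) (Bn : nat -> V -> V) B :
  rate r -> (forall n, has_integral (fn n) (Bn n)) ->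
  (forall n x, cabs (fn n x - f x) <= r n) ->
  (forall n h, rnorm (Bn n h - B h) <= r n * rnorm h) -> has_integral f B.
Proof.
move=> rr fB ff BB e e0; have e2 : 0 < e / 2 by rewrite divr_gt0.
have [n /(_ n (leqnn n)) hn] := rr _ e2.
have [J [k [c [mk fc Bc]]]] := fB n _ e2; exists J, k, c; split=> // [x|h].
  have -> : f x - c (k x) = (fn n x - c (k x)) - (fn n x - f x) by ring.
  rewrite (splitr e) (le_trans (cabsB _ _))// lerD//.
  exact: le_trans (ff n x) hn.
rewrite (le_trans (rnorm_dist_triangle _ _ (Bn n h)))// rnorm_distC.
rewrite (splitr e) mulrDl lerD// (le_trans (BB n h))// ler_wpM2r ?rnorm_ge0//.
Qed.

End SpectralCalculus.

(** * Integrals of divided differences against the product measure *)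

Section TorusCalculus.
Context {R : realType} {K : hilbertType R} d {X : measurableType d}.
Variables (E : set X -> {linear K -> K}) (G : set (X * X) -> {linear S2 K -> S2 K}).
Hypotheses (spE : spectral E) (spG : spectral G).
Hypothesis GX : forall A B, measurable A -> measurable B -> forall (Y : S2 K) x,
  val (G (A `*` B) Y) x = E A (val Y (E B x)).
Variables (f : X -> R[i]) (U : contr K K).
Hypotheses (f1 : forall x, cabs (f x) <= 1) (fU : has_integral E f U).

Let I := contr_id K.

Lemma scaled_contr_subproof (W : {linear K -> K}) (e : R) : 0 < e ->
  (forall x, rnorm (W x) <= e * rnorm x) ->
  forall x, rnorm ((e^-1%:C \*: W : {linear K -> K}) x) <= rnorm x.
Proof.
move=> e0 We x; rewrite rnormZ cabsR ger0_norm ?invr_ge0 ?(ltW e0)//.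
by rewrite mulrC ler_pdivrMr// mulrC.
Qed.

(** After division by [e] the operator [W] is a contraction, and [sandwich_contr] applies with it on
    either side. *)
Lemma sandwich_le (W : {linear K -> K}) (P Q : contr K K) (e : R) (Y B : S2 K) : 0 < e ->
  (forall x, rnorm (W x) <= e * rnorm x) ->
  (forall x, val B x = W (val Y (Q x))) \/ (forall x, val B x = P (val Y (W x))) ->
  rnorm B <= e * rnorm Y.
Proof.
move=> e0 We BE; pose C := Contr (scaled_contr_subproof e0 We).
have CW x : W x = e%:C *: C x.
  by rewrite /C /= scalerA -rmorphM/= divff ?scale1r// gt_eqF.
have nZ (D : S2 K) : rnorm D <= rnorm Y -> B = e%:C *: D -> rnorm B <= e * rnorm Y.
  by move=> DY ->; rewrite rnormZ cabsR (ger0_norm (ltW e0)) ler_wpM2l// (ltW e0).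
case: BE => BE.
  apply: (nZ (sandwich C Q Y)); first exact: sandwich_contr.
  by apply: S2_eq => x; rewrite BE S2Z sandwichE CW.
apply: (nZ (sandwich P C Y)); first exact: sandwich_contr.
by apply: S2_eq => x; rewrite BE S2Z sandwichE CW S2_appZ linearZ_LR.
Qed.

Lemma simple_integral_linear (J : finType) (k : X -> J) c : linear (simple_integral E k c).
Proof.
move=> a x y; rewrite /simple_integral scaler_sumr -big_split; apply: eq_bigr => j _.
by rewrite linearP scalerDr !scalerA mulrC.
Qed.

Lemma preimage_fst (J : Type) (k : X -> J) j :
  (fun p : X * X => k p.1) @^-1` [set j] = (k @^-1` [set j]) `*` setT.
Proof. by apply/seteqP; split => -[x y] /=; [move=> ?; split|case]. Qed.

Lemma preimage_snd (J : Type) (k : X -> J) j :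
  (fun p : X * X => k p.2) @^-1` [set j] = setT `*` (k @^-1` [set j]).
Proof. by apply/seteqP; split => -[x y] /=; [move=> ?; split|case]. Qed.

Lemma has_integral_fst : has_integral G (fun p => f p.1) (sandwich_c U I).
Proof.
move=> e e0; have [J [k [c [mk fc Uc]]]] := fU e0.
exists J, (fun p => k p.1), c; split=> [j|p|Y].
- by rewrite preimage_fst; exact: measurableX.
- exact: fc.
pose W := mk_linear (simple_integral_linear k c).
apply: (@sandwich_le (U \- W) I I) => //; left=> x.
rewrite S2B S2_suml; congr (_ - _); apply: eq_bigr => j _.
by rewrite S2Z preimage_fst GX// spectralT.
Qed.

Lemma has_integral_snd : has_integral G (fun p => f p.2) (sandwich_c I U).
Proof.
move=> e e0; have [J [k [c [mk fc Uc]]]] := fU e0.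
exists J, (fun p => k p.2), c; split=> [j|p|Y].
- by rewrite preimage_snd; exact: measurableX.
- exact: fc.
pose W := mk_linear (simple_integral_linear k c).
apply: (@sandwich_le (U \- W) I I) => //; right=> x.
transitivity (val Y (U x) - val Y (simple_integral E k c x)); last by rewrite -S2_appB.
rewrite S2B S2_suml; congr (_ - _).
have -> : val Y (simple_integral E k c x) = \sum_j val Y (c j *: E (k @^-1` [set j]) x).
  exact: (linear_sum (S2_lin Y)).
by apply: eq_bigr => j _; rewrite S2Z preimage_snd GX// spectralT// S2_appZ.
Qed.

Lemma iter_sandwich (P Q : contr K K) n (Y : S2 K) x :
  val (contr_iter (sandwich_c P Q) n Y) x = iter n P (val Y (iter n Q x)).
Proof.
rewrite contr_iterE; elim: n x => [//|n IH] x.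
by rewrite iterS (sandwichE P Q) IH -iterS -iterSr.
Qed.

Lemma iter_id n (x : K) : iter n I x = x.
Proof. by elim: n => //= n ->. Qed.

Lemma has_integral_ddp p : has_integral G (fun q => ddp p (f q.1) (f q.2)) (ddop p U U).
Proof.
rewrite /ddp /ddop /dd_sum.
have mono j k : has_integral G (fun q => f q.1 ^+ j * f q.2 ^+ k)
    (fun Y => sandwich (contr_iter U j) (contr_iter U k) Y).
  have h1 := has_integral_iter spG j (fun q => f1 q.1) has_integral_fst.
  have h2 := has_integral_iter spG k (fun q => f1 q.2) has_integral_snd.
  have b n z : cabs (f z ^+ n) <= 1 by rewrite cabsX exprn_ile1 ?cabs_ge0.
  have := has_integralM spG (fun q => b j q.1) (fun q => b k q.2) (contrP _) h1 h2.
  congr has_integral; apply/funext => Y; apply: S2_eq => x.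
  by rewrite !iter_sandwich !iter_id sandwichE !contr_iterE.
have := has_integral_sum spG (index_enum 'I_(size p)) (fun=> 1) (fun j : 'I_(size p) =>
  has_integral_sum spG (index_enum 'I_(size p)) (fun k => p`_(j + k).+1) (fun k => mono j k)).
congr has_integral; apply/funext => q; apply: eq_bigr => j _; by rewrite ?mul1r ?scale1r.
Qed.

Variables (phi : R[i] -> R[i]) (P : nat -> {poly R[i]}).
Let e n : R := n.+1%:R^-1.
Hypothesis Pphi : forall n z, cabs z <= 1 -> cabs ((P n).[z] - disk_ext phi z) <= 4 * e n.
Hypothesis dPphi : forall n z, cabs z <= 1 ->
  cabs ((P n)^`().[z] - disk_ext (derive1 phi) z) <= e n.

Definition ddext (z w : R[i]) : R[i] :=
  if z == w then disk_ext (derive1 phi) z else (disk_ext phi z - disk_ext phi w) / (z - w).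

(** Dividing the error of [P n] by [z - w] would not be uniform near the diagonal. Instead
    [ddp (P n)] is compared with [ddp (P m)] through the derivatives, uniformly, and only [m] is
    chosen depending on [z] and [w]. *)
Lemma ddp_ddext n z w : cabs z <= 1 -> cabs w <= 1 ->
  cabs (ddp (P n) z w - ddext z w) <= 2 * e n.
Proof.
move=> z1 w1; rewrite /ddext; case: eqVneq => [<-|zw].
  by rewrite ddp_diag (le_trans (dPphi n z1))// ler_peMl ?ler1n// invr_ge0.
have zw0 : z - w != 0 by rewrite subr_eq0.
have cz : 0 < cabs (z - w) by rewrite lt_def cabs_ge0 andbT cabs_eq0.
apply/ler_addgt0Pr => t t0.
have [m _ mt] : exists2 m, True & 8 * e m / cabs (z - w) + e m <= t.
  have h : 0 <= 8 / cabs (z - w) + 1 by rewrite addr_ge0// divr_ge0// cabs_ge0.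
  have [N /(_ N (leqnn N)) hN] := rateZ h (@rate_inv R) t0; exists N => //.
  have aux (a b c : R) : a * b / c + b = (a / c + 1) * b by ring.
  by rewrite aux.
have h1 : cabs (ddp (P n) z w - ddp (P m) z w) <= e n + e m.
  rewrite /ddp -dd_sumB; apply: ddp_le => // y y1; rewrite derivB hornerD hornerN.
  have -> : (P n)^`().[y] - (P m)^`().[y] = ((P n)^`().[y] - disk_ext (derive1 phi) y)
    - ((P m)^`().[y] - disk_ext (derive1 phi) y) by ring.
  by rewrite (le_trans (cabsB _ _))// lerD ?dPphi.
have h2 : cabs (ddp (P m) z w - (disk_ext phi z - disk_ext phi w) / (z - w)) <=
    8 * e m / cabs (z - w).
  have -> : ddp (P m) z w - (disk_ext phi z - disk_ext phi w) / (z - w) =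
      (((P m).[z] - disk_ext phi z) - ((P m).[w] - disk_ext phi w)) / (z - w).
    have := ddp_mul (P m) z w; move: (ddp _ _ _) (_.[z]) (_.[w]) (disk_ext phi z) (disk_ext phi w) => y a b c d' yE.
    have -> : y = (a - b) / (z - w) by rewrite -yE mulrC mulKf.
    by rewrite -mulrBl !opprD !opprK addrACA.
  rewrite cabsM cabsV ler_pdivlMr// divfK ?gt_eqF// (le_trans (cabsB _ _))//.
  by rewrite (le_trans (lerD (Pphi m z1) (Pphi m w1)))//; lra.
set D := _ / (z - w) in h2 *.
have -> : ddp (P n) z w - D = (ddp (P n) z w - ddp (P m) z w) + (ddp (P m) z w - D) by ring.
rewrite (le_trans (cabsD _ _))// (le_trans (lerD h1 h2))//.
have := mt; have : 0 <= e n by rewrite invr_ge0.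
by move: (e n) (8 * e m / _) => a b; lra.
Qed.

Lemma has_integral_ddext : exists B : S2 K -> S2 K,
  has_integral G (fun q => ddext (f q.1) (f q.2)) B /\
  forall n Y, rnorm (ddop (P n) U U Y - B Y) <= 2 * e n * rnorm Y.
Proof.
pose B Y := sval (cid (ddop_limit dPphi U U Y)).
have hB n Y : rnorm (ddop (P n) U U Y - B Y) <= 2 * e n * rnorm Y.
  by rewrite mulrC /B; case: cid.
exists B; split=> //.
apply: (has_integral_lim (r := fun n => 2 * e n) _ (fun n => has_integral_ddp (P n))) => //.
  by apply: rateZ => //; exact: rate_inv.
by move=> n q; exact: ddp_ddext.
Qed.

End TorusCalculus.

(** Polarization: norms determine real parts of inner products, and [i x] in place of [x] gives the
    imaginary parts. *)
Lemma norm_preserving_isometric {R : realType} {V W : hilbertType R} (L : {linear V -> W}) :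
  (forall x, rnorm (L x) = rnorm x) -> forall x y, hdot (L x) (L y) = hdot x y.
Proof.
move=> Ln x y; have ReE u v : complex.Re (hdot (L u) (L v)) = complex.Re (hdot u v).
  have := qformD (hdot_psd W) (L u) (L v); rewrite -linearD -!sqr_rnorm !Ln !sqr_rnorm.
  rewrite (qformD (hdot_psd V)) => h; lra.
have := ReE ('i *: x) y; rewrite linearZ !hdotZl => h.
have := ReE x y; move: h; case: (hdot (L x) (L y)) => a b; case: (hdot x y) => a' b' /=.
by rewrite !mul0r !mul1r !sub0r => /oppr_inj -> ->.
Qed.

(** * Isometric embeddings and compressions *)

Section Dilation.
Context {R : realType} {H K : hilbertType R} (J : {linear H -> K}).
Hypothesis isoJ : isometric (@hdot R H) J.

Lemma isometric_rnorm x : rnorm (J x) = rnorm x.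
Proof.
apply/eqP; rewrite -(@eqrXn2 _ 2)// ?rnorm_ge0//; apply/eqP.
by apply: complexI; rewrite -!hdotxx isoJ.
Qed.

Lemma isometric_le x : rnorm (J x) <= rnorm x.
Proof. by rewrite isometric_rnorm. Qed.

(** [Sc] is the adjoint of [J]; it turns the relation [compression J B A] into a formula for [A]. *)
Lemma coisometry_exists : exists Sc : contr K H,
  (forall x, Sc (J x) = x) /\
  forall (B : K -> K) (A : H -> H), compression J B A -> forall x, A x = Sc (B (J x)).
Proof.
have J1 x : rnorm (J x) <= 1 * rnorm x by rewrite mul1r isometric_le.
have [S [SJ Sn]] := adjoint_exists ler01 J1.
have S1 y : rnorm (S y) <= rnorm y by rewrite -[leRHS]mul1r.
exists (Contr S1); split=> [x|B A BA x]; apply: hdot_eq => z; rewrite SJ ?isoJ//.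
by apply/eqP; rewrite -isoJ eq_sym -subr_eq0 -hdotBl BA.
Qed.

End Dilation.

(** * Double operator integrals by compression *)

Section DilatedDOI.
Context {R : realType} {H K : hilbertType R} d {X : measurableType d}.
Variables (J : contr H K) (S : contr K H).
Hypothesis SJ : forall x, S (J x) = x.
Variables (E : set X -> {linear H -> H}) (EK : set X -> {linear K -> K}).
Hypothesis EE : forall D, measurable D -> forall x, E D x = S (EK D (J x)).
Variable G : set (X * X) -> {linear S2 K -> S2 K}.
Hypothesis spG : spectral G.
Hypothesis GX : forall A B, measurable A -> measurable B -> forall (Y : S2 K) x,
  val (G (A `*` B) Y) x = EK A (val Y (EK B x)).

Let JJ : {linear S2 H -> S2 K} := sandwich J S.
Let CC : {linear S2 K -> S2 H} := sandwich S J.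

Let CJ A : CC (JJ A) = A.
Proof. by apply: S2_eq => x; rewrite !sandwichE !SJ. Qed.

Lemma sandwich_isometric : isometric (@hs_dot R H) JJ.
Proof.
move=> A B; rewrite norm_preserving_isometric// => {B}A'.
apply/eqP; rewrite eq_le sandwich_contr/= -[in leLHS](CJ A'); exact: sandwich_contr.
Qed.

(** [CC] is a contractive left inverse of the contraction [JJ], so [JJ] after [CC] is a contractive
    idempotent, hence the orthogonal projection onto the range of [JJ]. *)
Let sandwich_proj A B : hdot (JJ A) (B - JJ (CC B)) = 0.
Proof.
have Pc B' : rnorm ((JJ \o CC : {linear S2 K -> S2 K}) B') <= rnorm B'.
  exact: le_trans (sandwich_contr _ _ _) (sandwich_contr _ _ _).
have PP B' : (JJ \o CC : {linear S2 K -> S2 K}) ((JJ \o CC : {linear S2 K -> S2 K}) B') =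
    (JJ \o CC : {linear S2 K -> S2 K}) B'.
  exact: (congr1 JJ (CJ (CC B'))).
transitivity (hdot (JJ (CC (JJ A))) (B - JJ (CC B))); first by rewrite CJ.
exact: (proj_orthogonal Pc PP).
Qed.

Lemma sandwich_compression (B : S2 K -> S2 K) : compression JJ B (fun A => CC (B (JJ A))).
Proof. by move=> A A'; rewrite hdotC sandwich_proj conjC0. Qed.

Let CC_adjoint B A : hs_dot (CC B) A = hdot B (JJ A).
Proof.
rewrite -sandwich_isometric; apply/eqP; rewrite eq_sym -subr_eq0 -hdotBl.
by rewrite hdotC sandwich_proj conjC0.
Qed.

Definition dilated_measure (D : set (X * X)) : {linear S2 H -> S2 H} :=
  (CC \o (G D \o JJ : {linear S2 H -> S2 K}))%FUN.

Lemma dilated_measureE D A : dilated_measure D A = CC (G D (JJ A)).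
Proof. by []. Qed.

Lemma dilated_measure_semi_spectral : semi_spectral hs_dot dilated_measure.
Proof.
have [[Gbp _ _ Gs] _] := spG; split.
- move=> D mD; split.
    exists 1 => A; rewrite mul1r -!S2_hdot !hdotxx lecR lerXn2r ?nnegrE ?rnorm_ge0//.
    rewrite dilated_measureE (le_trans (sandwich_contr _ _ _))//.
    exact: le_trans (spectral_contr spG _ mD) (sandwich_contr _ _ _).
  by move=> A; rewrite dilated_measureE CC_adjoint; have [_] := Gbp D mD.
- by move=> A; rewrite dilated_measureE (spectral0 spG) linear0.
- by move=> A; rewrite dilated_measureE (spectralT spG) CJ.
move=> D mD tD A B; rewrite dilated_measureE CC_adjoint.
have -> : (fun n => \sum_(i < n) hs_dot (dilated_measure (D i) A) B) =
    (fun n => \sum_(i < n) hdot (G (D i) (JJ A)) (JJ B)).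
  by apply/funext => n; apply: eq_bigr => i _; rewrite dilated_measureE CC_adjoint.
exact: Gs.
Qed.

Lemma dilated_measureX D1 D2 : measurable D1 -> measurable D2 -> forall (A : S2 H) x,
  val (dilated_measure (D1 `*` D2) A) x = E D1 (val A (E D2 x)).
Proof. by move=> m1 m2 A x; rewrite dilated_measureE sandwichE GX// sandwichE !EE. Qed.

Lemma dilated_double_operator_integral Phi B Q D : spectral_integral G Phi B ->
  CC (B (JJ Q)) = D -> double_operator_integral E E Phi Q D.
Proof.
move=> PhiB BQ; exists dilated_measure, (fun A => CC (B (JJ A))); split=> //.
- exact: dilated_measure_semi_spectral.
- exact: dilated_measureX.
exists (S2 K), JJ, G, B; split=> //; last exact: sandwich_compression.
split=> //; first exact: sandwich_isometric.
by move=> D' mD; exact: sandwich_compression.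
Qed.

(** The compression is exact on each monomial: [S U^j (J Q S) U^k J = T^j Q T^k]. *)
Lemma dilated_ddop (T : contr H H) (U : contr K K) p Q :
  (forall n x, iter n T x = S (iter n U (J x))) ->
  CC (ddop p U U (JJ Q)) = ddop p T T Q.
Proof.
move=> TU; rewrite /ddop /dd_sum linear_sum; apply: eq_bigr => j _.
rewrite linear_sum; apply: eq_bigr => k _; rewrite linearZ_LR; congr (_ *: _).
by apply: S2_eq => x; rewrite !sandwichE !contr_iterE !TU.
Qed.

End DilatedDOI.

(** * The segment between two contractions *)

Section Segment.
Context {R : realType} {H : hilbertType R} (T S : {linear H -> H}).
Hypotheses (Tc : contraction_op T) (Sc : contraction_op S).

Lemma segment_op_linear t : linear (segment_op T S t).
Proof.
move=> a x y; rewrite /segment_op (linearP T) (linearP S) !scalerDr !scalerA !(mulrC a).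
by rewrite addrACA.
Qed.

Lemma contraction_op_rnorm (A : H -> H) x : contraction_op A -> rnorm (A x) <= rnorm x.
Proof. by move=> /(_ x); rewrite !rnormE lecR. Qed.

(** Convexity gives a contraction only for parameters in [0, 1]; clamping makes [segment_contr]
    total. *)
Let clamp (t : R) := Num.max 0 (Num.min 1 t).

Let clamp01 t : 0 <= clamp t <= 1.
Proof. by rewrite le_max lexx/= ge_max ler01 ge_min lexx. Qed.

Let clamp_id t : 0 <= t <= 1 -> clamp t = t.
Proof. by move=> /andP[t0 t1]; rewrite /clamp (min_idPr t1) (max_idPr t0). Qed.

Lemma segment_contr_subproof t x : rnorm (mk_linear (segment_op_linear (clamp t)) x) <= rnorm x.
Proof.
have /andP[t0 t1] := clamp01 t; rewrite mk_linearE /segment_op (le_trans (rnormD _ _))//.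
rewrite !rnormZ !cabsR !ger0_norm ?subr_ge0//.
have -> : rnorm x = (1 - clamp t) * rnorm x + clamp t * rnorm x by rewrite -mulrDl subrK mul1r.
by rewrite lerD// ler_wpM2l ?subr_ge0//; exact: contraction_op_rnorm.
Qed.

Definition segment_contr t : contr H H := Contr (segment_contr_subproof t).

Lemma segment_contrE t : 0 <= t <= 1 -> segment_contr t = segment_op T S t :> (H -> H).
Proof. by move=> t01; rewrite -[in RHS](clamp_id t01). Qed.

Lemma segment_contrB s t x : 0 <= s <= 1 -> 0 <= t <= 1 ->
  segment_contr s x - segment_contr t x = (s - t)%:C *: (S x - T x).
Proof.
move=> s01 t01; rewrite !segment_contrE// /segment_op scalerBr opprD addrACA -!scalerBl.
rewrite -!rmorphB addrC; congr (_ + _).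
by rewrite -scaleNr -rmorphN; congr (_%:C *: _); ring.
Qed.

End Segment.

Theorem theorem6p1 (R : realType) (phi : R[i] -> R[i]) (H : hilbertType R)
    (T S : {linear H -> H}) :
  analytic_disk phi -> in_disk_algebra (derive1 phi) ->
  contraction_op T -> contraction_op S ->
  hilbert_schmidt (fun x => T x - S x) ->
  (forall t : R, 0 <= t <= 1 -> exists D : S2 H,
     hs_derivative (fun s => disk_calculus phi (segment_op T S s)) t D) /\
  (forall E : set (circle R) -> {linear H -> H}, semi_spectral_of T E ->
     exists Q D : S2 H,
       [/\ forall x, val Q x = S x - T x,
           hs_derivative (fun s => disk_calculus phi (segment_op T S s)) 0 D &
           double_operator_integral E E (divided_difference phi) Q D]).
Proof.
move=> phiA dphiA Tc Sc hTS.
have [P [Pphi dPphi]] := disk_algebra_approximation phiA dphiA.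
pose X : S2 H := - mkS2 hTS.
have XE x : val X x = S x - T x by rewrite S2N mkS2E opprB.
pose C := segment_contr Tc Sc.
have der t L : 0 <= t <= 1 ->
    (forall n, rnorm (ddop (P n) (C t) (C t) X - L) <= rnorm X * (2 * n.+1%:R^-1)) ->
    hs_derivative (fun s => disk_calculus phi (segment_op T S s)) t L.
  move=> t01 hL; apply: (disk_calculus_hs_derivative Pphi dPphi (C := C) (X := X)) => //.
    by move=> s s01; rewrite segment_contrE.
  by move=> s x ts01; rewrite segment_contrB// XE addrAC subrr add0r.
split=> [t t01|E].
  have [L hL] := ddop_limit dPphi (C t) (C t) X.
  by exists L; exact: der.
move=> [K [J [U [EU [isoJ [[isoU _] powU] [spEU intU] EE]]]]].
have [L hL] := ddop_limit dPphi (C 0) (C 0) X.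
have zero01 : (0 : R) <= 0 <= 1 by rewrite lexx /=.
exists X, L; split=> //; first exact: der.
have [G [spG GX]] := product_spectral spEU.
pose Jc := Contr (isometric_le isoJ); pose Uc := Contr (isometric_le isoU).
have [Sj [SJ comp]] := coisometry_exists isoJ.
have TE n x : iter n (C 0) x = Sj (iter n Uc (Jc x)).
  rewrite -(comp _ _ (powU n)); congr (iter n _ x).
  by apply/funext => y; rewrite segment_contrE// /segment_op subr0 scale1r scale0r addr0.
have circ z : cabs (circle_val z) <= 1 :> R.
  by have /eqP := svalP z; rewrite normcE => /complexI ->.
have fU : has_integral EU circle_val Uc := spectral_integralP intU.
have [B [intB hB]] := has_integral_ddext spEU spG GX circ fU Pphi dPphi.
apply: (dilated_double_operator_integral (J := Jc) (S := Sj) SJ _ spG GX (B := B)).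
- by move=> D mD x; exact: comp (EE D mD) x.
- exact: has_integralP intB.
(* The compression of [B] and the derivative [L] are both limits of the operators [ddop (P N)] for
   [T], each with error at most [2 / (N + 1)] times the norm of [X]; hence the constant 4. *)
apply: rnorm_small_eq => e e0.
have c0 : 0 <= 4 * rnorm X by rewrite mulr_ge0 ?rnorm_ge0.
have [N /(_ N (leqnn N)) hN] := rateZ c0 (@rate_inv R) e0; apply: le_trans hN.
have h1 := hB N (sandwich Jc Sj X); have h2 := hL N.
have h3 : rnorm (sandwich Jc Sj X) <= rnorm X := sandwich_contr _ _ _.
rewrite -(dilated_ddop (P N) X TE) in h2.
rewrite (le_trans (rnorm_dist_triangle _ _ (sandwich Sj Jc (ddop (P N) Uc Uc (sandwich Jc Sj X)))))//.
have -> : 4 * rnorm X * N.+1%:R^-1 = 2 * N.+1%:R^-1 * rnorm X + rnorm X * (2 * N.+1%:R^-1) by ring.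
rewrite lerD// -linearB (le_trans (sandwich_contr _ _ _))// rnorm_distC (le_trans h1)//.
by rewrite ler_wpM2l// mulr_ge0// invr_ge0.
Qed.
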